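(* For every fixed $m\ge1$ there exists a deterministic algorithm which, given integer vectors $\mathbf i,\mathbf a,\mathbf b\in\mathbb Z_{>0}^m$ with $i_ja_j=i_{j+1}b_{j+1}$ for $j=1,\dots,m$ (indices modulo $m$) and an integer vector $\mathbf t$ with $0\le t_j<a_j$ for all $j$, computes the output $\boldsymbol\psi(\mathbf t)$ of the continuous O'Hara algorithm in polynomial time (i.e. in a number of steps bounded by a polynomial in the logarithm of the largest entry of the input).
   Context: Continuous O'Hara algorithm: with indices modulo $m$ (so $s_0=s_m$, $a_0=a_m$), on input $\mathbf t\in[0,a_1)\times\cdots\times[0,a_m)$ set $\mathbf s\leftarrow\mathbf t$; while some coordinate satisfies $s_j\ge b_j$, choose such a $j$ and replace $s_j\leftarrow s_j-b_j$, $s_{j-1}\leftarrow s_{j-1}+a_{j-1}$. When the loop terminates, output $\boldsymbol\psi(\mathbf t)=\mathbf s$. (The algorithm terminates, and the output is independent of the choices made; $\boldsymbol\psi$ is a bijection from $[0,a_1)\times\cdots\times[0,a_m)$ onto $[0,b_1)\times\cdots\times[0,b_m)$.) *)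

(* Defs.v *)
From HB Require Import structures.
From mathcomp Require Import all_boot all_order all_algebra.
Set Implicit Arguments.
Unset Strict Implicit.
Unset Printing Implicit Defensive.
Import Order.TTheory GRing.Theory Num.Theory.
Local Open Scope ring_scope.

(** * The continuous O'Hara algorithm

    Coordinates are numbered from 0, and [ord_pred] is the cyclic predecessor.
    Writing the update as a sum of vectors makes the case [m = 1], where [j]
    and [ord_pred j] coincide, come out right.  The scalars are generic: the
    reals are one instance and [int] is another. *)
Section OHara.
Variables (R : realDomainType) (m : nat).
Implicit Types (a b s u : 'rV[R]_m) (j : 'I_m).

Definition ohara_fire a b s j : 'rV[R]_m :=
  s - b 0 j *: delta_mx 0 j
    + a 0 (ord_pred j) *: delta_mx 0 (ord_pred j).

(** [ohara_output a b t s]: some run of the loop started at [t] terminates and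
    returns [s].  The choice of [j] is free in each round, but
    [ohara_output_fire] and [ohara_output_inj] below show that the result does
    not depend on it. *)
Inductive ohara_output a b : 'rV[R]_m -> 'rV[R]_m -> Prop :=
| ohara_stop s :
    (forall j, s 0 j < b 0 j) -> ohara_output a b s s
| ohara_loop s u j :
    b 0 j <= s 0 j -> ohara_output a b (ohara_fire a b s j) u ->
    ohara_output a b s u.

Lemma ohara_fireC a b s j k :
  ohara_fire a b (ohara_fire a b s j) k = ohara_fire a b (ohara_fire a b s k) j.
Proof.
rewrite /ohara_fire -!addrA; congr (_ + _).
by rewrite addrA [RHS]addrA addrC.
Qed.

Lemma ohara_fire_other a b s j k :
  (forall l, 0 <= a 0 l) -> j != k -> s 0 k <= ohara_fire a b s j 0 k.
Proof.
move=> a_ge0 jk; rewrite /ohara_fire !mxE /= eq_sym (negPf jk) mulr0 subr0.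
by rewrite lerDl mulr_ge0 // ler0n.
Qed.

Lemma ohara_output_fire a b s u j :
  (forall l, 0 <= a 0 l) -> b 0 j <= s 0 j ->
  ohara_output a b s u -> ohara_output a b (ohara_fire a b s j) u.
Proof.
move=> a_ge0 + out; elim: out j => {s u} [s lt_sb j|s u k le_bs out IH j] le_j.
  by have := lt_sb j; rewrite ltNge le_j.
have [-> //|jk] := eqVneq j k.
apply: (@ohara_loop _ _ _ _ k).
  by apply: le_trans le_bs _; apply: ohara_fire_other.
rewrite ohara_fireC; apply: IH.
by apply: le_trans le_j _; apply: ohara_fire_other; rewrite // eq_sym.
Qed.

Lemma ohara_output_inj a b s u u' :
  (forall l, 0 <= a 0 l) ->
  ohara_output a b s u -> ohara_output a b s u' -> u = u'.
Proof.
move=> a_ge0 out; elim: out u' => {s u} [s lt_sb|s u j le_j _ IH] u' out'.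
  case: out' lt_sb => // {}s {}u' j le_j _ lt_sb.
  by have := lt_sb j; rewrite ltNge le_j.
by apply: IH; apply: ohara_output_fire.
Qed.

End OHara.

(** * Deterministic algorithms and their bit cost

    Programs act on integer registers, all but finitely many of which a given
    program never touches.  There is no indirect addressing.  Time is the
    logarithmic cost: an elementary operation is charged the number of bits of
    its operands, or the product of the two lengths for multiplication and
    division (the schoolbook cost).  A result is at most one bit longer than
    the cost charged for it, so running times agree with those of multitape Turing
    machines up to a polynomial. *)
Definition store := nat -> int.

Inductive prog :=
| Const (x : nat) (c : int)
| Copy (x y : nat)
| Add (x y z : nat)
| Sub (x y z : nat)
| Mul (x y z : nat)
| Div (x y z : nat)
| Seq (p q : prog)
| IfPos (x : nat) (p q : prog)
| WhilePos (x : nat) (p : prog).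

Definition upd (st : store) (x : nat) (v : int) : store :=
  fun y => if y == x then v else st y.

(** Binary length; it is 1 for 0, so that every operation has positive cost. *)
Definition bits (z : int) : nat := (trunc_log 2 `|z|%N).+1.

(** [exec p st st' n]: started in [st], the program [p] halts in [st'] after
    time [n].  Division is Euclidean, with quotient 0 for the divisor 0. *)
Inductive exec : prog -> store -> store -> nat -> Prop :=
| exec_const x c st :
    exec (Const x c) st (upd st x c) (bits c)
| exec_copy x y st :
    exec (Copy x y) st (upd st x (st y)) (bits (st y))
| exec_add x y z st :
    exec (Add x y z) st (upd st x (st y + st z)) (bits (st y) + bits (st z))%N
| exec_sub x y z st :
    exec (Sub x y z) st (upd st x (st y - st z)) (bits (st y) + bits (st z))%N
| exec_mul x y z st :
    exec (Mul x y z) st (upd st x (st y * st z)) (bits (st y) * bits (st z))%N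
| exec_div x y z st :
    exec (Div x y z) st (upd st x (st y %/ st z)%Z)
      (bits (st y) * bits (st z))%N
| exec_seq p q st st1 st2 n1 n2 :
    exec p st st1 n1 -> exec q st1 st2 n2 ->
    exec (Seq p q) st st2 (n1 + n2)%N
| exec_if_pos x p q st st' n :
    0 < st x -> exec p st st' n ->
    exec (IfPos x p q) st st' (bits (st x) + n)%N
| exec_if_npos x p q st st' n :
    st x <= 0 -> exec q st st' n ->
    exec (IfPos x p q) st st' (bits (st x) + n)%N
| exec_while_stop x p st :
    st x <= 0 -> exec (WhilePos x p) st st (bits (st x))
| exec_while_loop x p st st1 st2 n1 n2 :
    0 < st x -> exec p st st1 n1 -> exec (WhilePos x p) st1 st2 n2 ->
    exec (WhilePos x p) st st2 (bits (st x) + n1 + n2)%N.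

Lemma exec_deterministic p st st1 st2 n1 n2 :
  exec p st st1 n1 -> exec p st st2 n2 -> st1 = st2 /\ n1 = n2.
Proof.
move=> e1; elim: e1 st2 n2 => {p st st1 n1}; try by
  move=> *; match goal with H : exec _ _ _ _ |- _ => inversion H; subst end.
- move=> p q st st1 st2 n1 n2 _ IH1 _ IH2 st3 n3 e.
  inversion e; subst.
  have [? ?] := IH1 _ _ ltac:(eassumption); subst.
  by have [-> ->] := IH2 _ _ ltac:(eassumption).
- move=> x p q st st' n x_gt0 _ IH st3 n3 e.
  inversion e as [| | | | | | |? ? ? ? ? ? ? e'|? ? ? ? ? ? x_le0| |]; subst.
    by have [-> ->] := IH _ _ e'.
  by move: x_gt0; rewrite ltNge x_le0.
- move=> x p q st st' n x_le0 _ IH st3 n3 e.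
  inversion e as [| | | | | | |? ? ? ? ? ? x_gt0|? ? ? ? ? ? ? e'| |]; subst.
    by move: x_gt0; rewrite ltNge x_le0.
  by have [-> ->] := IH _ _ e'.
- move=> x p st x_le0 st3 n3 e.
  inversion e as [| | | | | | | | | |? ? ? ? ? ? ? x_gt0]; subst => //.
  by move: x_gt0; rewrite ltNge x_le0.
move=> x p st st1 st2 n1 n2 x_gt0 _ IH1 _ IH2 st3 n3 e.
inversion e as [| | | | | | | | |? ? ? x_le0|? ? ? ? ? ? ? ? e1 e2]; subst.
  by move: x_gt0; rewrite ltNge x_le0.
have [? ?] := IH1 _ _ e1; subst.
by have [-> ->] := IH2 _ _ e2.
Qed.

(** * Input and output conventions *)

Definition entries m (v : 'rV[int]_m) : seq int := [seq v 0 j | j <- enum 'I_m].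

(** Registers [0 .. 4m-1] hold the entries of [i], [a], [b], [t] in this
    order; all other registers hold 0. *)
Definition input_store m (i a b t : 'rV[int]_m) : store :=
  nth 0 (entries i ++ entries a ++ entries b ++ entries t).

(** The output vector is read off registers [0 .. m-1]. *)
Definition output_vec m (st : store) : 'rV[int]_m := \row_(j < m) st j.

Definition largest_entry m (i a b t : 'rV[int]_m) : nat :=
  (\max_(x <- entries i ++ entries a ++ entries b ++ entries t) `|x|)%N.

(* Main.v *)
(** Let [k j] count the firings of coordinate [j].  The loop stops at the least
    vector [k >= 0] with [t j - b j * k j + a j * k (j + 1) < b j] for all [j]:
    by induction, no run fires a coordinate more often than such a vector
    allows.  The relation between [i], [a] and [b] gives an explicit vector of
    this kind with polynomially many bits, so [k] is found by binary search on
    the sum of its entries, each test being an integer program in [m] variables.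

    Integer programming in fixed dimension is solved in the spirit of Lenstra
    and of Lovasz and Scarf.  A body is the cone over the rational points of a
    polytope, given by generators.  A full-dimensional body either contains an
    integer point that we find, or is narrow in an integral direction [y] that
    we find: cut the body in the middle of its extent along [y] and recurse on
    the slice.  If the slice has no point but is narrow along [y'], then
    [y' - r * y] for a suitable integer [r] has at most 3/4 of the width of [y],
    because up to a shear the body is about as wide along [y'] as its middle
    slice.  A body which is narrow along [y] has boundedly many slices with
    [y] integral, which are bodies of smaller dimension. *)
Require Import Defs.
From HB Require Import structures.
From mathcomp Require Import all_boot all_order all_algebra.
From mathcomp Require Import zify ring lra.
Set Implicit Arguments.
Unset Strict Implicit.
Unset Printing Implicit Defensive.
Import Order.TTheory GRing.Theory Num.Theory.
Local Open Scope ring_scope.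

(** * Polynomial-time computable functions *)

(** Constants: suppose the extent along [y] is [h >= 6] and the slice lies at the integer just below
    the middle. Then at least a third of the extent is on either side. If the slice has width at
    most [C] along [y'], every point is within [3 C] of the chord joining the two extreme points,
    measured in the plane of values along [y] and [y']. Two points deviate by at most [6 C <= h / 4]
    once [h >= 24 C], and rounding the slope of the chord to [r] costs at most [h / 2]. Hence the
    factor 3/4 and the recursion from [C] to [24 C + 6]. Sizes: directions are never reduced. On a
    full-dimensional body a form is determined by its values on the generators, so a direction of
    bounded width has few bits of its own accord, and the width never grows during the search.
    Composition: the number of generators is squared by each half-space and the exponents grow with
    the dimension, but only as a function of [m]. Inside a loop every state is bounded in terms of
    the original instance, so polynomial bounds are not compounded from round to round. *)

Lemma bits_gt0 z : (0 < bits z)%N.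
Proof. by []. Qed.

Lemma bits0 : bits 0 = 1%N.
Proof. by rewrite /bits absz0 trunc_log0. Qed.

Lemma abs_lt_bits z : (`|z| < 2 ^ bits z)%N.
Proof. exact: trunc_log_ltn. Qed.

Lemma bits_le_exp z e : (0 < e)%N -> (`|z| < 2 ^ e)%N -> (bits z <= e)%N.
Proof.
move=> e0 lt; rewrite /bits; have [->|z0] := posnP `|z|%N; first by rewrite trunc_log0.
rewrite -(ltn_exp2l _ _ (isT : (1 < 2)%N)); apply: leq_ltn_trans lt.
exact: trunc_logP.
Qed.

Lemma bits_mono z w : (`|z| <= `|w|)%N -> (bits z <= bits w)%N.
Proof. by move=> le; apply: bits_le_exp => //; apply: leq_ltn_trans le (abs_lt_bits w). Qed.

Lemma bits_add z w : (bits (z + w) <= bits z + bits w)%N.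
Proof.
apply: bits_le_exp; first by rewrite addn_gt0.
have := abs_lt_bits z; have := abs_lt_bits w.
have zp := bits_gt0 z; have wp := bits_gt0 w.
rewrite expnD.
have : (2 ^ 1 <= 2 ^ bits z)%N by rewrite leq_exp2l.
have : (2 ^ 1 <= 2 ^ bits w)%N by rewrite leq_exp2l.
have : (absz (z + w)%R <= absz z + absz w)%N by lia.
move: (2 ^ bits z)%N (2 ^ bits w)%N => A B; nia.
Qed.

Lemma bitsN z : bits (- z) = bits z.
Proof. by rewrite /bits abszN. Qed.

Lemma bits_mul z w : (bits (z * w) <= bits z + bits w)%N.
Proof.
apply: bits_le_exp; first by rewrite addn_gt0.
rewrite abszM expnD; apply: ltn_mul; exact: abs_lt_bits.
Qed.

Lemma bits_div z w : (bits (z %/ w)%Z <= bits z)%N.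
Proof.
apply: bits_mono; have [->|w0] := eqVneq w 0; first by rewrite divz0.
have := divz_eq z w; have := modz_ge0 z w0; have := ltz_mod z w0; nia.
Qed.

(** An operation costs almost as many bits as it produces, so time dominates length. Bounds on
    computed values can therefore be read off running times, as in [pf_bits]. *)
Lemma exec_bits P st st' n : exec P st st' n ->
  forall r, (bits (st' r) <= maxn (bits (st r)) n.+1)%N.
Proof.
have updB s x v r N : (bits v <= N.+1)%N -> (bits (upd s x v r) <= maxn (bits (s r)) N.+1)%N.
  by move=> h; rewrite /upd; case: ifP => _; rewrite leq_max ?h ?orbT ?leqnn.
elim=> {P st st' n}; try by move=> *; apply: updB; rewrite // ltnW.
- by move=> x y z s r; apply: updB; apply: ltnW; rewrite ltnS bits_add.
- by move=> x y z s r; apply: updB; apply: ltnW; rewrite ltnS -(bitsN (s z)) bits_add.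
- move=> x y z s r; apply: updB; apply: leq_trans (bits_mul _ _) _.
  have := bits_gt0 (s y); have := bits_gt0 (s z); nia.
- move=> x y z s r; apply: updB; apply: leq_trans (bits_div _ _) _.
  have := bits_gt0 (s y); have := bits_gt0 (s z); nia.
- move=> p q s s1 s2 n1 n2 _ IH1 _ IH2 r; have := IH1 r; have := IH2 r; lia.
- move=> x p q s s' n _ _ IH r; have := IH r; lia.
- move=> x p q s s' n _ _ IH r; have := IH r; lia.
- by move=> x p s _ r; rewrite leq_max leqnn.
move=> x p s s1 s2 n1 n2 _ _ IH1 _ IH2 r; have := IH1 r; have := IH2 r; lia.
Qed.

(** The base is at least 2 even when [sz x] is 0, so a larger exponent absorbs constants, sums and
    products. One exponent thus stands for an arbitrary polynomial. *)
Definition pbound (T : Type) (sz c : T -> nat) :=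
  exists e, forall x, (c x <= (sz x + 2) ^ e)%N.

Section PBound.
Variables (T : Type) (sz : T -> nat).
Implicit Types c d : T -> nat.

Lemma pbound_le c d : (forall x, (c x <= d x)%N) -> pbound sz d -> pbound sz c.
Proof. by move=> le [e h]; exists e => x; apply: leq_trans (le x) (h x). Qed.

Lemma pbound_cst k : pbound sz (fun=> k).
Proof.
exists k => x; apply: leq_trans (_ : 2 ^ k <= _)%N; first exact/ltnW/ltn_expl.
by case: k => // k; rewrite leq_exp2r ?leq_addl.
Qed.

Lemma pbound_sz : pbound sz sz.
Proof. by exists 1%N => x; rewrite expn1 leq_addr. Qed.

Lemma pboundM c d : pbound sz c -> pbound sz d -> pbound sz (fun x => c x * d x)%N.
Proof. by move=> [e he] [f hf]; exists (e + f)%N => x; rewrite expnD leq_mul. Qed.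

Lemma pboundS c : pbound sz c -> pbound sz (fun x => (c x).+1).
Proof.
move=> [e he]; exists e.+1 => x; have := he x.
have : (0 < (sz x + 2) ^ e)%N by rewrite expn_gt0 addn2.
rewrite expnS; move: ((sz x + 2) ^ e)%N => A; nia.
Qed.

Lemma pboundD c d : pbound sz c -> pbound sz d -> pbound sz (fun x => c x + d x)%N.
Proof.
move=> pc pd; apply: pbound_le (pboundM (pboundS pc) (pboundS pd)) => x; nia.
Qed.

Lemma pboundX c k : pbound sz c -> pbound sz (fun x => c x ^ k)%N.
Proof.
move=> [e he]; exists (e * k)%N => x; rewrite expnM.
by case: k => [|k]; rewrite ?expn0 // leq_exp2r.
Qed.
End PBound.

Lemma pbound_comp (T U : Type) (sz : T -> nat) (sz' : U -> nat) (phi : T -> U) c :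
  pbound sz (sz' \o phi) -> pbound sz' c -> pbound sz (c \o phi).
Proof.
move=> ps [e he]; apply: (@pbound_le _ _ _ (fun x => (sz' (phi x) + 2) ^ e)%N).
  by move=> x; apply: he.
by apply: pboundX; apply: pboundD => //; apply: pbound_cst.
Qed.

(** A context is a family of problem instances, each with a size and with the
    integers that describe it and are available in registers. *)
Record ctx := Ctx {
  inst :> Type;
  sz : inst -> nat;
  len : nat;
  enc : inst -> nat -> int;
  enc_bits : exists e, forall x i, (i < len)%N -> (bits (enc x i) <= (sz x + 2) ^ e)%N
}.
Arguments sz {c} : rename.
Arguments enc {c} : rename.

(** [pf f]: [f] is computed in polynomial time, from any input registers and
    without touching the registers below [k]. *)
Variant pf (c : ctx) (f : c -> int) : Prop := Pf of
  forall (rho : nat -> nat) k, (forall i, (i < len c)%N -> (rho i < k)%N) ->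
  exists P e, forall (x : c) (st : store),
    (forall i, (i < len c)%N -> st (rho i) = enc x i) ->
  exists st' n, [/\ exec P st st' n, forall r, (r < k)%N -> st' r = st r,
    st' k = f x & (n <= (sz x + 2) ^ e)%N].

Lemma pf_ext (c : ctx) (f g : c -> int) : f =1 g -> pf f -> pf g.
Proof.
move=> fg [pff]; split=> rho k rk; have [P [e h]] := pff rho k rk; exists P, e => x st hst.
by have [st' [n [? ? ? ?]]] := h x st hst; exists st', n; split; rewrite -?fg.
Qed.

Lemma pf_bits (c : ctx) (f : c -> int) : pf f -> pbound sz (fun x => bits (f x)).
Proof.
case=> pff; have [//|P [e h]] := pff id (len c).
suff: pbound sz (fun x : c => (((sz x + 2) ^ e).+1)%N).
  apply: pbound_le => x.
  pose st := fun r => if (r < len c)%N then enc x r else 0.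
  have [|st' [n [ex _ <- le]]] := h x st; first by move=> i il; rewrite /st il.
  apply: leq_trans (exec_bits ex (len c)) _; rewrite /st ltnn.
  by rewrite geq_max ltnS le andbT.
by apply: pboundS; exists e.
Qed.

(** The values are stored in consecutive registers, each computed with its scratch area above the
    earlier ones. This is why [pf] quantifies over the first free register [k]. *)
Lemma pf_fam (c : ctx) r (f : nat -> c -> int) :
  (forall i, (i < r)%N -> pf (f i)) ->
  forall (rho : nat -> nat) k, (forall i, (i < len c)%N -> (rho i < k)%N) ->
  exists P e, forall (x : c) (st : store),
    (forall i, (i < len c)%N -> st (rho i) = enc x i) ->
  exists st' n, [/\ exec P st st' n, forall q, (q < k)%N -> st' q = st q,
    forall i, (i < r)%N -> st' (k + i)%N = f i x & (n <= (sz x + 2) ^ e)%N].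
Proof.
move=> + rho k rk; elim: r => [|r IH] pff.
  exists (Const k 0), 1%N => x st _; exists (upd st k 0), (bits 0); split=> //.
  - exact: exec_const.
  - by move=> q qk; rewrite /upd ltn_eqF.
  - by rewrite bits0 expn1 addn2.
have [|P [e h]] := IH; first by move=> i ir; apply: pff; apply: ltnW.
have [pr] := pff r (ltnSn r).
have [|Q [e' h']] := pr rho (k + r)%N.
  by move=> i il; apply: leq_trans (rk i il) (leq_addr _ _).
have [E hE] : pbound sz (fun x : c => ((sz x + 2) ^ e + (sz x + 2) ^ e')%N).
  by apply: pboundD; [exists e | exists e'].
exists (Seq P Q), E => x st hst.
have [st1 [n1 [ex1 low1 out1 le1]]] := h x st hst.
have [|st2 [n2 [ex2 low2 out2 le2]]] := h' x st1.
  by move=> i il; rewrite low1 ?hst ?rk.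
exists st2, (n1 + n2)%N; split; first exact: exec_seq ex1 ex2.
- by move=> q qk; rewrite low2 ?low1 // (leq_trans qk) ?leq_addr.
- move=> i; rewrite ltnS leq_eqVlt => /orP[/eqP->//|ir].
  by rewrite low2 ?ltn_add2l // out1.
- by apply: leq_trans (hE x); apply: leq_add.
Qed.

(** Copying upwards is safe because the target block ends before the source block begins. Register
    [dst + r] is exempt from the frame condition: there is no idle instruction, so the copy of an
    empty block is [Const dst 0]. *)
Lemma exec_copies r src dst : (dst + r <= src)%N ->
  exists P, forall st B, (forall i, (i < r)%N -> (bits (st (src + i)%N) <= B)%N) ->
  exists st' n, [/\ exec P st st' n,
    forall q, (q < dst)%N || (dst + r < q)%N -> st' q = st q,
    forall i, (i < r)%N -> st' (dst + i)%N = st (src + i)%N & (n <= r * B + 1)%N].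
Proof.
elim: r => [|r IH] le.
  exists (Const dst 0) => st B _; exists (upd st dst 0), (bits 0).
  split=> //; first exact: exec_const.
  - by move=> q; rewrite addn0 /upd; case: ltngtP.
have [|P hP] := IH; first by lia.
exists (Seq P (Copy (dst + r) (src + r))%N) => st B hB.
have [|st1 [n1 [ex1 low1 out1 le1]]] := hP st B; first by move=> i ir; apply: hB; lia.
have E : st1 (src + r)%N = st (src + r)%N by apply: low1; lia.
exists (upd st1 (dst + r)%N (st1 (src + r)%N)), (n1 + bits (st1 (src + r)%N))%N; split.
- by apply: exec_seq ex1 _; apply: exec_copy.
- by move=> q hq; rewrite /upd ifF; [apply: low1; lia | lia].
- move=> i ir; rewrite /upd eqn_add2l; case: eqP => [->|ne]; first exact: E.
  by apply: out1; lia.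
- have := hB r (ltnSn r); rewrite E mulSn; lia.
Qed.

Section Ops.
Variable c : ctx.
Implicit Types f g h : c -> int.

Lemma pf_cst a : pf (fun _ : c => a).
Proof.
split=> rho k rk; have [e he] := pbound_cst (@sz c) (bits a).
exists (Const k a), e => x st _; exists (upd st k a), (bits a); split=> //.
- exact: exec_const.
- by move=> q qk; rewrite /upd ltn_eqF.
- by rewrite /upd eqxx.
Qed.

Lemma pf_proj i : (i < len c)%N -> pf (fun x : c => enc x i).
Proof.
move=> il; split=> rho k rk; have [e he] := enc_bits c.
exists (Copy k (rho i)), e => x st hst; exists (upd st k (st (rho i))), (bits (st (rho i))).
split; first exact: exec_copy.
- by move=> q qk; rewrite /upd ltn_eqF.
- by rewrite /upd eqxx hst.
- by rewrite hst // he.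
Qed.

Lemma pf_op2 (op : nat -> nat -> nat -> prog) (o : int -> int -> int) (cost : nat -> nat -> nat) f g :
  (forall x y z st, exec (op x y z) st (upd st x (o (st y) (st z)))
     (cost (bits (st y)) (bits (st z)))) ->
  (forall c1 c2 : c -> nat, pbound sz c1 -> pbound sz c2 -> pbound sz (fun x => cost (c1 x) (c2 x))) ->
  pf f -> pf g -> pf (fun x => o (f x) (g x)).
Proof.
move=> exop bop pff pfg; split=> rho k rk.
have [|P [e hP]] := @pf_fam c 2 (fun i => if i == 0%N then f else g) _ rho k rk.
  by case=> [|[]].
have [e' he'] : pbound sz (fun x => (sz x + 2) ^ e + cost (bits (f x)) (bits (g x)))%N.
  apply: pboundD; first by exists e.
  by apply: bop; apply: pf_bits.
exists (Seq P (op k k k.+1)), e' => x st hst.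
have [st1 [n1 [ex1 low1 out1 le1]]] := hP x st hst.
have E0 : st1 k = f x by have := out1 0%N isT; rewrite addn0.
have E1 : st1 k.+1 = g x by have := out1 1%N isT; rewrite addn1.
exists (upd st1 k (o (st1 k) (st1 k.+1))), (n1 + cost (bits (st1 k)) (bits (st1 k.+1)))%N; split.
- exact: exec_seq ex1 (exop _ _ _ _).
- by move=> q qk; rewrite /upd ltn_eqF // low1.
- by rewrite /upd eqxx E0 E1.
- by rewrite E0 E1; apply: leq_trans (he' x); rewrite leq_add2r.
Qed.

Lemma pf_add f g : pf f -> pf g -> pf (fun x => f x + g x).
Proof.
refine (@pf_op2 Add (fun a b => a + b) addn f g _ _); last by move=> *; apply: pboundD.
by move=> x y z st; apply: exec_add.
Qed.

Lemma pf_sub f g : pf f -> pf g -> pf (fun x => f x - g x).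
Proof.
refine (@pf_op2 Defs.Sub (fun a b => a - b) addn f g _ _); last by move=> *; apply: pboundD.
by move=> x y z st; apply: exec_sub.
Qed.

Lemma pf_mul f g : pf f -> pf g -> pf (fun x => f x * g x).
Proof.
refine (@pf_op2 Mul (fun a b => a * b) muln f g _ _); last by move=> *; apply: pboundM.
by move=> x y z st; apply: exec_mul.
Qed.

Lemma pf_div f g : pf f -> pf g -> pf (fun x => (f x %/ g x)%Z).
Proof.
refine (@pf_op2 Div divz muln f g _ _); last by move=> *; apply: pboundM.
by move=> x y z st; apply: exec_div.
Qed.

Lemma pf_opp f : pf f -> pf (fun x => - f x).
Proof. by move=> pff; apply: pf_ext (pf_sub (pf_cst 0) pff) => x; rewrite sub0r. Qed.

Lemma pf_mod f g : pf f -> pf g -> pf (fun x => (f x %% g x)%Z).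
Proof.
move=> pff pfg; apply: pf_ext (pf_sub pff (pf_mul (pf_div pff pfg) pfg)) => x.
by rewrite {1}(divz_eq (f x) (g x)) addrC addKr.
Qed.

Lemma pf_sum (T : Type) (s : seq T) (p : pred T) (F : T -> c -> int) :
  (forall i, pf (F i)) -> pf (fun x => \sum_(i <- s | p i) F i x).
Proof.
move=> pF; elim: s => [|i s IH].
  by apply: pf_ext (pf_cst 0) => x; rewrite big_nil.
case E: (p i); last by apply: pf_ext IH => x; rewrite big_cons E.
by apply: pf_ext (pf_add (pF i) IH) => x; rewrite big_cons E.
Qed.

(** An instance carries a proof of [p] that the registers do not encode. A branch of a program can
    thus be developed under the condition that was tested. *)
Definition sub_ctx (p : c -> Prop) : ctx.
Proof.
apply: (@Ctx {x : c | p x} (fun x => sz (sval x)) (len c) (fun x => enc (sval x))).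
by have [e he] := enc_bits c; exists e => x; apply: he.
Defined.

Lemma pf_case f g :
  pf g -> @pf (sub_ctx (fun x => 0 < g x)) (fun x => f (sval x)) ->
  @pf (sub_ctx (fun x => g x <= 0)) (fun x => f (sval x)) -> pf f.
Proof.
move=> pfg [p1] [p2]; split=> rho k rk.
have [P [e hP]] := let: Pf h := pfg in h rho k rk.
have [P1 [e1 h1]] := p1 rho k rk; have [P2 [e2 h2]] := p2 rho k rk.
have [E hE] : pbound sz (fun x => (sz x + 2) ^ e + (bits (g x) + ((sz x + 2) ^ e1 + (sz x + 2) ^ e2)))%N.
  apply: pboundD; first by exists e.
  apply: pboundD; first exact: pf_bits.
  by apply: pboundD; [exists e1 | exists e2].
exists (Seq P (IfPos k P1 P2)), E => x st hst.
have [st1 [n1 [ex1 low1 out1 le1]]] := hP x st hst.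
have hst1 i : (i < len c)%N -> st1 (rho i) = enc x i by move=> il; rewrite low1 ?hst ?rk.
have [pos|npos] := boolP (0 < g x).
  have [st2 [n2 [ex2 low2 out2 le2]]] := h1 (exist _ x pos) st1 hst1.
  exists st2, (n1 + (bits (st1 k) + n2))%N; split=> //.
  - by apply: exec_seq ex1 _; apply: exec_if_pos => //; rewrite out1.
  - by move=> r rk'; rewrite low2 ?low1.
  - rewrite out1; apply: leq_trans (hE x); rewrite /= in le2; lia.
have npos' : g x <= 0 by rewrite leNgt.
have [st2 [n2 [ex2 low2 out2 le2]]] := h2 (exist _ x npos') st1 hst1.
exists st2, (n1 + (bits (st1 k) + n2))%N; split=> //.
- by apply: exec_seq ex1 _; apply: exec_if_npos => //; rewrite out1.
- by move=> r rk'; rewrite low2 ?low1.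
- rewrite out1; apply: leq_trans (hE x); rewrite /= in le2; lia.
Qed.
End Ops.

(** A reduction between problems: the encoding of [phi x] is written to fresh registers, and the
    program for [h] runs with its input placement [rho] pointing there. *)
Lemma pf_comp (c d : ctx) (phi : c -> d) (h : d -> int) :
  (forall i, (i < len d)%N -> pf (fun x => enc (phi x) i)) ->
  pbound sz (fun x => sz (phi x)) -> pf h -> pf (fun x => h (phi x)).
Proof.
move=> penc psz ph; split=> rho k rk.
have [P [e hP]] := pf_fam penc rk.
have [hh] := ph.
have [|Q [e' hQ]] := hh (fun i => k + i)%N (k + len d)%N; first by move=> i il; rewrite ltn_add2l.
have [E hE] : pbound sz (fun x => (sz x + 2) ^ e + ((sz (phi x) + 2) ^ e' + bits (h (phi x))))%N.
  apply: pboundD; first by exists e.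
  apply: pboundD.
    by apply: (pbound_comp (phi := phi) (c := fun y => ((sz y + 2) ^ e')%N) psz); exists e'.
  exact: (pbound_comp (phi := phi) (c := fun y => bits (h y)) psz (pf_bits ph)).
exists (Seq (Seq P Q) (Copy k (k + len d)%N)), E => x st hst.
have [st1 [n1 [ex1 low1 out1 le1]]] := hP x st hst.
have [|st2 [n2 [ex2 low2 out2 le2]]] := hQ (phi x) st1; first exact: out1.
exists (upd st2 k (st2 (k + len d)%N)), (n1 + n2 + bits (st2 (k + len d)%N))%N; split.
- by apply: exec_seq (exec_seq ex1 ex2) _; apply: exec_copy.
- by move=> q qk; rewrite /upd ltn_eqF // low2 ?low1 // ltn_addr.
- by rewrite /upd eqxx.
- by apply: leq_trans (hE x); rewrite out2 addnA leq_add2r leq_add.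
Qed.

Lemma pf_sub_ctx (c : ctx) (p : c -> Prop) f :
  pf f -> @pf (sub_ctx p) (fun x => f (sval x)).
Proof.
apply: (@pf_comp (sub_ctx p) c sval) => [i il|]; last exact: pbound_sz.
exact: (@pf_proj (sub_ctx p)).
Qed.

Lemma pf_if (c : ctx) (f g h : c -> int) :
  pf g -> pf f -> pf h -> pf (fun x => if 0 < g x then f x else h x).
Proof.
move=> pg pff ph; apply: (pf_case pg).
  by refine (pf_ext _ (pf_sub_ctx (fun x => 0 < g x) pff)) => -[x /= ->].
by refine (pf_ext _ (pf_sub_ctx (fun x => g x <= 0) ph)) => -[x /=]; rewrite leNgt => /negPf->.
Qed.

(** * Computable matrices, tests and search problems *)

Definition pfm (c : ctx) m n (A : c -> 'M[int]_(m, n)) :=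
  forall i j, pf (fun x => A x i j).

Definition pfb (c : ctx) (b : c -> bool) := pf (fun x => (b x)%:R).

Section Matrices.
Variable c : ctx.

Lemma pfm_ext m n (A B : c -> 'M[int]_(m, n)) : A =1 B -> pfm A -> pfm B.
Proof. by move=> AB pA i j; apply: pf_ext (pA i j) => x; rewrite AB. Qed.

Lemma pfm_cst m n (A : 'M[int]_(m, n)) : pfm (fun _ : c => A).
Proof. by move=> i j; apply: pf_cst. Qed.

Lemma pfm_add m n (A B : c -> 'M[int]_(m, n)) : pfm A -> pfm B -> pfm (fun x => A x + B x).
Proof. by move=> pA pB i j; apply: pf_ext (pf_add (pA i j) (pB i j)) => x; rewrite mxE. Qed.

Lemma pfm_opp m n (A : c -> 'M[int]_(m, n)) : pfm A -> pfm (fun x => - A x).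
Proof. by move=> pA i j; apply: pf_ext (pf_opp (pA i j)) => x; rewrite mxE. Qed.

Lemma pfm_sub m n (A B : c -> 'M[int]_(m, n)) : pfm A -> pfm B -> pfm (fun x => A x - B x).
Proof. by move=> pA pB; apply: pfm_add => //; apply: pfm_opp. Qed.

Lemma pfm_scale m n (a : c -> int) (A : c -> 'M[int]_(m, n)) :
  pf a -> pfm A -> pfm (fun x => a x *: A x).
Proof. by move=> pa pA i j; apply: pf_ext (pf_mul pa (pA i j)) => x; rewrite mxE. Qed.

Lemma pfm_mul m n p (A : c -> 'M[int]_(m, n)) (B : c -> 'M[int]_(n, p)) :
  pfm A -> pfm B -> pfm (fun x => A x *m B x).
Proof.
move=> pA pB i j; have := @pf_sum c _ (index_enum 'I_n) xpredT _ (fun k => pf_mul (pA i k) (pB k j)).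
by apply: pf_ext => x; rewrite mxE.
Qed.

Lemma pfm_tr m n (A : c -> 'M[int]_(m, n)) : pfm A -> pfm (fun x => (A x)^T).
Proof. by move=> pA i j; apply: pf_ext (pA j i) => x; rewrite mxE. Qed.

Lemma pfm_row m n i (A : c -> 'M[int]_(m, n)) : pfm A -> pfm (fun x => row i (A x)).
Proof. by move=> pA k j; apply: pf_ext (pA i j) => x; rewrite mxE. Qed.

Lemma pfm_row_mx m n p (A : c -> 'M[int]_(m, n)) (B : c -> 'M[int]_(m, p)) :
  pfm A -> pfm B -> pfm (fun x => row_mx (A x) (B x)).
Proof.
move=> pA pB i j; case: (split_ordP j) => k ->.
  by apply: pf_ext (pA i k) => x; rewrite row_mxEl.
by apply: pf_ext (pB i k) => x; rewrite row_mxEr.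
Qed.

Lemma pfm_col_mx m n p (A : c -> 'M[int]_(m, p)) (B : c -> 'M[int]_(n, p)) :
  pfm A -> pfm B -> pfm (fun x => col_mx (A x) (B x)).
Proof.
move=> pA pB i j; case: (split_ordP i) => k ->.
  by apply: pf_ext (pA k j) => x; rewrite col_mxEu.
by apply: pf_ext (pB k j) => x; rewrite col_mxEd.
Qed.

Lemma pfm_lsub m n p (A : c -> 'M[int]_(m, n + p)) : pfm A -> pfm (fun x => lsubmx (A x)).
Proof. by move=> pA i j; apply: pf_ext (pA i (lshift p j)) => x; rewrite mxE. Qed.

Lemma pfm_rsub m n p (A : c -> 'M[int]_(m, n + p)) : pfm A -> pfm (fun x => rsubmx (A x)).
Proof. by move=> pA i j; apply: pf_ext (pA i (rshift n j)) => x; rewrite mxE. Qed.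

Lemma pfm_scalar (a : c -> int) : pf a -> pfm (fun x => (a x)%:M : 'M_1).
Proof. by move=> pa i j; apply: pf_ext pa => x; rewrite !ord1 mxE. Qed.

Lemma pfm_if m n (g : c -> int) (A B : c -> 'M[int]_(m, n)) :
  pf g -> pfm A -> pfm B -> pfm (fun x => if 0 < g x then A x else B x).
Proof.
by move=> pg pA pB i j; apply: pf_ext (pf_if pg (pA i j) (pB i j)) => x; case: ifP.
Qed.

Lemma pfb_lt (f g : c -> int) : pf f -> pf g -> pfb (fun x => f x < g x).
Proof.
move=> pff pg; apply: pf_ext (pf_if (pf_sub pg pff) (pf_cst c 1) (pf_cst c 0)) => x.
by rewrite subr_gt0; case: ifP.
Qed.

Lemma pfb_neg (b : c -> bool) : pfb b -> pfb (fun x => ~~ b x).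
Proof. by move=> pb; apply: pf_ext (pf_sub (pf_cst c 1) pb) => x; case: (b x). Qed.

Lemma pfb_le (f g : c -> int) : pf f -> pf g -> pfb (fun x => f x <= g x).
Proof. by move=> pff pg; apply: pf_ext (pfb_neg (pfb_lt pg pff)) => x; rewrite leNgt. Qed.

Lemma pfb_and (b d : c -> bool) : pfb b -> pfb d -> pfb (fun x => b x && d x).
Proof.
by move=> pb pd; apply: pf_ext (pf_mul pb pd) => x; case: (b x) => /=; rewrite ?mul1r ?mul0r.
Qed.

Lemma pfb_forall (T : finType) (b : T -> c -> bool) :
  (forall i, pfb (b i)) -> pfb (fun x => [forall i, b i x]).
Proof.
move=> pb; suff: pfb (fun x => all (fun i => b i x) (enum T)).
  apply: pf_ext => x; congr (nat_of_bool _)%:R.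
  by apply/allP/forallP => h i; rewrite ?mem_enum //; apply: h; rewrite mem_enum.
elim: (enum T) => [|i s IH] /=; first exact: pf_cst.
exact: pfb_and.
Qed.

Lemma pfb_eq0 (f : c -> int) : pf f -> pfb (fun x => f x == 0).
Proof.
move=> pff; apply: pf_ext (pfb_and (pfb_le pff (pf_cst c 0)) (pfb_le (pf_cst c 0) pff)) => x.
by rewrite -eq_le.
Qed.

Lemma pfm_ifb m n (b : c -> bool) (A B : c -> 'M[int]_(m, n)) :
  pfb b -> pfm A -> pfm B -> pfm (fun x => if b x then A x else B x).
Proof.
by move=> pb pA pB; apply: pfm_ext (pfm_if pb pA pB) => x; case: (b x).
Qed.

Lemma pfm_sub_ctx m n (p : c -> Prop) (A : c -> 'M[int]_(m, n)) :
  pfm A -> @pfm (sub_ctx p) _ _ (fun x => A (sval x)).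
Proof. by move=> pA i j; apply: (pf_sub_ctx p (pA i j)). Qed.

(** The form [exists2 F, pfm F & forall x, R x (F x)] says that the search problem [R] is solvable
    in polynomial time; all later algorithms are stated this way. The two solutions are glued by a
    dependent case, since each takes the proof of its branch as part of its argument. *)
Lemma solve_case r s (b : c -> bool) (R : c -> 'M[int]_(r, s) -> Prop) :
  pfb b ->
  (exists2 F, @pfm (sub_ctx b) _ _ F & forall x, R (sval x) (F x)) ->
  (exists2 F, @pfm (sub_ctx (fun x => ~~ b x)) _ _ F & forall x, R (sval x) (F x)) ->
  exists2 F, @pfm c _ _ F & forall x, R x (F x).
Proof.
move=> pb [F pF sF] [F' pF' sF'].
pose H x := match boolP (b x) with
  | AltTrue h => F (exist _ x h) | AltFalse h => F' (exist _ x h) end.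
have HT x (h : b x) : H x = F (exist _ x h).
  rewrite /H; case: {-}_ / boolP => h'; last by case/negP: (h').
  by rewrite (bool_irrelevance h' h).
have HF x (h : ~~ b x) : H x = F' (exist _ x h).
  rewrite /H; case: {-}_ / boolP => h'; first by case/negP: (h).
  by rewrite (bool_irrelevance h' h).
exists H; last by move=> x; rewrite /H; case: {-}_ / boolP => h; [exact: (sF (exist _ x h)) | exact: (sF' (exist _ x h))].
move=> i j; apply: (pf_case pb).
  have sub y : 0 < (b y)%:R :> int -> b y by case: (b y).
  pose phi (x : sub_ctx (fun x => 0 < (b x)%:R :> int)) : sub_ctx b :=
    exist _ (sval x) (sub _ (svalP x)).
  refine (pf_ext _ (pf_comp (phi := phi) _ _ (pF i j))) => [[x h]||].
  - by rewrite /phi /= -HT.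
  - by move=> k kl; apply: (@pf_proj (sub_ctx _)).
  - exact: pbound_sz.
have sub y : (b y)%:R <= 0 :> int -> ~~ b y by case: (b y).
pose phi (x : sub_ctx (fun x => (b x)%:R <= 0 :> int)) : sub_ctx (fun x => ~~ b x) :=
  exist _ (sval x) (sub _ (svalP x)).
refine (pf_ext _ (pf_comp (phi := phi) _ _ (pF' i j))) => [[x h]||].
- by rewrite /phi /= -HF.
- by move=> k kl; apply: (@pf_proj (sub_ctx _)).
- exact: pbound_sz.
Qed.
End Matrices.

(** * Loops with polynomially many rounds *)

Section Loop.
Variables (c : ctx) (r : nat) (Inv : c -> nat -> 'rV[int]_r.+1 -> Prop).

(** The counter [t] of the invariant is a ghost variable bounding the number of rounds. *)
Definition loop_bound := exists e, forall x t s, Inv x t s ->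
  (t <= (sz x + 2) ^ e)%N /\ forall i, (bits (s 0%R i) <= (sz x + 2) ^ e)%N.

Hypothesis Inv_bound : loop_bound.

(** One round of the loop, seen as an instance of its own. Its size is that of the original
    instance, which [Inv_bound] justifies, so all rounds share one time bound. *)
Definition loop_ctx : ctx.
Proof.
apply: (@Ctx {p : c * nat * 'rV[int]_r.+1 | Inv p.1.1 p.1.2 p.2 /\ 0 < p.2 0 0}
  (fun p => sz (sval p).1.1) (len c + r.+1)
  (fun p i => if (i < len c)%N then enc (sval p).1.1 i else (sval p).2 0 (inord (i - len c)))).
have [e1 h1] := Inv_bound; have [e2 h2] := enc_bits c.
exists (maxn e1 e2) => -[[[x t] s] /= [hI _]] i _; case: ifP => il.
  by apply: leq_trans (h2 x i il) _; rewrite leq_pexp2l ?leq_maxr ?addn2.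
by apply: leq_trans ((h1 _ _ _ hI).2 _) _; rewrite leq_pexp2l ?leq_maxl ?addn2.
Defined.

Lemma pf_loop_lift f : pf f -> @pf loop_ctx (fun p => f (sval p).1.1).
Proof.
apply: (@pf_comp loop_ctx c (fun p => (sval p).1.1)) => [i il|]; last exact: pbound_sz.
refine (pf_ext _ (@pf_proj loop_ctx i _)) => [p|] /=; first by rewrite il.
exact: leq_trans il (leq_addr _ _).
Qed.

Lemma pfm_loop_state : @pfm loop_ctx _ _ (fun p => (sval p).2).
Proof.
move=> i j; refine (pf_ext _ (@pf_proj loop_ctx (len c + j)%N _)) => [p|] /=.
  by rewrite ltnNge leq_addr /= addKn inord_val ord1.
by rewrite ltn_add2l.
Qed.

(** Entry 0 of the state is the guard. The invariant cannot hold with the counter above its bound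
    [B x], so iterating [(B x).+1] times a step that freezes stopped states is certain to reach a
    stopped one. This defines the result as a total function, which the while loop then computes. *)
Lemma solve_loop (init : c -> 'rV[int]_r.+1) (step : loop_ctx -> 'rV[int]_r.+1) :
  pfm init -> (forall x, Inv x 0 (init x)) ->
  pfm step -> (forall p : loop_ctx, Inv (sval p).1.1 (sval p).1.2.+1 (step p)) ->
  exists2 F, pfm F & forall x, (exists t, Inv x t (F x)) /\ F x 0 0 <= 0.
Proof.
move=> pinit Iinit pstep Istep; have [e he] := Inv_bound.
pose state x := {ts : nat * 'rV[int]_r.+1 | Inv x ts.1 ts.2}.
pose start x : state x := exist (fun ts => Inv x ts.1 ts.2) (0%N, init x) (Iinit x).
pose mk x (p : state x) (h : 0 < (sval p).2 0 0) : loop_ctx :=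
  exist (fun p : c * nat * 'rV[int]_r.+1 => Inv p.1.1 p.1.2 p.2 /\ 0 < p.2 0 0)
    (x, (sval p).1, (sval p).2) (conj (svalP p) h).
pose next x (p : state x) : state x := match boolP (0 < (sval p).2 0 0) with
  | AltTrue h => exist (fun ts => Inv x ts.1 ts.2) ((sval p).1.+1, step (mk x p h)) (Istep (mk x p h))
  | AltFalse _ => p end.
have nextT x (p : state x) (h : 0 < (sval p).2 0 0) : sval (next x p) = ((sval p).1.+1, step (mk x p h)).
  rewrite /next; case: {-}_ / boolP => h'; last by case/negP: (h').
  by rewrite (bool_irrelevance h' h).
have nextF x (p : state x) : ~~ (0 < (sval p).2 0 0) -> next x p = p.
  by rewrite /next; case: {-}_ / boolP => // h /negP [].
pose B (x : c) := ((sz x + 2) ^ e)%N.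
pose fin x := iter (B x).+1 (next x) (start x).
have stop x n (p : state x) : (sval (iter n (next x) p)).2 0 0 <= 0 \/ (sval (iter n (next x) p)).1 = ((sval p).1 + n)%N.
  elim: n => [|n [IH|IH]] /=; first by right; rewrite addn0.
    by left; rewrite nextF // -leNgt.
  have [h|h] := boolP (0 < (sval (iter n (next x) p)).2 0 0).
    by right; rewrite (nextT _ _ h) /= IH addnS.
  by left; rewrite nextF // leNgt.
have fin_stop x : (sval (fin x)).2 0 0 <= 0.
  case: (stop x (B x).+1 (start x)) => // E.
  by have [] := he _ _ _ (svalP (fin x)); rewrite E /= add0n ltnn.
exists (fun x => (sval (fin x)).2); last first.
  by move=> x; split => //; exists (sval (fin x)).1; exact: svalP (fin x).
move=> i j; split=> rho k rk.
have [|P0 [e0 h0]] := @pf_fam c r.+1 (fun i x => init x 0 (inord i)) _ rho k rk; first by move=> *; apply: pinit.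
(* The body reads the original inputs in place and the state from registers [k] to [k + r]. The new
   state is computed above the old one and then copied down over it. *)
pose rho' i := if (i < len c)%N then rho i else (k + (i - len c))%N.
have [||P1 [e1 h1]] := @pf_fam loop_ctx r.+1 (fun i p => step p 0 (inord i)) _ rho' (k + r.+1)%N.
- by move=> *; apply: pstep.
- move=> q /= ql; rewrite /rho'; case: ifP => qc; last by lia.
  by apply: leq_trans (rk q qc) (leq_addr _ _).
have [P2 h2] := @exec_copies r.+1 (k + r.+1)%N k (leqnn _).
pose Q := Seq P1 P2.
pose cost (x : c) := (B x + (sz x + 2) ^ e1 + r.+1 * B x + 1)%N.
have run x n : forall (p : state x) st,
    (forall q, (q < len c)%N -> st (rho q) = enc x q) ->
    (forall q, (q < r.+1)%N -> st (k + q)%N = (sval p).2 0 (inord q)) ->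
    (sval (iter n (next x) p)).2 0 0 <= 0 ->
    exists st' N, [/\ exec (WhilePos k Q) st st' N, forall q, (q < k)%N -> st' q = st q,
      forall q, (q < r.+1)%N -> st' (k + q)%N = (sval (iter n (next x) p)).2 0 (inord q)
      & (N <= n.+1 * cost x)%N].
  have inord0 : inord 0 = 0 :> 'I_r.+1 by apply: val_inj; rewrite /= inordK.
  elim: n => [|n IH] p st hst hp.
    move=> /= p0; have E : st k = (sval p).2 0 0 by rewrite -[k]addn0 hp // inord0.
    exists st, (bits (st k)); split=> //; first by apply: exec_while_stop; rewrite E.
    have [_ hb] := he _ _ _ (svalP p); rewrite mul1n E; apply: leq_trans (hb 0) _.
    by rewrite /cost /B -!addnA leq_addr.
  rewrite iterSr => pn; have E : st k = (sval p).2 0 0 by rewrite -[k]addn0 hp // inord0.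
  have [pos|npos] := boolP (0 < (sval p).2 0 0); last first.
    rewrite (nextF _ _ npos) in pn *.
    have [st' [N [? ? ? le]]] := IH p st hst hp pn; exists st', N; split=> //.
    by apply: leq_trans le _; rewrite leq_mul2r leqnSn orbT.
  have [|st1 [n1 [ex1 low1 out1 le1]]] := h1 (mk x p pos) st.
    move=> q /= ql; rewrite /rho'; case: ifP => qc; first exact: hst.
    by rewrite hp //; lia.
  have nE := nextT _ _ pos.
  have [|st2 [n2 [ex2 low2 out2 le2]]] := h2 st1 (B x).
    move=> q ql; rewrite out1 //.
    by have [_] := he _ _ _ (svalP (next x p)); rewrite nE /=; apply.
  have low q : (q < k)%N -> st2 q = st q.
    by move=> qk; rewrite low2 ?qk // low1 // ltn_addr.
  have [|||st3 [N [ex3 low3 out3 le3]]] := IH (next x p) st2.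
  - by move=> q qc; rewrite low ?hst ?rk.
  - by move=> q ql; rewrite out2 // out1 // nE.
  - exact: pn.
  exists st3, (bits (st k) + (n1 + n2) + N)%N; split.
  - by apply: exec_while_loop ex3; rewrite ?E //; apply: exec_seq ex1 ex2.
  - by move=> q qk; rewrite low3 ?low.
  - by move=> q ql; rewrite out3.
  - have [_ hb] := he _ _ _ (svalP p); have := hb 0; rewrite -E -/(B x) mulSn /cost /= in le1 le2 le3 *.
    lia.
have [E hE] : pbound sz (fun x : c => ((sz x + 2) ^ e0 + (B x).+2 * cost x + B x)%N).
  have pB : pbound sz B by exists e.
  apply: pboundD => //; apply: pboundD; first by exists e0.
  apply: pboundM; first by do 2 apply: pboundS.
  apply: pboundD; last exact: pbound_cst.
  apply: pboundD; last by apply: pboundM => //; apply: pbound_cst.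
  by apply: pboundD => //; exists e1.
exists (Seq (Seq P0 (WhilePos k Q)) (Copy k (k + j)%N)), E => x st hst.
have [st0 [n0 [ex0 low0 out0 le0]]] := h0 x st hst.
have [||st1 [n1 [ex1 low1 out1 le1]]] := run x (B x).+1 (start x) st0 _ _ (fin_stop x).
- by move=> q qc; rewrite low0 ?hst ?rk.
- by move=> q ql; rewrite out0.
have oj : st1 (k + j)%N = (sval (fin x)).2 0 j by rewrite out1 ?inord_val.
exists (upd st1 k (st1 (k + j)%N)), (n0 + n1 + bits (st1 (k + j)%N))%N; split.
- by apply: exec_seq (exec_seq ex0 ex1) _; apply: exec_copy.
- by move=> q qk; rewrite /upd ltn_eqF // low1 ?low0.
- by rewrite /upd eqxx oj !ord1.
- have [_ hb] := he _ _ _ (svalP (fin x)); have := hb j; rewrite -oj -/(B x) => le2.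
  by apply: leq_trans (hE x); rewrite leq_add // leq_add.
Qed.
End Loop.
(** * Unimodular completion of an integer vector *)

Definition seq_row n (s : seq int) : 'rV[int]_n := \row_i s`_i.

Lemma seq_rowE n s i j : seq_row n s i j = s`_j.
Proof. by rewrite mxE. Qed.

Lemma pfm_seq_row (c : ctx) n (s : c -> seq int) :
  (forall i, (i < n)%N -> pf (fun x => (s x)`_i)) -> pfm (fun x => seq_row n (s x)).
Proof. by move=> ps i j; apply: pf_ext (ps j (ltn_ord j)) => x; rewrite seq_rowE. Qed.

Lemma pf_abs (c : ctx) (f : c -> int) : pf f -> pf (fun x => `|f x|).
Proof.
move=> pff; apply: pf_ext (pf_if pff pff (pf_opp pff)) => x.
by case: ltrP => [/gtr0_norm|/ler0_norm].
Qed.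

Lemma expn2_lt_bits2 t (b : int) r0 r1 : 0 < r1 -> r1 < r0 ->
  (2 ^ t)%N%:Z * r0 * r1 <= b * b -> (t.+1 <= 2 * bits b)%N.
Proof.
move=> h1 h2 le; rewrite -(ltn_exp2l _ _ (isT : (1 < 2)%N)) mul2n -addnn expnD.
have := abs_lt_bits b; move: (2 ^ bits b)%N (2 ^ t)%N le => A T le lt.
have h : T%:Z <= b * b.
  by apply: le_trans le; rewrite -mulrA ler_peMr //; nia.
have h' : b * b < A%:Z * A%:Z by nia.
by have := le_lt_trans h h'; lia.
Qed.

Notation ord4 k := (@Ordinal 4 k isT).
Notation ord5 k := (@Ordinal 5 k isT).

(** The cofactors are kept modulo [b], so that they stay small. *)
Definition bezout_inv (a b : int) (t : nat) (s : 'rV[int]_4) : Prop :=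
  let r1 := s 0 0 in let r0 := s 0 (ord4 1) in
  let u1 := s 0 (ord4 2) in let u0 := s 0 (ord4 3) in
  [/\ [/\ 0 <= r1, r1 < r0 & r0 <= `|b|],
      [/\ 0 <= u1, u1 <= `|b|, 0 <= u0 & u0 <= `|b|],
      gcdz r0 r1 = gcdz a b,
      (exists k, r0 = u0 * a + k * b) /\ (exists k, r1 = u1 * a + k * b)
    & (2 ^ t)%N%:Z * r0 * r1 <= b * b /\ (t <= 2 * bits b)%N].

Lemma bezout_inv_bound (c : ctx) (a b : c -> int) : pf b ->
  loop_bound (fun x => bezout_inv (a x) (b x)).
Proof.
move=> pb; have [e he] : pbound sz (fun x => 2 * bits (b x))%N.
  by apply: pboundM; [apply: pbound_cst | apply: pf_bits].
exists e => x t s [[h1 h2 h3] [h4 h5 h6 h7] _ _ [_ h8]]; split; first exact: leq_trans (he x).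
move=> i; apply: leq_trans (he x); apply: (@leq_trans (bits (b x))); last by lia.
apply: bits_mono; have : [|| i == 0, i == ord4 1, i == ord4 2 | i == ord4 3].
  by rewrite -!val_eqE /=; case: i => [[|[|[|[|]]]]].
by move=> /or4P[] /eqP->; lia.
Qed.

Lemma pf_bezout_neq0 (c : ctx) (a b : c -> int) :
  pf a -> pf b -> (forall x, b x != 0) ->
  exists2 F : c -> 'rV[int]_5, pfm F & forall x,
    [/\ a x = F x 0 (ord5 0) * F x 0 (ord5 1), b x = F x 0 (ord5 0) * F x 0 (ord5 2)
      & F x 0 (ord5 3) * F x 0 (ord5 1) + F x 0 (ord5 4) * F x 0 (ord5 2) = 1].
Proof.
move=> pa pb b0.
have nb := bezout_inv_bound a pb.
pose init x := seq_row 4 [:: (a x %% b x)%Z; `|b x|; 1; 0].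
pose step (p : loop_ctx nb) :=
  let r1 := (sval p).2 0 0 in let r0 := (sval p).2 0 (ord4 1) in
  let u1 := (sval p).2 0 (ord4 2) in let u0 := (sval p).2 0 (ord4 3) in
  seq_row 4 [:: (r0 %% r1)%Z; r1; ((u0 - (r0 %/ r1)%Z * u1) %% b (sval p).1.1)%Z; u1].
have [||||F pF sF] := @solve_loop c 3 _ nb init step.
- apply: pfm_seq_row => -[|[|[|[|//]]]] _ /=; try exact: pf_cst; first exact: pf_mod.
  exact: pf_abs.
- move=> x; have bx := b0 x; have m0 := modz_ge0 (a x) bx; have m1 := ltz_mod (a x) bx.
  rewrite /bezout_inv !seq_rowE /=; split=> //.
  + by split; lia.
  + rewrite gcdzC -(gcdz_modl (a x) (b x)) /gcdz; congr (gcdn _ _)%:Z; lia.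
  + have := divz_eq (a x) (b x) => E; split; last by exists (- (a x %/ b x)%Z); lia.
    by exists (Num.sg (b x)); rewrite mul0r add0r -normrEsg.
  + by split=> //; rewrite expn0; nia.
- have ps := pfm_loop_state nb.
  apply: pfm_seq_row => -[|[|[|[|//]]]] _ /=; try exact: ps.
    by apply: pf_mod; apply: ps.
  apply: pf_mod; last exact: (pf_loop_lift nb pb).
  apply: pf_sub; first exact: ps.
  by apply: pf_mul (ps _ _); apply: pf_div; apply: ps.
- case=> [[[x t] s] /= [[[h1 h2 h3] [h4 h5 h6 h7] hg [[k0 hk0] [k1 hk1]] [hT ht]] pos]].
  rewrite /step /= /bezout_inv !seq_rowE /=.
  move: (s 0 0) (s 0 (ord4 1)) (s 0 (ord4 2)) (s 0 (ord4 3)) => r1 r0 u1 u0 in h1 h2 h3 h4 h5 h6 h7 hg hk0 hk1 hT pos *.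
  have r1n : r1 != 0 by lia.
  have m0 := modz_ge0 r0 r1n; have m1 := ltz_mod r0 r1n; have E := divz_eq r0 r1.
  have bx := b0 x; set w := u0 - _.
  have n0 := modz_ge0 w bx; have n1 := ltz_mod w bx; have E' := divz_eq w (b x).
  split.
  + by split; lia.
  + by split; lia.
  + by rewrite gcdz_modr gcdzC.
  + split; first by exists k1.
    exists (k0 - (r0 %/ r1)%Z * k1 + (w %/ b x)%Z * a x).
    have -> : (r0 %% r1)%Z = r0 - (r0 %/ r1)%Z * r1 by apply/eqP; rewrite eq_sym subr_eq addrC -E.
    have -> : (w %% b x)%Z = w - (w %/ b x)%Z * b x by apply/eqP; rewrite eq_sym subr_eq addrC -E'.
    by rewrite /w {1}hk0 {2}hk1; ring.
  + split; last exact: expn2_lt_bits2 pos h2 hT.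
    apply: le_trans hT; rewrite expnS PoszM.
    have q1 : 1 <= (r0 %/ r1)%Z by rewrite lez_divRL // mul1r ltW.
    (* As the quotient is at least 1, the remainder is at most half of [r0]. The product of two
       successive remainders is therefore at least halved in each round, which gives the bound
       [2 * bits b] on the number of rounds. *)
    have h : 2 * (r0 %% r1)%Z <= r0 by move: (r0 %/ r1)%Z (r0 %% r1)%Z m0 m1 E q1 => D M *; nia.
    have : 0 <= (2 ^ t)%N%:Z * r1 by rewrite mulr_ge0.
    move: (2 ^ t)%N%:Z (r0 %% r1)%Z h => T M h hT'.
    have -> : 2%:Z * T * r1 * M = T * r1 * (2 * M) by ring.
    have -> : T * r0 * r1 = T * r1 * r0 by ring.
    by rewrite ler_wpM2l.
pose r0 x : int := F x 0 (ord4 1); pose u0 x : int := F x 0 (ord4 3).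
(* The cofactor of [b] is not carried through the loop; the invariant only asserts that it exists,
   and here one exact division recovers it. *)
exists (fun x => seq_row 5 [:: r0 x; (a x %/ r0 x)%Z; (b x %/ r0 x)%Z; u0 x;
                            ((r0 x - u0 x * a x) %/ b x)%Z]).
  apply: pfm_seq_row => -[|[|[|[|[|//]]]]] _ /=; try exact: pF.
  - by apply: pf_div => //; apply: pF.
  - by apply: pf_div => //; apply: pF.
  - by apply: pf_div => //; apply: pf_sub; [apply: pF | apply: pf_mul => //; apply: pF].
move=> x; have [[t [[h1 h2 h3] _ hg [[k hk] _] _]] stop] := sF x.
rewrite !seq_rowE /= -/(r0 x) -/(u0 x) in h1 h2 h3 hg hk *.
have E0 : F x 0 0 = 0 by lia.
have rg : r0 x = gcdz (a x) (b x) by rewrite -hg E0 gcdz0; lia.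
have [p ap] : exists p, a x = p * r0 x by apply/dvdzP; rewrite rg dvdz_gcdl.
have [q bq] : exists q, b x = q * r0 x by apply/dvdzP; rewrite rg dvdz_gcdr.
have rn : r0 x != 0 by lia.
have -> : (a x %/ r0 x)%Z = p by rewrite ap mulzK.
have -> : (b x %/ r0 x)%Z = q by rewrite bq mulzK.
have -> : ((r0 x - u0 x * a x) %/ b x)%Z = k.
  by rewrite {1}hk addrC addKr mulzK ?b0.
split; rewrite 1?mulrC //.
by apply: (mulIf rn); rewrite mul1r mulrDl -!mulrA [p * _]mulrCA -ap -bq -hk.
Qed.

(** The entries are a common divisor, the two quotients and their cofactors. Stating the relation
    for the quotients keeps it meaningful when [a] and [b] are both 0: the divisor is then 0 and the
    quotients are still coprime. *)
Lemma pf_bezout (c : ctx) (a b : c -> int) : pf a -> pf b ->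
  exists2 F : c -> 'rV[int]_5, pfm F & forall x,
    [/\ a x = F x 0 (ord5 0) * F x 0 (ord5 1), b x = F x 0 (ord5 0) * F x 0 (ord5 2)
      & F x 0 (ord5 3) * F x 0 (ord5 1) + F x 0 (ord5 4) * F x 0 (ord5 2) = 1].
Proof.
move=> pa pb; apply: (@solve_case c _ _ (fun x => b x == 0)
  (fun x (v : 'rV_5) => [/\ a x = v 0 (ord5 0) * v 0 (ord5 1), b x = v 0 (ord5 0) * v 0 (ord5 2)
    & v 0 (ord5 3) * v 0 (ord5 1) + v 0 (ord5 4) * v 0 (ord5 2) = 1])).
- exact: pfb_eq0.
- exists (fun x => seq_row 5 [:: a (sval x); 1; 0; 1; 0]).
    apply: pfm_seq_row => -[|[|[|[|[|//]]]]] _ /=; try exact: pf_cst.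
    exact: pf_sub_ctx.
  by case=> x /= /eqP ->; rewrite !seq_rowE /= mulr1 mulr0.
- apply: (@pf_bezout_neq0 (sub_ctx (fun x => b x != 0)) (fun x => a (sval x)) (fun x => b (sval x))).
  + exact: pf_sub_ctx.
  + exact: pf_sub_ctx.
  + by case.
Qed.

Lemma pfm_block_mx (c : ctx) m1 m2 n1 n2 (A : c -> 'M[int]_(m1, n1)) (B : c -> 'M[int]_(m1, n2))
    (C : c -> 'M[int]_(m2, n1)) (D : c -> 'M[int]_(m2, n2)) :
  pfm A -> pfm B -> pfm C -> pfm D -> pfm (fun x => block_mx (A x) (B x) (C x) (D x)).
Proof.
by move=> pA pB pC pD; exact: pfm_col_mx (pfm_row_mx pA pB) (pfm_row_mx pC pD).
Qed.

Record frame n := Frame {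
  fr_u : 'cV[int]_(1 + n); fr_U : 'M[int]_(1 + n, n);
  fr_w : 'rV[int]_(1 + n); fr_W : 'M[int]_(n, 1 + n) }.

(** [row_mx u U] is a unimodular matrix with inverse [col_mx w W]. *)
Definition is_frame n (f : frame n) :=
  [/\ fr_w f *m fr_u f = 1, fr_w f *m fr_U f = 0, fr_W f *m fr_u f = 0,
      fr_W f *m fr_U f = 1%:M & fr_u f *m fr_w f + fr_U f *m fr_W f = 1%:M].

Definition pf_frame (c : ctx) n (f : c -> frame n) :=
  [/\ pfm (fun x => fr_u (f x)), pfm (fun x => fr_U (f x)),
      pfm (fun x => fr_w (f x)) & pfm (fun x => fr_W (f x))].

(** The new matrix is the old one, bordered by a 1, times the 2 by 2 block with rows [(P, - B)] and
    [(Q, A)], extended by the identity. That block has determinant [A * P + B * Q = 1], and its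
    inverse gives [w'] and [W']. *)
Lemma frame_step k n (P Q A B : int) (u : 'cV[int]_k) (U : 'M[int]_(k, n))
    (w : 'rV[int]_k) (W : 'M[int]_(n, k)) :
  A * P + B * Q = 1 ->
  [/\ w *m u = 1, w *m U = 0, W *m u = 0, W *m U = 1%:M & u *m w + U *m W = 1%:M] ->
  let u' := col_mx P%:M (Q *: u) in let U' := block_mx (- B)%:M 0 (A *: u) U in
  let w' := row_mx A%:M (B *: w) in let W' := block_mx (- Q)%:M (P *: w) 0 W in
  [/\ w' *m u' = 1, w' *m U' = 0, W' *m u' = 0, W' *m U' = 1%:M
    & u' *m w' + U' *m W' = 1%:M].
Proof.
move=> AB [h1 h2 h3 h4 h5]; split=> /=.
- rewrite mul_row_col -scalar_mxM -scalemxAl -scalemxAr h1 scalerA scalemx1 -raddfD /=.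
  by rewrite AB.
- rewrite mul_row_block -scalar_mxM mulmx0 add0r -!scalemxAl -scalemxAr h1 h2 scaler0.
  rewrite scalerA scalemx1 -raddfD /= mulrN mulrC addNr.
  by rewrite raddf0 row_mx0.
- rewrite mul_block_col -scalar_mxM -!scalemxAl -!scalemxAr h1 h3 mul0mx add0r scaler0.
  by rewrite scalerA scalemx1 -raddfD /= mulNr mulrC addNr raddf0 col_mx0.
- rewrite mulmx_block -scalar_mxM mulrNN -!scalemxAl -!scalemxAr h1 h2 h3 h4 !mul0mx !mulmx0.
  rewrite !scaler0 !add0r scalerA scalemx1 -raddfD /=.
  by rewrite [Q * B]mulrC [P * A]mulrC addrC AB -scalar_mx_block.
rewrite mul_col_row mulmx_block add_block_mx -!scalar_mxM mulrNN !mulmx0 !mul0mx !addr0.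
rewrite !mul_scalar_mx !mul_mx_scalar -!scalemxAl -!scalemxAr !scalerA -!raddfD /=.
rewrite [P * A]mulrC AB !mulNr !scaleNr [B * P]mulrC subrr [A * Q]mulrC subrr.
by rewrite addrA -scalerDl [Q * B]mulrC [B * Q + _]addrC AB scale1r h5 -scalar_mx_block.
Qed.

(** Induction on the dimension: the tail of [y] is a multiple [g2] of a unimodular column, and the
    Bezout identity for [g2] and the first entry feeds [frame_step]. The zero vector is covered as
    well, with [g x = 0]. *)
Lemma solve_frame n (c : ctx) (y : c -> 'cV[int]_(1 + n)) : pfm y ->
  exists (g : c -> int) (f : c -> frame n),
    [/\ pf g, pf_frame f, forall x, is_frame (f x) & forall x, y x = g x *: fr_u (f x)].
Proof.
elim: n y => [|n IH] y py.
  exists (fun x => y x 0 0), (fun x => Frame 1%:M 0 1%:M 0); split=> //.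
  - by split; apply: pfm_cst.
  - move=> x; split; rewrite /= ?mulmx1 ?mulmx0 ?mul0mx ?addr0 //.
    by apply/matrixP => -[].
  - by move=> x; apply/matrixP => i j; rewrite !ord1 !mxE /= mulr1.
have py2 : pfm (fun x => dsubmx (y x : 'cV_(1 + (1 + n)))).
  by move=> i j; apply: pf_ext (py (rshift 1 i) j) => x; rewrite mxE.
have [g2 [f2 [pg2 [pu pU pw pW] fr2 E2]]] := IH _ py2.
have [F pF sF] := pf_bezout (py 0 0) pg2.
pose g x : int := F x 0 (ord5 0); pose p x : int := F x 0 (ord5 1); pose q x : int := F x 0 (ord5 2).
pose al x : int := F x 0 (ord5 3); pose be x : int := F x 0 (ord5 4).
exists g, (fun x => let f := f2 x in
  Frame (col_mx (p x)%:M (q x *: fr_u f))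
        (block_mx (- be x)%:M 0 (al x *: fr_u f) (fr_U f))
        (row_mx (al x)%:M (be x *: fr_w f))
        (block_mx (- q x)%:M (p x *: fr_w f) 0 (fr_W f))).
split; first exact: pF.
- split=> /=.
  + by apply: pfm_col_mx; [apply: pfm_scalar; apply: pF | apply: pfm_scale => //; apply: pF].
  + apply: (@pfm_block_mx c 1 (1 + n) 1 n) => //; [|exact: pfm_cst|by apply: pfm_scale => //; apply: pF].
    by apply: pfm_scalar; apply: pf_opp; apply: pF.
  + by apply: pfm_row_mx; [apply: pfm_scalar; apply: pF | apply: pfm_scale => //; apply: pF].
  + apply: (@pfm_block_mx c 1 n 1 (1 + n)) => //; [|by apply: pfm_scale => //; apply: pF|exact: pfm_cst].
    by apply: pfm_scalar; apply: pf_opp; apply: pF.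
- move=> x; have B : al x * p x + be x * q x = 1 by have [] := sF x.
  exact: frame_step B (fr2 x).
move=> x; have [E1 E3 _] := sF x; rewrite -/(g x) -/(p x) -/(q x) in E1 E3.
rewrite /= -[LHS](@vsubmxK _ 1 (1 + n)) E2 E3 scale_col_mx scalerA; congr col_mx.
apply/matrixP => i j; rewrite !ord1 !mxE /= -E1; congr (y x _ _).
by apply: val_inj.
Qed.
(** * Cones and slices *)

Definition lin k (x : 'rV[int]_k) (l : 'cV[int]_k) : int := (x *m l) 0 0.

Section Lin.
Variable k : nat.
Implicit Types (x y : 'rV[int]_k) (l : 'cV[int]_k).
Lemma linDl x y l : lin (x + y) l = lin x l + lin y l.
Proof. by rewrite /lin mulmxDl mxE. Qed.
Lemma linZl a x l : lin (a *: x) l = a * lin x l.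
Proof. by rewrite /lin -scalemxAl mxE. Qed.
Lemma linNl x l : lin (- x) l = - lin x l.
Proof. by rewrite /lin mulNmx mxE. Qed.
Lemma linDr x l l' : lin x (l + l') = lin x l + lin x l'.
Proof. by rewrite /lin mulmxDr mxE. Qed.
Lemma linZr a x l : lin x (a *: l) = a * lin x l.
Proof. by rewrite /lin -scalemxAr mxE. Qed.
Lemma linNr x l : lin x (- l) = - lin x l.
Proof. by rewrite /lin mulmxN mxE. Qed.
Lemma lin0l l : lin 0 l = 0.
Proof. by rewrite /lin mul0mx mxE. Qed.
Lemma lin_row M (G : 'M[int]_(M, k)) i l : lin (row i G) l = (G *m l) i 0.
Proof. by rewrite /lin -row_mul mxE. Qed.
Lemma linP x l : x *m l = (lin x l)%:M.
Proof. by rewrite [LHS]mx11_scalar. Qed.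
Lemma lin_comb M (c : 'rV[int]_M) (G : 'M[int]_(M, k)) l :
  lin (c *m G) l = \sum_i c 0 i * lin (row i G) l.
Proof.
by rewrite {1}/lin -mulmxA mxE; apply: eq_bigr => i _; rewrite lin_row.
Qed.
End Lin.

Lemma linA k m (x : 'rV[int]_k) (A : 'M[int]_(k, m)) l : lin (x *m A) l = lin x (A *m l).
Proof. by rewrite /lin mulmxA. Qed.

Section Cone.
Variables (M N : nat) (G : 'M[int]_(M, N)).
Implicit Types (x y : 'rV[int]_N).

(** Rational points are represented up to a positive scalar. *)
Definition incone x := exists q (c : 'rV[int]_M),
  [/\ 0 < q, forall i, 0 <= c 0 i & q *: x = c *m G].

Lemma incone_comb a b x y : incone x -> incone y -> 0 <= a -> 0 <= b ->
  incone (a *: x + b *: y).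
Proof.
move=> [q [c [q0 c0 E]]] [q' [c' [q0' c0' E']]] a0 b0.
exists (q * q'), ((a * q') *: c + (b * q) *: c'); split; first exact: mulr_gt0.
  by move=> i; rewrite !mxE addr_ge0 // mulr_ge0 // mulr_ge0 // ltW.
rewrite mulmxDl -!scalemxAl -E -E' scalerDr !scalerA.
by congr (_ *: _ + _ *: _); ring.
Qed.

Lemma incone0 : incone 0.
Proof. by exists 1, 0; split=> // [i|]; rewrite ?mxE // mul0mx scaler0. Qed.

Lemma inconeD x y : incone x -> incone y -> incone (x + y).
Proof. by move=> hx hy; rewrite -[x]scale1r -[y]scale1r; apply: incone_comb. Qed.

Lemma inconeZ a x : 0 <= a -> incone x -> incone (a *: x).
Proof. by move=> a0 hx; rewrite -[_ *: _]addr0 -(scaler0 _ 0); apply: incone_comb incone0 _ _. Qed.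

Lemma incone_cancel a x : 0 < a -> incone (a *: x) -> incone x.
Proof.
move=> a0 [q [c [q0 c0 E]]]; exists (q * a), c; split=> //; first exact: mulr_gt0.
by rewrite -scalerA.
Qed.

Lemma incone_row i : incone (row i G).
Proof.
exists 1, (delta_mx 0 i); split=> // [j|]; last by rewrite scale1r rowE.
by rewrite mxE ler0n.
Qed.

Lemma incone_sum (I : finType) (P : pred I) (F : I -> 'rV[int]_N) :
  (forall i, P i -> incone (F i)) -> incone (\sum_(i | P i) F i).
Proof. by move=> h; apply: big_ind => //; [apply: incone0 | apply: inconeD]. Qed.

Lemma incone_ge0 l x : (forall i, 0 <= lin (row i G) l) -> incone x -> 0 <= lin x l.
Proof.
move=> h [q [c [q0 c0 E]]]; rewrite -(pmulr_rge0 _ q0) -linZl E lin_comb.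
by apply: sumr_ge0 => i _; apply: mulr_ge0.
Qed.

Lemma incone_eq0 l x : (forall i, lin (row i G) l = 0) -> incone x -> lin x l = 0.
Proof.
move=> h hx; apply/le_anti/andP; split; last by apply: incone_ge0 hx => i; rewrite h.
by rewrite -oppr_ge0 -linNr; apply: incone_ge0 hx => i; rewrite linNr h oppr0.
Qed.
End Cone.

Lemma incone_trans M M' N (G : 'M[int]_(M, N)) (H : 'M[int]_(M', N)) x :
  (forall i, incone G (row i H)) -> incone H x -> incone G x.
Proof.
move=> h [q [c [q0 c0 E]]]; apply: (incone_cancel q0); rewrite E mulmx_sum_row.
by apply: incone_sum => i _; apply: inconeZ.
Qed.

Section Cut.
Variables (M N : nat).
Implicit Types (G : 'M[int]_(M, N)) (l : 'cV[int]_N).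

(** A generator on the right side is kept, and a pair on opposite sides contributes the point where
    its segment meets the hyperplane. All other pairs give a zero row, so that the number of rows
    does not depend on the instance. *)
Definition cut_row G l (i j : 'I_M) : 'rV[int]_N :=
  if 0 <= lin (row i G) l then
    if i == j then row i G else
    if lin (row j G) l < 0 then lin (row i G) l *: row j G - lin (row j G) l *: row i G else 0
  else 0.

Definition cut_size := #|{: 'I_M * 'I_M}|.

(** Intersection of a cone with the half-space [0 <= lin x l], as in the double
    description method. *)
Definition cut G l : 'M[int]_(cut_size, N) :=
  \matrix_k cut_row G l (enum_val k).1 (enum_val k).2.

Lemma cut_row_incone G l i j : incone G (cut_row G l i j) /\ 0 <= lin (cut_row G l i j) l.
Proof.
rewrite /cut_row; case: ifP => [ai|_]; last by rewrite lin0l; split=> //; apply: incone0.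
case: eqP => [_|_]; first by split=> //; apply: incone_row.
case: ifP => [bj|_]; last by rewrite lin0l; split=> //; apply: incone0.
split; last by rewrite linDl linNl !linZl mulrC subrr.
rewrite -scaleNr; apply: incone_comb => //; try exact: incone_row.
by rewrite oppr_ge0 ltW.
Qed.

Lemma incone_cut_row G l i j : incone (cut G l) (cut_row G l i j).
Proof.
have := incone_row (cut G l) (enum_rank (i, j)).
by rewrite rowK enum_rankK.
Qed.

(** For the converse, write [q *: x = X + Y] with the generators of nonnegative value in [X] and the
    others in [Y], and let [P] and [- Q] be the values of these parts. Summing the crossing points
    with weights [c 0 i * c 0 j] gives [Q *: X + P *: Y], and [P *: (X + Y)] exceeds this by
    [(P - Q) *: X], which is in the cut because [Q <= P]. *)
Lemma incone_cut G l x : incone (cut G l) x <-> incone G x /\ 0 <= lin x l.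
Proof.
split=> [hx|[[q [c [q0 c0 E]]] lx]].
  split; first by apply: incone_trans hx => k; rewrite rowK; case: (cut_row_incone G l (enum_val k).1 (enum_val k).2).
  by apply: incone_ge0 hx => k; rewrite rowK; case: (cut_row_incone G l (enum_val k).1 (enum_val k).2).
pose a i := lin (row i G) l.
pose P := \sum_(i | 0 <= a i) c 0 i * a i; pose Q := \sum_(j | ~~ (0 <= a j)) c 0 j * - a j.
pose X := \sum_(i | 0 <= a i) c 0 i *: row i G.
pose Y := \sum_(j | ~~ (0 <= a j)) c 0 j *: row j G.
have EX : q *: x = X + Y by rewrite E mulmx_sum_row (bigID (fun i => 0 <= a i)).
have EP : q * lin x l = P - Q.
  rewrite -linZl E lin_comb (bigID (fun i => 0 <= a i)) /= /P /Q -sumrN.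
  by congr (_ + _); apply: eq_bigr => i _; rewrite mulrN opprK.
have PQ : Q <= P by rewrite -subr_ge0 -EP mulr_ge0 // ltW.
have Q0 : 0 <= Q.
  by apply: sumr_ge0 => j; rewrite -ltNge => hj; rewrite mulr_ge0 // oppr_ge0 ltW.
have hX : incone (cut G l) X.
  apply: incone_sum => i ai; apply: inconeZ => //.
  by have := incone_cut_row G l i i; rewrite /cut_row ai eqxx.
have hXY : incone (cut G l) (Q *: X + P *: Y).
  suff -> : Q *: X + P *: Y = \sum_(i | 0 <= a i) \sum_(j | ~~ (0 <= a j)) (c 0 i * c 0 j) *: cut_row G l i j.
    apply: incone_sum => i _; apply: incone_sum => j _.
    by apply: inconeZ (incone_cut_row _ _ _ _); rewrite mulr_ge0.
  rewrite /X /Y /P scaler_sumr scaler_suml -big_split /=; apply: eq_bigr => i ai.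
  rewrite /Q scaler_suml scaler_sumr -big_split /=; apply: eq_bigr => j aj.
  rewrite /cut_row -/(a i) -/(a j) ai; case: eqP => [ij|_]; first by rewrite -ij ai in aj.
  rewrite ltNge aj /= scalerDr scalerN !scalerA addrC -scaleNr.
  by congr (_ *: _ + _ *: _); ring.
have [P0|P0] := eqVneq P 0; last first.
  have Pp : 0 < P by rewrite lt0r P0 (le_trans Q0).
  apply: (incone_cancel (mulr_gt0 Pp q0)); rewrite -scalerA EX scalerDr.
  have -> : P *: X + P *: Y = (P - Q) *: X + (Q *: X + P *: Y).
    by rewrite addrA -scalerDl subrK.
  by apply: inconeD => //; apply: inconeZ => //; rewrite subr_ge0.
(* If [P = 0] nothing can be divided by [P], but then [Q = 0] too, and this kills the coefficient of
   every generator of negative value. *)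
have Qz : Q = 0 by apply/eqP; rewrite eq_le Q0 -P0 PQ.
apply: (incone_cancel q0); rewrite EX.
suff -> : Y = 0 by rewrite addr0.
apply: big1 => j aj; suff -> : c 0 j = 0 by rewrite scale0r.
have /eqP := Qz; rewrite psumr_eq0 => [|i]; last by rewrite -ltNge => hi; rewrite mulr_ge0 // oppr_ge0 ltW.
move=> /allP/(_ j); rewrite mem_index_enum aj => /(_ isT) /=.
rewrite -ltNge in aj; rewrite mulf_eq0 oppr_eq0 => /orP[/eqP//|/eqP E0].
by rewrite E0 ltxx in aj.
Qed.
End Cut.

Lemma pf_lin (c : ctx) n (x : c -> 'rV[int]_n) l : pfm x -> pfm l -> pf (fun z => lin (x z) (l z)).
Proof. by move=> px pl; apply: (pfm_mul px pl). Qed.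

Lemma pfm_cut (c : ctx) M N (G : c -> 'M[int]_(M, N)) l :
  pfm G -> pfm l -> pfm (fun x => cut (G x) (l x)).
Proof.
move=> pG pl k j; set i1 := (enum_val k).1; set i2 := (enum_val k).2.
suff h : pfm (fun x => cut_row (G x) (l x) i1 i2).
  by apply: pf_ext (h 0 j) => x; rewrite [RHS]mxE.
have p1 i : pf (fun x => lin (row i (G x)) (l x)) by apply: pf_lin => //; apply: pfm_row.
apply: pfm_ifb; [|case: eqP => _|]; [|exact: pfm_row| |exact: pfm_cst].
  by apply: pfb_le => //; apply: pf_cst.
apply: pfm_ifb; [|apply: pfm_sub|exact: pfm_cst].
- by apply: pfb_lt => //; apply: pf_cst.
- by apply: pfm_scale => //; apply: pfm_row.
- by apply: pfm_scale => //; apply: pfm_row.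
Qed.

Lemma dn_lsub k (x : 'rV[int]_(1 + k)) : x 0 0 = lsubmx x 0 0.
Proof. by rewrite mxE; congr (x _ _); apply: val_inj. Qed.

(** A generator [row_mx d z] stands for the point [z / d], and a zero row for no point. *)
Definition pointed M n (G : 'M[int]_(M, 1 + n)) :=
  forall x, incone G x -> 0 <= x 0 0 /\ (x 0 0 = 0 -> x = 0).

Definition full M N (G : 'M[int]_(M, N)) := forall l : 'cV[int]_N, G *m l = 0 -> l = 0.

Lemma pointed_cut M n (G : 'M[int]_(M, 1 + n)) l : pointed G -> pointed (cut G l).
Proof. by move=> pG x /incone_cut[/pG]. Qed.

Section Slice.
Variables (n : nat) (f : frame n) (v : int).
Hypothesis fr : is_frame f.

Definition slice_form : 'cV[int]_(1 + (1 + n)) := col_mx (- v)%:M (fr_u f).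
Definition slice_proj : 'M[int]_(1 + (1 + n), 1 + n) := block_mx 1%:M 0 0 (fr_U f).
(** [v *: fr_w f] is an integer point of the hyperplane on which [fr_u f] takes the value [v], and
    the rows of [fr_W f] are a basis of the lattice parallel to it. The integer points of the slice
    are thus exactly the integer points in the new coordinates. *)
Definition slice_emb : 'M[int]_(1 + n, 1 + (1 + n)) := block_mx 1%:M (v *: fr_w f) 0 (fr_W f).

Lemma slice_embK : slice_emb *m slice_proj = 1%:M.
Proof.
have [h1 h2 h3 h4 h5] := fr; rewrite mulmx_block !mulmx0 !mul0mx !mulmx1 ?mul1mx.
by rewrite -scalemxAl h2 h4 scaler0 !addr0 !add0r -scalar_mx_block.
Qed.

Lemma slice_emb_form : slice_emb *m slice_form = 0.
Proof.
have [h1 h2 h3 h4 h5] := fr; rewrite mul_block_col !mul0mx mul1mx -scalemxAl h1 h3.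
by rewrite scalemx1 -raddfD /= addNr raddf0 addr0 col_mx0.
Qed.

Lemma slice_projK x : lin x slice_form = 0 -> x *m slice_proj *m slice_emb = x.
Proof.
have [h1 h2 h3 h4 h5] := fr; rewrite -[x]hsubmxK /lin mul_row_col => h.
have {}h : rsubmx x *m fr_u f = v *: lsubmx x.
  rewrite [LHS]mx11_scalar [lsubmx x]mx11_scalar scale_scalar_mx; congr (_%:M).
  move/eqP: h; rewrite mxE mul_mx_scalar mxE mulNr addrC subr_eq0 => /eqP->.
  by rewrite mxE.
rewrite !mul_row_block !mulmx0 !mulmx1 !addr0 add0r; congr row_mx.
rewrite -[RHS]mulmx1 -h5 mulmxDr !mulmxA h -scalemxAl -scalemxAr; congr (_ + _).
Qed.

Definition slice M (G : 'M[int]_(M, 1 + (1 + n))) :=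
  cut (cut G slice_form) (- slice_form) *m slice_proj.

Variables (M : nat) (G : 'M[int]_(M, 1 + (1 + n))).

Lemma incone_cut2 x : incone (cut (cut G slice_form) (- slice_form)) x <->
  incone G x /\ lin x slice_form = 0.
Proof.
split=> [/incone_cut[/incone_cut[h h1]]|[h E]].
  by rewrite linNr oppr_ge0 => h2; split=> //; apply/eqP; rewrite eq_le h1 h2.
by apply/incone_cut; rewrite linNr E oppr0; split=> //; apply/incone_cut; rewrite E.
Qed.

Lemma incone_slice s : incone (slice G) s <-> incone G (s *m slice_emb).
Proof.
split=> [[q [c [q0 c0 E]]]|h].
  apply: (incone_cancel q0); rewrite scalemxAl E !mulmxA slice_projK; last first.
    rewrite /lin -mulmxA (_ : _ *m slice_form = 0) ?mulmx0 ?mxE //.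
    apply/matrixP => i j; rewrite ord1 -lin_row [RHS]mxE.
    by have /incone_cut2[] := incone_row (cut (cut G slice_form) (- slice_form)) i.
  rewrite mulmx_sum_row; apply: incone_sum => i _; apply: inconeZ => //.
  by have /incone_cut2[] := incone_row (cut (cut G slice_form) (- slice_form)) i.
have /incone_cut2[q [c [q0 c0 E]]] : incone G (s *m slice_emb) /\ lin (s *m slice_emb) slice_form = 0.
  by split=> //; rewrite /lin -mulmxA slice_emb_form mulmx0 mxE.
exists q, c; split=> //; rewrite /slice mulmxA -E -scalemxAl -mulmxA.
by rewrite slice_embK mulmx1.
Qed.

Lemma slice_emb_dn (s : 'rV_(1 + n)) : (s *m slice_emb) 0 0 = s 0 0.
Proof.
rewrite dn_lsub [RHS]dn_lsub -{1}[s]hsubmxK mul_row_block mulmx1 mulmx0 addr0.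
by rewrite row_mxKl.
Qed.

Lemma pointed_slice : pointed G -> pointed (slice G).
Proof.
move=> pG s /incone_slice /pG; rewrite slice_emb_dn => -[h h']; split=> // /h' E.
by rewrite -[s]mulmx1 -slice_embK mulmxA E mul0mx.
Qed.

(** A form vanishing on the section of the cone by the hyperplane is proportional to [slice_form]:
    every generator off the hyperplane is joined to [xp] or [xm] by a segment that crosses it, and
    this fixes the value of the form there. Pulling back along [slice_emb] kills [slice_form]. *)
Lemma full_slice xp xm : full G -> incone G xp -> incone G xm ->
  0 < lin xp slice_form -> lin xm slice_form < 0 -> full (slice G).
Proof.
move=> fG hp hm lp lm l; rewrite /slice -mulmxA; set w := slice_proj *m l => E.
have zero x : incone G x -> lin x slice_form = 0 -> lin x w = 0.
  move=> hx lx; have {hx lx} /incone_cut2 : incone G x /\ lin x slice_form = 0 by [].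
  by apply: incone_eq0 => i; rewrite lin_row E mxE.
set a := lin xm slice_form in lm; set ap := lin xp slice_form in lp.
have E1 : ap * lin xm w = a * lin xp w.
  have /zero : incone G (ap *: xm + (- a) *: xp) by apply: incone_comb => //; rewrite ?oppr_ge0 ltW.
  rewrite !linDl !linZl -/a -/ap mulrC mulNr subrr => /(_ (erefl _)) /eqP.
  by rewrite mulNr subr_eq0 => /eqP.
have E2 : a *: w = lin xm w *: slice_form.
  apply/eqP; rewrite -subr_eq0; apply/eqP; apply: fG; apply/matrixP => i j.
  rewrite ord1 -lin_row [RHS]mxE linDr linNr !linZr; have hg := incone_row G i.
  move: (row i G) hg => g hg; apply/eqP; rewrite subr_eq0; apply/eqP.
  have [t0|t0|t0] := ltgtP (lin g slice_form) 0; last by rewrite t0 mulr0 zero ?mulr0.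
    have /zero : incone G ((- lin g slice_form) *: xp + ap *: g).
      by apply: incone_comb => //; rewrite ?oppr_ge0 ltW.
    rewrite !linDl !linZl -/ap mulNr mulrC addNr => /(_ (erefl _)) E2.
    have ap0 : ap != 0 by rewrite gt_eqF.
    apply: (mulfI ap0); rewrite mulrCA [RHS]mulrA E1.
    by rewrite (_ : ap * lin g w = lin g slice_form * lin xp w); [ring | lia].
  have /zero : incone G (lin g slice_form *: xm + (- a) *: g).
    by apply: incone_comb => //; rewrite ?oppr_ge0 ltW.
  rewrite !linDl !linZl -/a mulNr mulrC subrr => /(_ (erefl _)) E2.
  by rewrite [RHS]mulrC; lia.
have : a *: l = 0.
  by rewrite -[l]mul1mx -slice_embK -mulmxA -/w scalemxAr E2 -scalemxAr slice_emb_form scaler0.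
by move=> /eqP; rewrite scalemx_eq0 lt_eqF //= => /eqP.
Qed.
End Slice.

(** * Widths of bodies, in homogeneous coordinates *)

Definition dnf n : 'cV[int]_(1 + n) := col_mx 1%:M 0.
Definition vl n (y : 'cV[int]_n) : 'cV[int]_(1 + n) := col_mx 0 y.

Lemma lin_dnf n (x : 'rV[int]_(1 + n)) : lin x (dnf n) = x 0 0.
Proof. by rewrite dn_lsub /lin -{1}[x]hsubmxK mul_row_col mulmx1 mulmx0 addr0. Qed.

Lemma vlD n (y y' : 'cV[int]_n) : vl (y + y') = vl y + vl y'.
Proof. by rewrite /vl add_col_mx addr0. Qed.

Lemma vlZ n a (y : 'cV[int]_n) : vl (a *: y) = a *: vl y.
Proof. by rewrite /vl scale_col_mx scaler0. Qed.

Lemma vlN n (y : 'cV[int]_n) : vl (- y) = - vl y.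
Proof. by rewrite -scaleN1r vlZ scaleN1r. Qed.

Lemma lin_vl n (z : 'rV[int]_n) (y : 'cV[int]_n) a : lin (row_mx a z) (vl y) = lin z y.
Proof. by rewrite /lin mul_row_col mulmx0 add0r. Qed.

Lemma dn_row n (z : 'rV[int]_n) : (row_mx 1%:M z : 'rV_(1 + n)) 0 0 = 1.
Proof. by rewrite dn_lsub row_mxKl mxE. Qed.

Lemma lin_slice_form n (f : frame n) v x :
  lin x (slice_form f v) = lin x (vl (fr_u f)) - v * x 0 0.
Proof.
have -> : slice_form f v = vl (fr_u f) - v *: dnf (1 + n).
  by rewrite /slice_form /vl /dnf scale_col_mx opp_col_mx add_col_mx scaler0 oppr0 addr0 sub0r scalemx1 raddfN.
by rewrite linDr linNr linZr lin_dnf.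
Qed.

Section Width.
Variables (M n : nat).
Implicit Types (G : 'M[int]_(M, 1 + n)) (y : 'cV[int]_n).

(** The width of the body in direction [y] is at most [a / b]. *)
Definition wid G y (a b : int) := forall x x', incone G x -> incone G x' ->
  b * (lin x (vl y) * x' 0 0 - lin x' (vl y) * x 0 0) <= a * (x 0 0 * x' 0 0).

Definition widb G y a b := [forall i, forall j,
  b * (lin (row i G) (vl y) * G j 0 - lin (row j G) (vl y) * G i 0) <= a * (G i 0 * G j 0)].

(** The inequality is linear in [x] for fixed [x'] and conversely, so it extends from generators to
    the cone in one argument after the other. *)
Lemma widP G y a b : reflect (wid G y a b) (widb G y a b).
Proof.
apply: (iffP forallP) => [h|h i]; last first.
  apply/forallP => j; have := h _ _ (incone_row G i) (incone_row G j).
  by rewrite !(mxE, mulmx_sum_row).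
have row0 k : (row k G) 0 0 = G k 0 by rewrite mxE.
have h1 j x : incone G x ->
    b * (lin x (vl y) * G j 0 - lin (row j G) (vl y) * x 0 0) <= a * (x 0 0 * G j 0).
  pose l := (a * G j 0 + b * lin (row j G) (vl y)) *: dnf n - (b * G j 0) *: vl y.
  have E z : lin z l = a * (z 0 0 * G j 0) - b * (lin z (vl y) * G j 0 - lin (row j G) (vl y) * z 0 0).
    by rewrite linDr linNr !linZr lin_dnf; ring.
  move=> hx; rewrite -subr_ge0 -E; apply: incone_ge0 hx => i.
  by rewrite E row0 subr_ge0; have /forallP := h i; apply.
move=> x x' hx hx'.
pose l := (a * x 0 0 - b * lin x (vl y)) *: dnf n + (b * x 0 0) *: vl y.
have E z : lin z l = a * (x 0 0 * z 0 0) - b * (lin x (vl y) * z 0 0 - lin z (vl y) * x 0 0).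
  by rewrite linDr !linZr lin_dnf; ring.
rewrite -subr_ge0 -E; apply: incone_ge0 hx' => j.
by rewrite E row0 subr_ge0; apply: h1.
Qed.
End Width.

Lemma pfm_vl (c : ctx) n (y : c -> 'cV[int]_n) : pfm y -> pfm (fun x => vl (y x)).
Proof. by move=> py; apply: pfm_col_mx => //; apply: pfm_cst. Qed.

Lemma pfb_widb (c : ctx) M n (G : c -> 'M[int]_(M, 1 + n)) y a b :
  pfm G -> pfm y -> pf a -> pf b -> pfb (fun x => widb (G x) (y x) (a x) (b x)).
Proof.
move=> pG py pa pb; apply: pfb_forall => i; apply: pfb_forall => j.
have pl k : pf (fun x => lin (row k (G x)) (vl (y x))).
  by apply: pf_lin; [apply: pfm_row | apply: pfm_vl].
apply: pfb_le; first by apply: pf_mul => //; apply: pf_sub; apply: pf_mul.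
by apply: pf_mul => //; apply: pf_mul.
Qed.

(** * Fraction-free elimination and bounds on bit lengths *)

Definition elim_mx M n (G : 'M[int]_(M, 1 + n)) i : 'M[int]_(M, n) :=
  G i 0 *: rsubmx G - lsubmx G *m row i (rsubmx G).

(** The first entry is chosen so that the lifted form vanishes on the pivot row [i]. *)
Definition elim_back M n (G : 'M[int]_(M, 1 + n)) i (l : 'cV[int]_n) : 'cV[int]_(1 + n) :=
  col_mx (- (row i (rsubmx G) *m l)) (G i 0 *: l).

Lemma elim_mxE M n (G : 'M[int]_(M, 1 + n)) i (l : 'cV[int]_(1 + n)) :
  elim_mx G i *m dsubmx l = G i 0 *: (G *m l) - lsubmx G *m row i (G *m l).
Proof.
have -> : G *m l = lsubmx G *m usubmx l + rsubmx G *m dsubmx l.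
  by rewrite -mul_row_col hsubmxK vsubmxK.
have rowG : row i (lsubmx G) = (G i 0)%:M.
  by apply/matrixP => a b; rewrite !ord1 !mxE /=; congr (G _ _); apply: val_inj.
have -> : row i (lsubmx G *m usubmx l + rsubmx G *m dsubmx l)
    = G i 0 *: usubmx l + row i (rsubmx G) *m dsubmx l.
  by rewrite -mul_scalar_mx -rowG -!row_mul; apply/matrixP => a b; rewrite !mxE.
rewrite mulmxBl -scalemxAl scalerDr mulmxDr -scalemxAr mulmxA opprD addrACA subrr add0r.
by [].
Qed.

Lemma elim_backE M n (G : 'M[int]_(M, 1 + n)) i l : G *m elim_back G i l = elim_mx G i *m l.
Proof.
rewrite -{1}[G]hsubmxK mul_row_col mulmxN -scalemxAr mulmxBl -scalemxAl mulmxA addrC.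
by [].
Qed.

Lemma full_elim M n (G : 'M[int]_(M, 1 + n)) i : G i 0 != 0 -> full G -> full (elim_mx G i).
Proof.
move=> p0 fG l; rewrite -elim_backE => /fG /eqP; rewrite /elim_back col_mx_eq0 => /andP[_].
by rewrite scalemx_eq0 (negPf p0) /= => /eqP.
Qed.

Lemma full_pivot M n (G : 'M[int]_(M, 1 + n)) : full G -> exists i, G i 0 != 0.
Proof.
move=> fG; apply/existsP; apply: contraT; rewrite negb_exists => /forallP h.
have /fG/eqP : G *m dnf n = 0.
  apply/matrixP => i j; rewrite ord1 -lin_row lin_dnf !mxE.
  by apply/eqP; rewrite -[_ == _]negbK.
by rewrite /dnf col_mx_eq0 => /andP[/eqP/matrixP/(_ 0 0)]; rewrite !mxE.
Qed.

(** A quantitative form of the fact that values on a full set of generators determine a form, by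
    elimination instead of Cramer's rule. Each elimination turns the length [s] into [2 s + 1],
    whence the recursion [2 K + n + 2]; it is exponential in the dimension, which is fixed. *)
Lemma full_bound n : exists K, forall M (G : 'M[int]_(M, n)) (l : 'cV[int]_n) s, full G ->
  (forall i j, (`|G i j| <= 2 ^ s)%N) -> (forall i, (absz ((G *m l) i 0)%R <= 2 ^ s)%N) ->
  forall i, (absz (l i 0)%R <= 2 ^ (K * s.+1))%N.
Proof.
elim: n => [|n [K IH]]; first by exists 0%N => M G l s _ _ _ [].
exists (K * 2 + n.+2)%N => M G l s fG hG hl.
have [p p0] := full_pivot fG.
have mulB (a b : int) S T : (`|a| <= S)%N -> (`|b| <= T)%N -> (absz (a * b)%R <= S * T)%N.
  by move=> ha hb; rewrite abszM leq_mul.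
have subB (a b : int) S : (`|a| <= S)%N -> (`|b| <= S)%N -> (absz (a - b)%R <= 2 * S)%N by lia.
have e2 : (2 ^ (s.*2.+1) = 2 * (2 ^ s * 2 ^ s))%N by rewrite expnS -expnD addnn.
have hr : forall i, (absz (dsubmx (l : 'cV_(1 + n)) i 0)%R <= 2 ^ (K * (s.*2.+1).+1))%N.
  apply: (IH M (elim_mx (G : 'M_(M, 1 + n)) p) _ s.*2.+1).
  - exact: full_elim.
  - move=> i j; rewrite e2 !mxE big_ord1 !mxE; apply: subB; apply: mulB; exact: hG.
  - move=> i; rewrite elim_mxE e2 !mxE; apply: subB; first by apply: mulB; [apply: hG | have := hl i; rewrite mxE].
    rewrite big_ord1 !mxE; apply: mulB; first exact: hG.
    by have := hl p; rewrite mxE.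
set R := (K * (s.*2.+1).+1)%N in hr.
have RE : ((K * 2 + n.+2) * s.+1 = R + n.+2 * s.+1)%N by rewrite /R; nia.
move=> i; rewrite RE; case: (@split_ordP 1 n i) => k ->; last first.
  have := hr k; rewrite mxE => h; apply: leq_trans h _.
  by rewrite leq_exp2l // leq_addr.
have E : (G p 0) * l (lshift n k) 0 = (G *m l) p 0 - \sum_(j < n) G p (rshift 1 j) * l (rshift 1 j) 0.
  rewrite mxE (@big_split_ord _ _ _ 1 n) /= big_ord1 addrK; congr (G _ _ * l _ _); apply: val_inj => //=.
  by rewrite ord1.
have S j : (absz (G p (rshift 1 j) * l (rshift 1 j) 0)%R <= 2 ^ s * 2 ^ R)%N.
  by apply: mulB; [apply: hG | have := hr j; rewrite mxE].
have S' : (absz (\sum_(j < n) G p (rshift 1 j) * l (rshift 1 j) 0)%R <= n * (2 ^ s * 2 ^ R))%N.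
  have -> : (n * (2 ^ s * 2 ^ R) = \sum_(j < n) (2 ^ s * 2 ^ R))%N by rewrite sum_nat_const card_ord.
  by elim/big_ind2: _ => // x1 x2 y1 y2 h1 h2; lia.
have h1 : (absz (l (lshift n k) 0)%R <= absz (G p 0 * l (lshift n k) 0)%R)%N by rewrite abszM leq_pmull // absz_gt0.
apply: (leq_trans h1); rewrite E.
have h2 : (2 ^ s <= 2 ^ s * 2 ^ R)%N by rewrite leq_pmulr // expn_gt0.
have h3 : (n.+1 * (2 ^ s * 2 ^ R) <= 2 ^ (R + n.+2 * s.+1))%N.
  apply: (@leq_trans (2 ^ n.+1 * (2 ^ s * 2 ^ R))%N); first by rewrite leq_mul2r ltnW ?orbT // ltn_expl.
  by rewrite -!expnD leq_exp2l //; nia.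
have := hl p; lia.
Qed.
Definition center M n (G : 'M[int]_(M, 1 + n)) : 'rV[int]_(1 + n) := const_mx 1 *m G.

Lemma incone_center M n (G : 'M[int]_(M, 1 + n)) : incone G (center G).
Proof. by exists 1, (const_mx 1); split=> // [i|]; rewrite ?mxE ?scale1r. Qed.

Lemma center_gt0 M n (G : 'M[int]_(M, 1 + n)) : pointed G -> full G -> 0 < center G 0 0.
Proof.
move=> pG /full_pivot [i Gi].
have G0 k : 0 <= G k 0 by have [] := pG _ (incone_row G k); rewrite mxE.
rewrite mxE (bigD1 i) //= mxE mul1r ltr_wpDr //; last by rewrite lt0r Gi G0.
by apply: sumr_ge0 => k _; rewrite mxE mul1r.
Qed.

Lemma pbound_sum (T : Type) (sz : T -> nat) (I : finType) (F : I -> T -> nat) :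
  (forall i, pbound sz (F i)) -> pbound sz (fun x => \sum_i F i x)%N.
Proof.
move=> h; elim: (index_enum I) => [|i s IH].
  by apply: pbound_le (pbound_cst sz 0) => x; rewrite big_nil.
by apply: pbound_le (pboundD (h i) IH) => x; rewrite big_cons.
Qed.

Section Bounds.
Variables (c : ctx) (M n : nat) (G : c -> 'M[int]_(M, 1 + n)).
Hypotheses (pG : pfm G) (poG : forall x, pointed (G x)).

(** This keeps the directions met during the search short without any lattice reduction: a bound on
    the width already bounds the entries. *)
Lemma wid_bits (H : c -> int) : (forall x, full (G x)) -> pf H ->
  exists e, forall x y, wid (G x) y (H x) 1 ->
    forall j, (bits (y j 0%R) <= (sz x + 2) ^ e)%N.
Proof.
move=> fG pH; have [K hK] := full_bound (1 + n).
pose w x k : int := H x * (G x k 0 * center (G x) 0 0).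
have pw k : pf (fun x => w x k).
  by apply: pf_mul => //; apply: pf_mul; [apply: pG | apply: (pfm_mul (pfm_cst _ _) pG)].
pose s x := (\sum_i \sum_j bits (G x i j) + \sum_k bits (w x k))%N.
have ps : pbound sz s.
  apply: pboundD; last by apply: pbound_sum => k; apply: pf_bits.
  by do 2 apply: pbound_sum => ?; apply: pf_bits; apply: pG.
have [e he] : pbound sz (fun x => (K * (s x).+1).+1)%N.
  by apply: pboundS; apply: pboundM (pbound_cst _ _) (pboundS ps).
exists e => x y hw j; apply: leq_trans (he x); apply: bits_le_exp => //.
pose D : int := center (G x) 0 0; have D0 : 0 < D := center_gt0 (@poG x) (fG x).
(* The width bounds only differences of values of [y], so the value at the center is subtracted
   before [full_bound] is applied. *)
pose l := D *: vl y - lin (center (G x)) (vl y) *: dnf n.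
have G0 k : 0 <= G x k 0 by have [] := poG (incone_row (G x) k); rewrite mxE.
have hl : forall i, (absz (l i 0)%R <= 2 ^ (K * (s x).+1))%N.
  apply: hK (fG x) _ _.
    move=> i k; apply: (@leq_trans (2 ^ bits (G x i k))); first exact/ltnW/abs_lt_bits.
    rewrite leq_exp2l // /s (bigD1 i) //= (bigD1 k) //=; lia.
  move=> i; rewrite -lin_row linDr linNr !linZr lin_dnf.
  have r0 : (row i (G x)) 0 0 = G x i 0 by rewrite mxE.
  rewrite r0.
  have h1 := hw _ _ (incone_row (G x) i) (incone_center (G x)).
  have h2 := hw _ _ (incone_center (G x)) (incone_row (G x) i).
  have : `|D * lin (row i (G x)) (vl y) - lin (center (G x)) (vl y) * G x i 0| <= w x i.
    rewrite /w -/D ler_norml; rewrite !mul1r r0 -/D in h1 h2.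
    move: (lin _ _) (lin _ _) (G x i 0) h1 h2 => a b g h1 h2; apply/andP; split; nia.
  move=> h; apply: (@leq_trans (2 ^ bits (w x i))).
    by apply: leq_trans (ltnW (abs_lt_bits _)); lia.
  rewrite leq_exp2l // /s (bigD1 i (F := fun k => bits (w x k))) //=; lia.
have e1 : vl y (rshift 1 j) 0 = y j 0 by rewrite col_mxEd.
have e2 : dnf n (rshift 1 j) 0 = 0 by rewrite col_mxEd mxE.
have lE : l (rshift 1 j) 0 = D * y j 0.
  by rewrite /l mxE [X in X + _]mxE [X in _ + X]mxE [X in - X]mxE e1 e2 mulr0 subr0.
have := hl (rshift 1 j); rewrite lE => h.
have h1 : (absz (y j 0)%R <= absz (D * y j 0)%R)%N by rewrite abszM leq_pmull // absz_gt0 gt_eqF.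
apply: leq_ltn_trans (leq_trans h1 h) _; by rewrite ltn_exp2l.
Qed.

(** A generator has denominator at least 1 or is zero, so every coordinate of a point of the body is
    bounded by the sum of the absolute values of all entries. *)
Lemma point_bits : exists e, forall x (z : 'rV[int]_n), incone (G x) (row_mx 1%:M z) ->
  forall j, (bits (z 0%R j) <= (sz x + 2) ^ e)%N.
Proof.
pose B x := \sum_i \sum_j `|G x i j|.
have pB : pf B by apply: pf_sum => i; apply: pf_sum => j; apply: pf_abs; apply: pG.
have [e he] := pf_bits pB; exists e => x z hz j; apply: leq_trans (he x); apply: bits_mono.
have GB i k : `|G x i k| <= B x.
  rewrite /B (bigD1 i) //= (bigD1 k) //= -addrA lerDl addr_ge0 //; apply: sumr_ge0 => // a _.
  by apply: sumr_ge0.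
have h a : `|a| <= 1 -> 0 <= B x + a * z 0 j.
  move=> a1; pose l := B x *: dnf n + a *: vl (delta_mx j 0).
  have E y : lin y l = B x * y 0 0 + a * y 0 (rshift 1 j).
    rewrite linDr !linZr lin_dnf /vl -{2}[y]hsubmxK /lin mul_row_col mulmx0 add0r -colE.
    by rewrite !mxE.
  have : 0 <= lin (row_mx 1%:M z) l.
    apply: incone_ge0 hz => i; rewrite E; have [] := poG (incone_row (G x) i).
    move: (GB i (rshift 1 j)); rewrite !mxE => hij h0 h1.
    have [z0|nz] := eqVneq (G x i 0) 0; last by nia.
    by move: (h1 z0) => /matrixP /(_ 0 (rshift 1 j)); rewrite !mxE z0 => ->; lia.
  by rewrite E dn_row row_mxEr mulr1.
have := h 1; have := h (-1); lia.
Qed.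
End Bounds.

(** * A body with a narrow middle slice stays close to a chord *)

Section Chord.
Variable R : realFieldType.
Implicit Types C X Y d : R.

(** [X] is the height above the slice and [Y] the value along the second direction; the chord joins
    the lowest point [j] to the highest point [i]. If [X >= 0], the segment to [j] meets the slice
    within [C] of the chord, and the homothety centered at [j] enlarges this deviation by
    [(X - Xj) / - Xj], at most 3 because a third of the extent lies below. If [X <= 0], the point
    [i] serves instead. *)
Lemma chord_point C X Y Xi Yi Xj Yj s u :
  Xj < 0 -> 0 < Xi -> Yi = u + s * Xi -> Yj = u + s * Xj -> Xj <= X -> X <= Xi ->
  Xi - Xj <= 3 * Xi -> Xi - Xj <= - 3 * Xj -> 0 <= C ->
  (0 <= X -> `|X * Yj - Xj * Y - u * (X - Xj)| <= C * (X - Xj)) ->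
  (X <= 0 -> `|Xi * Y - X * Yi - u * (Xi - X)| <= C * (Xi - X)) ->
  `|Y - s * X - u| <= 3 * C.
Proof.
move=> Xj0 Xi0 -> -> XjX XXi h3i h3j C0 hp hm.
have [X0|X0] := leP 0 X.
  have := hp X0; have -> : X * (u + s * Xj) - Xj * Y - u * (X - Xj) = - Xj * (Y - s * X - u) by ring.
  rewrite normrM gtr0_norm ?oppr_gt0 // => h.
  rewrite -(ler_pM2l (_ : 0 < - Xj)) ?oppr_gt0 //; apply: le_trans h _.
  have : 0 <= C * (- 3 * Xj - (X - Xj)) by apply: mulr_ge0 => //; lra.
  by move=> h; rewrite -subr_ge0; apply: le_trans h _; rewrite le_eqVlt; apply/orP; left; apply/eqP; ring.
have := hm (ltW X0); have -> : Xi * Y - X * (u + s * Xi) - u * (Xi - X) = Xi * (Y - s * X - u) by ring.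
rewrite normrM gtr0_norm // => h.
rewrite -(ler_pM2l Xi0); apply: le_trans h _.
have : 0 <= C * (3 * Xi - (Xi - X)) by apply: mulr_ge0 => //; lra.
by move=> h; rewrite -subr_ge0; apply: le_trans h _; rewrite le_eqVlt; apply/orP; left; apply/eqP; ring.
Qed.

(** The two deviations from the chord add up to at most [6 C <= h / 4], and replacing the slope [s]
    by [r] costs at most [h / 2]. *)
Lemma chord_two C X Y X' Y' s r u h :
  `|Y - s * X - u| <= 3 * C -> `|Y' - s * X' - u| <= 3 * C ->
  2 * `|s - r| <= 1 -> `|X - X'| <= h -> 24 * C <= h ->
  4 * ((Y - r * X) - (Y' - r * X')) <= 3 * h.
Proof.
move=> h1 h2 h3 h4 h5.
have -> : (Y - r * X) - (Y' - r * X') = (Y - s * X - u) - (Y' - s * X' - u) + (s - r) * (X - X') by ring.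
have h6 : 2 * ((s - r) * (X - X')) <= h.
  apply: (@le_trans _ _ (2 * `|s - r| * `|X - X'|)); first by rewrite -mulrA -normrM ler_pM2l ?ler_norm // ltr0n.
  by apply: le_trans h4; rewrite ler_piMl.
have := ler_norm (Y - s * X - u); have := ler_norm (- (Y' - s * X' - u)); rewrite normrN; lra.
Qed.

(** Translates the comparison of two crossing points in homogeneous coordinates into the hypothesis
    of [chord_point]; the two inequalities differ by the positive factor
    [d * dj * (di * dj) * (Xi - Xj)]. *)
Lemma cross_le d dj di X Y Xi Yi Xj Yj C : 0 < d -> 0 < dj -> 0 < di -> Xj < Xi ->
  (X * d * (Yj * dj) - Xj * dj * (Y * d)) * (Xi * di * dj - Xj * dj * di)
    - (Xi * di * (Yj * dj) - Xj * dj * (Yi * di)) * (X * d * dj - Xj * dj * d)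
  <= C * ((X * d * dj - Xj * dj * d) * (Xi * di * dj - Xj * dj * di)) ->
  X * Yj - Xj * Y - (Xi * Yj - Xj * Yi) / (Xi - Xj) * (X - Xj) <= C * (X - Xj).
Proof.
move=> d0 dj0 di0 hX h.
have k0 : 0 < d * dj * (di * dj) * (Xi - Xj) by rewrite !mulr_gt0 // subr_gt0.
have nz : Xi - Xj != 0 by rewrite subr_eq0 gt_eqF.
rewrite -(ler_pM2l k0); move: h.
set L := (X in X <= _); set R0 := (X in _ <= X -> _).
set L' := (X in _ -> X <= _); set R' := (X in _ -> _ <= X).
have -> : L = L' by rewrite /L /L'; field.
by have -> : R0 = R' by rewrite /R0 /R'; ring.
Qed.
End Chord.
Notation "z %:q" := (z%:~R : rat) (at level 2, left associativity, format "z %:q").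

Lemma cross_int (t d e ti di ei tj dj ej C : int) :
  0 < d -> 0 < di -> 0 < dj -> tj * di < ti * dj ->
  (t * ej - tj * e) * (ti * dj - tj * di) - (ti * ej - tj * ei) * (t * dj - tj * d)
    <= C * ((t * dj - tj * d) * (ti * dj - tj * di)) ->
  t%:q / d%:q * (ej%:q / dj%:q) - tj%:q / dj%:q * (e%:q / d%:q)
    - (ti%:q / di%:q * (ej%:q / dj%:q) - tj%:q / dj%:q * (ei%:q / di%:q))
        / (ti%:q / di%:q - tj%:q / dj%:q) * (t%:q / d%:q - tj%:q / dj%:q)
  <= C%:q * (t%:q / d%:q - tj%:q / dj%:q).
Proof.
move=> d0 di0 dj0 lt h.
have d0' : 0 < d%:q by rewrite ltr0z.
have di0' : 0 < di%:q by rewrite ltr0z.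
have dj0' : 0 < dj%:q by rewrite ltr0z.
apply: (cross_le d0' dj0' di0').
  rewrite ltr_pdivrMr // mulrAC ltr_pdivlMr //.
  by rewrite -!rmorphM /= ltr_int.
move: h; rewrite -(ler_int rat) !(rmorphB, rmorphM) /=.
by rewrite !divfK ?gt_eqF.
Qed.

Section ChordWidth.
Variables (M n : nat) (G : 'M[int]_(M, 1 + n)) (u eta : 'cV[int]_n) (v r C : int).
Variables (gi gj : 'rV[int]_(1 + n)).
Hypotheses (poG : pointed G) (hgi : incone G gi) (hgj : incone G gj).
Hypotheses (di0 : 0 < gi 0 0) (dj0 : 0 < gj 0 0) (C0 : 0 <= C).
Hypothesis hi : forall x, incone G x -> lin x (vl u) * gi 0 0 <= lin gi (vl u) * x 0 0.
Hypothesis lo : forall x, incone G x -> lin gj (vl u) * x 0 0 <= lin x (vl u) * gj 0 0.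
Hypothesis narrow : forall x x', incone G x -> incone G x' ->
  lin x (vl u) = v * x 0 0 -> lin x' (vl u) = v * x' 0 0 ->
  lin x (vl eta) * x' 0 0 - lin x' (vl eta) * x 0 0 <= C * (x 0 0 * x' 0 0).
Let B := lin gi (vl u) * gj 0 0 - lin gj (vl u) * gi 0 0.
Let A := lin gi (vl eta) * gj 0 0 - lin gj (vl eta) * gi 0 0.
Hypotheses (B0 : 0 < B) (Bi : B <= 3 * ((lin gi (vl u) - v * gi 0 0) * gj 0 0))
  (Bj : B <= 3 * ((v * gj 0 0 - lin gj (vl u)) * gi 0 0))
  (BC : 24 * C * (gi 0 0 * gj 0 0) <= B) (Ar : 2 * `|A - r * B| <= B).

Let T (x : 'rV[int]_(1 + n)) : int := lin x (vl u) - v * x 0 0.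
Let E (x : 'rV[int]_(1 + n)) : int := lin x (vl eta).
Let D (x : 'rV[int]_(1 + n)) : int := x 0 0.
Let X x := (T x)%:q / (D x)%:q.
Let Y x := (E x)%:q / (D x)%:q.

(* The points where the segments from above to below the slice cross it. *)
Lemma crossing x y : incone G x -> incone G y -> 0 <= T x -> T y <= 0 ->
  let z := T x *: y + (- T y) *: x in
  [/\ incone G z, lin z (vl u) = v * z 0 0, E z = T x * E y - T y * E x
    & D z = T x * D y - T y * D x].
Proof.
move=> hx hy tx ty z; split.
- by apply: incone_comb => //; rewrite oppr_ge0.
- by rewrite linDl !linZl !mxE /T; ring.
- by rewrite /E linDl !linZl mulNr.
- by rewrite /D !mxE mulNr.
Qed.

Lemma cross_narrow x y x' y' : incone G x -> incone G y -> 0 <= T x -> T y <= 0 ->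
  incone G x' -> incone G y' -> 0 <= T x' -> T y' <= 0 ->
  (T x * E y - T y * E x) * (T x' * D y' - T y' * D x')
    - (T x' * E y' - T y' * E x') * (T x * D y - T y * D x)
  <= C * ((T x * D y - T y * D x) * (T x' * D y' - T y' * D x')).
Proof.
move=> hx hy tx ty hx' hy' tx' ty'.
have [h1 h2 <- <-] := crossing hx hy tx ty; have [h1' h2' <- <-] := crossing hx' hy' tx' ty'.
exact: narrow.
Qed.

Let Ti : 0 < T gi.
Proof. by have := Bi; rewrite -/(T gi); move: (T gi) => t; nia. Qed.
Let Tj : T gj < 0.
Proof. have := Bj; rewrite -opprB -/(T gj); move: (T gj) => t; nia. Qed.

Lemma chord_point_int x : incone G x -> 0 < D x ->
  let s := (Y gi - Y gj) / (X gi - X gj) in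
  let w := (X gi * Y gj - X gj * Y gi) / (X gi - X gj) in
  [/\ `|Y x - s * X x - w| <= 3 * C%:q, X gj <= X x & X x <= X gi].
Proof.
move=> hx dx0 s w.
have dx' : 0 < (D x)%:q by rewrite ltr0z.
have di' : 0 < (D gi)%:q by rewrite ltr0z.
have dj' : 0 < (D gj)%:q by rewrite ltr0z.
have Xi0 : 0 < X gi by rewrite divr_gt0 ?ltr0z.
have Xj0 : X gj < 0 by rewrite pmulr_llt0 ?invr_gt0 // ltrz0.
have nz : X gi - X gj != 0 by rewrite gt_eqF // subr_gt0 (lt_trans Xj0).
have leX a b : 0 < D a -> 0 < D b -> T a * D b <= T b * D a -> X a <= X b.
  move=> a0 b0 h; rewrite /X ler_pdivrMr ?ltr0z // mulrAC ler_pdivlMr ?ltr0z //.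
  by rewrite -!rmorphM /= ler_int.
have X1 : X gj <= X x.
  by apply: leX => //; have := lo hx; rewrite /T /D; lia.
have X2 : X x <= X gi.
  by apply: leX => //; have := hi hx; rewrite /T /D; lia.
split=> //; apply: (@chord_point _ _ _ _ (X gi) (Y gi) (X gj) (Y gj)) => //.
- by rewrite /w /s; field.
- by rewrite /w /s; field.
- rewrite /X -subr_ge0.
  have -> : 3 * ((T gi)%:q / (D gi)%:q) - ((T gi)%:q / (D gi)%:q - (T gj)%:q / (D gj)%:q)
     = (3 * T gi * D gj - (T gi * D gj - T gj * D gi))%:~R / ((D gi)%:q * (D gj)%:q).
    by rewrite !(rmorphB, rmorphM) /=; field; rewrite !gt_eqF.
  apply: divr_ge0; last by rewrite mulr_ge0 // ltW.
  rewrite ler0z; have := Bi; rewrite /B /T /D; lia.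
- rewrite /X -subr_ge0.
  have -> : - 3 * ((T gj)%:q / (D gj)%:q) - ((T gi)%:q / (D gi)%:q - (T gj)%:q / (D gj)%:q)
     = (- 3 * T gj * D gi - (T gi * D gj - T gj * D gi))%:~R / ((D gi)%:q * (D gj)%:q).
    by rewrite !(rmorphB, rmorphM, rmorphN) /=; field; rewrite !gt_eqF.
  apply: divr_ge0; last by rewrite mulr_ge0 // ltW.
  rewrite ler0z; have := Bj; rewrite /B /T /D; lia.
- by rewrite ler0z.
- move=> X0; have tx : 0 <= T x by move: X0; rewrite /X pmulr_lge0 ?invr_gt0 // ler0z.
  have lt : T gj * D gi < T gi * D gj by move: di0 dj0 Ti Tj; rewrite -/(D gi) -/(D gj); nia.
  rewrite ler_norml; apply/andP; split.
    (* The lower bound is the upper bound for the opposite direction [- E]. *)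
    have := @cross_int (T x) (D x) (- E x) (T gi) (D gi) (- E gi) (T gj) (D gj) (- E gj) C dx0 di0 dj0 lt.
    rewrite !rmorphN /= -/(X x) -/(X gi) -/(X gj) => h.
    have {}h := h _; rewrite lerNl; apply: le_trans (h _); last first.
      have := cross_narrow hgi hgj (ltW Ti) (ltW Tj) hx hgj tx (ltW Tj); lia.
    by rewrite /w le_eqVlt; apply/orP; left; apply/eqP; rewrite /Y; ring.
  apply: cross_int => //.
  exact: cross_narrow hx hgj tx (ltW Tj) hgi hgj (ltW Ti) (ltW Tj).
move=> X0; have tx : T x <= 0 by move: X0; rewrite /X pmulr_lle0 ?invr_gt0 // lerz0.
have lt : - T gi * D gj < - T gj * D gi by move: di0 dj0 Ti Tj; rewrite -/(D gi) -/(D gj); nia.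
(* Points below the slice are reflected in it: changing the sign of [T] exchanges the roles of [gi]
   and [gj] and leaves [w], the value of the chord at the slice, unchanged. *)
have wE : w = (- X gj * Y gi - - X gi * Y gj) / (- X gj - - X gi).
  by rewrite /w; field; rewrite opprK addrC.
rewrite ler_norml; apply/andP; split.
  have := @cross_int (- T x) (D x) (- E x) (- T gj) (D gj) (- E gj) (- T gi) (D gi) (- E gi) C dx0 dj0 di0 lt.
  rewrite !rmorphN /= !mulNr -/(X x) -/(X gi) -/(X gj) -/(Y x) -/(Y gi) -/(Y gj) => h.
  rewrite lerNl; have -> : C%:q * (X gi - X x) = C%:q * (- X x - - X gi) by ring.
  apply: le_trans (h _); last first.
    have := cross_narrow hgi hgj (ltW Ti) (ltW Tj) hgi hx (ltW Ti) tx; lia.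
  by rewrite wE le_eqVlt; apply/orP; left; apply/eqP; ring.
have := @cross_int (- T x) (D x) (E x) (- T gj) (D gj) (E gj) (- T gi) (D gi) (E gi) C dx0 dj0 di0 lt.
rewrite !rmorphN /= !mulNr -/(X x) -/(X gi) -/(X gj) -/(Y x) -/(Y gi) -/(Y gj) => h.
have -> : C%:q * (X gi - X x) = C%:q * (- X x - - X gi) by ring.
apply: le_trans (h _); last first.
  have := cross_narrow hgi hx (ltW Ti) tx hgi hgj (ltW Ti) (ltW Tj); lia.
by rewrite wE le_eqVlt; apply/orP; left; apply/eqP; ring.
Qed.

(** In affine coordinates [eta - r *: u] takes the value [Y - r X - r v]. The constant cancels in
    differences, so [chord_two] applies, with [h] the whole extent along [u] and [A / B] the slope
    of the chord. *)
Lemma chord_width x x' : incone G x -> incone G x' ->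
  4 * (lin x (vl (eta - r *: u)) * x' 0 0 - lin x' (vl (eta - r *: u)) * x 0 0) * (gi 0 0 * gj 0 0)
  <= 3 * B * (x 0 0 * x' 0 0).
Proof.
move=> hx hx'.
have [dx dx0] := poG hx; have [dx' dx0'] := poG hx'.
have [z|nz] := eqVneq (x 0 0) 0; first by rewrite z (dx0 z) !lin0l !(mul0r, mulr0, subr0).
have [z|nz'] := eqVneq (x' 0 0) 0; first by rewrite z (dx0' z) !lin0l !(mul0r, mulr0, subr0).
have p : 0 < D x by rewrite lt0r nz.
have p' : 0 < D x' by rewrite lt0r nz'.
have [h1 h2 h3] := chord_point_int hx p; have [h1' h2' h3'] := chord_point_int hx' p'.
have q : 0 < (D x)%:q by rewrite ltr0z.
have q' : 0 < (D x')%:q by rewrite ltr0z.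
have qi : 0 < (D gi)%:q by rewrite ltr0z.
have qj : 0 < (D gj)%:q by rewrite ltr0z.
have [k kE] : exists k, k = (D gi)%:q * (D gj)%:q by exists ((D gi)%:q * (D gj)%:q).
have BE : B%:q = (X gi - X gj) * k.
  rewrite kE; have -> : B = T gi * D gj - T gj * D gi by rewrite /B /T /D; ring.
  by rewrite rmorphB /= !rmorphM /= /X; field; rewrite !gt_eqF.
have AE : A%:q = (Y gi - Y gj) * k.
  rewrite kE; have -> : A = E gi * D gj - E gj * D gi by [].
  by rewrite rmorphB /= !rmorphM /= /Y; field; rewrite !gt_eqF.
have dd : 0 < k by rewrite kE mulr_gt0.
have hh : 0 < X gi - X gj by have : 0 < B%:q by [rewrite ltr0z]; rewrite BE pmulr_lgt0.
have := @chord_two _ C%:q (X x) (Y x) (X x') (Y x') _ r%:q _ (X gi - X gj) h1 h1'.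
have -> : (2 * `|(Y gi - Y gj) / (X gi - X gj) - r%:q| <= 1).
  have : 2 * `|A%:q - r%:q * B%:q| <= B%:q.
    by move: Ar; rewrite -(ler_int rat) rmorphM /= intr_norm rmorphB /= rmorphM.
  rewrite AE BE [r%:q * _]mulrA -mulrBl normrM (gtr0_norm dd) mulrA ler_pM2r // => h.
  rewrite -(ler_pM2r hh) mul1r -mulrA -{2}(gtr0_norm hh) -normrM mulrBl divfK ?gt_eqF //.
have -> : `|X x - X x'| <= X gi - X gj by rewrite ler_norml; lra.
have -> : 24 * C%:q <= X gi - X gj.
  rewrite -(ler_pM2r dd) -BE; move: BC; rewrite -(ler_int rat) !rmorphM /= -/(D gi) -/(D gj) -kE.
  by [].
move=> /(_ isT isT isT) h.
rewrite -(ler_int rat).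
have k0 : 0 < (D x)%:q * (D x')%:q * ((D gi)%:q * (D gj)%:q) by rewrite !mulr_gt0.
have eqle (a b a' b' : rat) : a <= b -> a = a' -> b = b' -> a' <= b' by move=> ? <- <-.
move: h; rewrite -(ler_pM2l k0) => h; apply: eqle h _ _.
  rewrite !vlD !vlN !vlZ !linDr !linNr !linZr -/(E x) -/(E x').
  have LT a : lin a (vl u) = T a + v * D a by rewrite /T /D subrK.
  rewrite (LT x) (LT x') -/(D x) -/(D x') -/(D gi) -/(D gj) /Y /X.
  move: (T x) (T x') (E x) (E x') => tx tx' ex ex'.
  rewrite !(rmorphB, rmorphM, rmorphD) /=.
  by field; rewrite !gt_eqF.
rewrite !rmorphM /= BE kE -/(D x) -/(D x'); ring.
Qed.
End ChordWidth.
(** The tests are tried in turn. An index found at run time, such as a pivot or an extremal row,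
    becomes a fixed parameter of its branch; no indirect addressing is required. *)
Lemma solve_choose (c : ctx) r s (T : finType) (b : T -> c -> bool) (R : c -> 'M[int]_(r, s) -> Prop) :
  (forall t, pfb (b t)) -> (forall x, exists t, b t x) ->
  (forall t, exists2 F, @pfm (sub_ctx (b t)) _ _ F & forall x, R (sval x) (F x)) ->
  exists2 F, @pfm c _ _ F & forall x, R x (F x).
Proof.
move=> pb ex h; suff [F pF sF] : exists2 F, @pfm c _ _ F &
    forall x, has (fun t => b t x) (enum T) -> R x (F x).
  exists F => // x; apply: sF; have [t bt] := ex x.
  by apply/hasP; exists t; rewrite ?mem_enum.
elim: (enum T) => [|t l [F pF sF]]; first by exists (fun=> 0) => //; apply: pfm_cst.
apply: (solve_case (R := fun x v => has (fun t => b t x) (t :: l) -> R x v) (pb t)).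
  by have [F' pF' sF'] := h t; exists F'.
exists (fun x => F (sval x)); first exact: pfm_sub_ctx.
by case=> x /= /negPf -> /=; apply: sF.
Qed.

Lemma divz_bounds (N D : int) : 0 < D -> (N %/ D)%Z * D <= N < ((N %/ D)%Z + 1) * D.
Proof.
move=> D0; have := divz_eq N D; have := modz_ge0 N (lt0r_neq0 D0); have := ltz_pmod N D0.
by move: (N %/ D)%Z (N %% D)%Z => q m'; lia.
Qed.

(** * Narrow directions *)

(** Answers of a search: the point counts if the flag is positive, and the direction otherwise. *)
Section Pack.
Variable n : nat.
Implicit Types r : 'rV[int]_(1 + (n + n)).
Definition pack (a : int) (z : 'rV[int]_n) (y : 'cV[int]_n) : 'rV[int]_(1 + (n + n)) :=
  row_mx a%:M (row_mx z y^T).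
Definition pk_flag r : int := r 0 0.
Definition pk_pt r : 'rV[int]_n := lsubmx (rsubmx r).
Definition pk_dir r : 'cV[int]_n := (rsubmx (rsubmx r))^T.

Lemma pk_flagE a z y : pk_flag (pack a z y) = a.
Proof. by rewrite /pk_flag dn_lsub row_mxKl mxE. Qed.
Lemma pk_ptE a z y : pk_pt (pack a z y) = z.
Proof. by rewrite /pk_pt row_mxKr row_mxKl. Qed.
Lemma pk_dirE a z y : pk_dir (pack a z y) = y.
Proof. by rewrite /pk_dir !row_mxKr trmxK. Qed.
Definition pkE := (pk_flagE, pk_ptE, pk_dirE).

Lemma pfm_pack (c : ctx) a z y : pf a -> pfm z -> pfm y -> pfm (fun x : c => pack (a x) (z x) (y x)).
Proof.
move=> pa pz py; apply: pfm_row_mx; first exact: pfm_scalar.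
by apply: pfm_row_mx => //; apply: pfm_tr.
Qed.
Lemma pf_flag (c : ctx) (r : c -> 'rV[int]_(1 + (n + n))) : pfm r -> pf (fun x => pk_flag (r x)).
Proof. by move=> pr; apply: pr. Qed.
Lemma pfm_pt (c : ctx) (r : c -> 'rV[int]_(1 + (n + n))) : pfm r -> pfm (fun x => pk_pt (r x)).
Proof. by move=> pr; apply: pfm_lsub; apply: pfm_rsub. Qed.
Lemma pfm_dir (c : ctx) (r : c -> 'rV[int]_(1 + (n + n))) : pfm r -> pfm (fun x => pk_dir (r x)).
Proof. by move=> pr; apply: pfm_tr; do 2 apply: pfm_rsub. Qed.
End Pack.

Section WidthFacts.
Variables (M n : nat) (G : 'M[int]_(M, 1 + n)).
Hypothesis poG : pointed G.

Lemma wid_scale g y a b : g != 0 -> 0 < b -> wid G (g *: y) a b -> wid G y a b.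
Proof.
move=> g0 b0 h x x' hx hx'; have := h _ _ hx hx'; have := h _ _ hx' hx.
rewrite vlZ !linZr; move: (lin x _) (lin x' _) => p p'.
have [d _] := poG hx; have [d' _] := poG hx'.
set Q := p * x' 0 0 - p' * x 0 0.
have -> : b * (g * p' * x 0 0 - g * p * x' 0 0) = - g * (b * Q) by rewrite /Q; ring.
have -> : b * (g * p * x' 0 0 - g * p' * x 0 0) = g * (b * Q) by rewrite /Q; ring.
rewrite [x' 0 0 * _]mulrC; move: (b * Q) (a * _) => q s; nia.
Qed.

Lemma wid_weaken y a b a' b' : 0 < b -> 0 <= b' -> b' * a <= a' * b -> wid G y a b -> wid G y a' b'.
Proof.
move=> b0 b0' le h x x' hx hx'; have := h _ _ hx hx'.
have [d _] := poG hx; have [d' _] := poG hx'.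
move: (_ - _) => Q; have := mulr_ge0 d d'; move: (_ * x' 0 0) => P P0 hQ.
rewrite -(ler_pM2l b0).
have : b' * (b * Q) <= b' * (a * P) by rewrite ler_wpM2l.
have : b' * a * P <= a' * b * P by rewrite ler_wpM2r.
lia.
Qed.

Lemma nwidP y a b : ~~ widb G y a b -> exists x x', [/\ incone G x, incone G x' &
  a * (x 0 0 * x' 0 0) < b * (lin x (vl y) * x' 0 0 - lin x' (vl y) * x 0 0)].
Proof.
rewrite negb_forall => /existsP[i]; rewrite negb_forall => /existsP[j]; rewrite -ltNge => h.
exists (row i G), (row j G); split; try exact: incone_row.
by rewrite ![(row _ G) 0 0]mxE.
Qed.

Lemma extremal_row (y : 'cV[int]_n) : full G -> exists2 i, 0 < G i 0 &
  forall k, lin (row k G) (vl y) * G i 0 <= lin (row i G) (vl y) * G k 0.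
Proof.
move=> /full_pivot[i0 Gi0].
have G0 k : 0 <= G k 0 by have [] := poG (incone_row G k); rewrite mxE.
have Pi0 : 0 < G i0 0 by rewrite lt0r Gi0 G0.
case: (@arg_maxP _ _ _ i0 (fun i => 0 < G i 0) (fun i => (lin (row i G) (vl y))%:q / (G i 0)%:q) Pi0).
move=> i Pi max; exists i => // k; have := G0 k; rewrite le0r => /orP[/eqP z|Pk].
  have [_ h] := poG (incone_row G k); have -> : row k G = 0 by apply: h; rewrite mxE.
  by rewrite lin0l mul0r z mulr0.
have := max k Pk; rewrite /= ler_pdivrMr ?ltr0z // mulrAC ler_pdivlMr ?ltr0z //.
by rewrite -!rmorphM /= ler_int.
Qed.
End WidthFacts.

Definition flat_ok C M n (G : 'M[int]_(M, 1 + n)) r :=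
  if 0 < pk_flag r then incone G (row_mx 1%:M (pk_pt r))
  else pk_dir r != 0 /\ wid G (pk_dir r) C 1.

Definition flat_solver n (C : int) := forall (c : ctx) M (G : c -> 'M[int]_(M, 1 + n)),
  pfm G -> (forall x, pointed (G x)) -> (forall x, full (G x)) ->
  exists2 r, pfm r & forall x, flat_ok C (G x) (r x).

Lemma incone_slice_pt n M (G : 'M[int]_(M, 1 + (1 + n))) f v (s : 'rV[int]_n) : is_frame f ->
  incone (slice f v G) (row_mx 1%:M s) -> incone G (row_mx 1%:M (v *: fr_w f + s *m fr_W f)).
Proof.
by move=> ff /incone_slice -/(_ ff); rewrite mul_row_block !mul1mx mulmx0 addr0.
Qed.

Lemma pfm_slice (c : ctx) M n (G : c -> 'M[int]_(M, 1 + (1 + n))) f v :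
  pfm G -> pf_frame f -> pf v -> pfm (fun x => slice (f x) (v x) (G x)).
Proof.
move=> pG [pu pU pw pW] pv.
have pform : pfm (fun x => slice_form (f x) (v x)).
  by apply: pfm_col_mx => //; apply: pfm_scalar; apply: pf_opp.
apply: pfm_mul; last by apply: (@pfm_block_mx c 1 (1 + n) 1 n) => //; apply: pfm_cst.
by apply: pfm_cut; [apply: pfm_cut | apply: pfm_opp].
Qed.

Lemma slice_wid n M (G : 'M[int]_(M, 1 + (1 + n))) f v y C : is_frame f ->
  wid (slice f v G) y C 1 -> forall x x', incone G x -> incone G x' ->
  lin x (vl (fr_u f)) = v * x 0 0 -> lin x' (vl (fr_u f)) = v * x' 0 0 ->
  lin x (vl (fr_U f *m y)) * x' 0 0 - lin x' (vl (fr_U f *m y)) * x 0 0 <= C * (x 0 0 * x' 0 0).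
Proof.
move=> ff hw x x' hx hx' ex ex'.
have key z : incone G z -> lin z (vl (fr_u f)) = v * z 0 0 ->
  [/\ incone (slice f v G) (z *m slice_proj f), (z *m slice_proj f) 0 0 = z 0 0
    & lin (z *m slice_proj f) (vl y) = lin z (vl (fr_U f *m y))].
  move=> hz ez; have pz : z *m slice_proj f *m slice_emb f v = z.
    by apply: slice_projK => //; rewrite lin_slice_form ez subrr.
  split; first by apply/incone_slice => //; rewrite pz.
    by rewrite -[RHS](congr1 (fun w : 'rV_(1 + (1 + n)) => w 0 0) pz) slice_emb_dn.
  by rewrite linA /vl mul_block_col !mulmx0 !mul0mx !add0r.
have [h1 h2 h3] := key x hx ex; have [h1' h2' h3'] := key x' hx' ex'.
by have := hw _ _ h1 h1'; rewrite h2 h2' h3 h3' mul1r.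
Qed.

(** The second clause preserves the initial width bound, and with it the bound on the bits of the
    direction; the third one measures progress. *)
Definition step_ok C M n (G : 'M[int]_(M, 1 + n)) y r :=
  if 0 < pk_flag r then incone G (row_mx 1%:M (pk_pt r)) else
  [/\ pk_dir r != 0, forall a b, 0 < b -> wid G y a b -> wid G (pk_dir r) a b
    & wid G (pk_dir r) C 1 \/ forall a b, 0 < b -> wid G y a b -> wid G (pk_dir r) (3 * a) (4 * b)].

(** The substantial case of one round: the direction is primitive and still wide, and the rows [i]
    and [j] of greatest and least value along it are known. *)
Lemma flat_step_main n (C : int) (d : ctx) M (G : d -> 'M[int]_(M, 1 + (1 + n))) f i j :
  0 <= C -> flat_solver n C ->
  pfm G -> (forall x, pointed (G x)) -> (forall x, full (G x)) ->
  pf_frame f -> (forall x, is_frame (f x)) ->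
  (forall x, 0 < G x i 0) -> (forall x, 0 < G x j 0) ->
  (forall x k, lin (row k (G x)) (vl (fr_u (f x))) * G x i 0
                 <= lin (row i (G x)) (vl (fr_u (f x))) * G x k 0) ->
  (forall x k, lin (row j (G x)) (vl (fr_u (f x))) * G x k 0
                 <= lin (row k (G x)) (vl (fr_u (f x))) * G x j 0) ->
  (forall x, ~~ widb (G x) (fr_u (f x)) (24 * C + 6) 1) ->
  exists2 r, pfm r & forall x, step_ok (24 * C + 6) (G x) (fr_u (f x)) (r x).
Proof.
move=> C0 IH pG poG fG pff ff Gi Gj hi lo nw; have [pu pU pw pW] := pff.
pose a k x := lin (row k (G x)) (vl (fr_u (f x))).
pose B x : int := a i x * G x j 0 - a j x * G x i 0.
(* The midpoint of the extent, rounded down. *)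
pose v x := divz (a i x * G x j 0 + a j x * G x i 0) (2 * (G x i 0 * G x j 0)).
have pa k : pf (a k) by apply: pf_lin; [apply: pfm_row | apply: pfm_vl].
have pB : pf B by apply: pf_sub; apply: pf_mul.
have pv : pf v.
  apply: pf_div; first by apply: pf_add; apply: pf_mul.
  by apply: pf_mul (pf_cst _ _) _; apply: pf_mul.
have row0 x k : (row k (G x)) 0 0 = G x k 0 by rewrite mxE.
have hi' x z : incone (G x) z ->
    lin z (vl (fr_u (f x))) * G x i 0 <= lin (row i (G x)) (vl (fr_u (f x))) * z 0 0.
  rewrite -subr_ge0 => hz.
  have := @incone_ge0 _ _ (G x) (a i x *: dnf _ - G x i 0 *: vl (fr_u (f x))) z.
  rewrite linDr linNr !linZr lin_dnf [G x i 0 * _]mulrC; apply=> // k.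
  by rewrite linDr linNr !linZr lin_dnf row0 [G x i 0 * _]mulrC subr_ge0.
have lo' x z : incone (G x) z ->
    lin (row j (G x)) (vl (fr_u (f x))) * z 0 0 <= lin z (vl (fr_u (f x))) * G x j 0.
  rewrite -subr_ge0 => hz.
  have := @incone_ge0 _ _ (G x) (G x j 0 *: vl (fr_u (f x)) - a j x *: dnf _) z.
  rewrite linDr linNr !linZr lin_dnf [G x j 0 * _]mulrC; apply=> // k.
  by rewrite linDr linNr !linZr lin_dnf row0 [G x j 0 * _]mulrC subr_ge0; exact: lo.
have hB x : (24 * C + 6) * (G x i 0 * G x j 0) < B x.
  have [z [z' [hz hz']]] := nwidP (nw x); rewrite mul1r.
  have := hi' x z hz; have := lo' x z' hz'; rewrite -/(a i x) -/(a j x).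
  have [d0 _] := poG x z hz; have [d0' _] := poG x z' hz'.
  have := Gi x; have := Gj x; rewrite /B; move: (G x i 0) (G x j 0) (a i x) (a j x) d0 d0'.
  move: (lin z _) (lin z' _) (z 0 0) (z' 0 0) => p p' e e' gi gj ai aj e0 e0' gj0 gi0 h1 h2 h3.
  have h4 : (24 * C + 6) * (e * e') * (gi * gj) < (p * e' - p' * e) * (gi * gj).
    by rewrite ltr_pM2r // mulr_gt0.
  have h5 : (p * gi) * (e' * gj) <= (ai * e) * (e' * gj) by rewrite ler_wpM2r // mulr_ge0 // ltW.
  have h6 : (aj * e') * (e * gi) <= (p' * gj) * (e * gi) by rewrite ler_wpM2r // mulr_ge0 // ltW.
  have h7 : (24 * C + 6) * (gi * gj) * (e * e') < (ai * gj - aj * gi) * (e * e') by lia.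
  have ee : 0 < e * e'.
    rewrite lt0r mulr_ge0 // andbT; apply/eqP => z0.
    by rewrite z0 !mulr0 ltxx in h7.
  by rewrite ltr_pM2r in h7.
have gg x : 0 < G x i 0 * G x j 0 by apply: mulr_gt0.
have hv x : 2 * v x * (G x i 0 * G x j 0) <= a i x * G x j 0 + a j x * G x i 0
            < 2 * (v x + 1) * (G x i 0 * G x j 0).
  have D0 : 0 < 2 * (G x i 0 * G x j 0) by rewrite mulr_gt0.
  have := divz_bounds (a i x * G x j 0 + a j x * G x i 0) D0; rewrite -/(v x).
  by move: (v x) (G x i 0 * G x j 0) => *; lia.
have Bi x : B x <= 3 * ((a i x - v x * G x i 0) * G x j 0).
  have := hv x; have := hB x; have := gg x; rewrite /B; nia.
(* Rounding down may bring the slice closer to the lowest point by less than 1; the summand 6 in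
   [24 * C + 6] ensures that a third of the extent still lies below. *)
have Bj x : B x <= 3 * ((v x * G x j 0 - a j x) * G x i 0).
  have := hv x; have := hB x; have := gg x; rewrite /B; nia.
have [|||r' pr' sr'] := IH d _ (fun x => slice (f x) (v x) (G x)).
- exact: pfm_slice.
- by move=> x; apply: pointed_slice.
- move=> x; apply: (@full_slice _ _ _ (ff x) _ _ (row i (G x)) (row j (G x))) => //; try exact: incone_row.
    rewrite lin_slice_form row0 -/(a i x); have := Bi x; have := hB x; have := Gi x; have := Gj x.
    have := gg x; nia.
  rewrite lin_slice_form row0 -/(a j x); have := Bj x; have := hB x; have := Gi x; have := Gj x.
  have := gg x; nia.
pose eta x := fr_U (f x) *m pk_dir (r' x).
pose ae k x := lin (row k (G x)) (vl (eta x)).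
pose A x : int := ae i x * G x j 0 - ae j x * G x i 0.
(* The integer nearest to the slope [A x / B x] of the chord. *)
pose r x := divz (2 * A x + B x) (2 * B x).
have peta : pfm eta by apply: pfm_mul => //; apply: pfm_dir.
have pae k : pf (ae k) by apply: pf_lin; [apply: pfm_row | apply: pfm_vl].
have pA : pf A by apply: pf_sub; apply: pf_mul.
have pr : pf r.
  by apply: pf_div; [apply: pf_add => //|]; apply: pf_mul => //; apply: pf_cst.
exists (fun x => pack (pk_flag (r' x)) (v x *: fr_w (f x) + pk_pt (r' x) *m fr_W (f x))
                      (eta x - r x *: fr_u (f x))).
  apply: pfm_pack; first exact: pf_flag.
    by apply: pfm_add; [apply: pfm_scale | apply: pfm_mul => //; apply: pfm_pt].
  by apply: pfm_sub => //; apply: pfm_scale.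
move=> x; rewrite /step_ok !pkE; have := sr' x; rewrite /flat_ok; case: ifP => _.
  exact: incone_slice_pt.
case=> y0 hw.
have B0 : 0 < B x by have := hB x; have := gg x; nia.
have Ar : 2 * `|A x - r x * B x| <= B x.
  have D0 : 0 < 2 * B x by rewrite mulr_gt0.
  have := divz_bounds (2 * A x + B x) D0; rewrite -/(r x).
  by move: (r x) (A x) (B x) => *; lia.
have shrink al be : 0 < be -> wid (G x) (fr_u (f x)) al be ->
    wid (G x) (eta x - r x *: fr_u (f x)) (3 * al) (4 * be).
  move=> be0 hu z z' hz hz'.
  have cw := @chord_width _ _ (G x) (fr_u (f x)) (eta x) (v x) (r x) C (row i (G x)) (row j (G x))
    (@poG x) (incone_row _ _) (incone_row _ _).
  rewrite !row0 in cw; have {cw} := cw (Gi x) (Gj x) C0 (hi' x) (lo' x) (slice_wid (ff x) hw) B0 (Bi x) (Bj x) _ Ar z z' hz hz'.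
  have -> : 24 * C * (G x i 0 * G x j 0) <= B x by have := hB x; have := gg x; nia.
  move=> /(_ isT); have := hu _ _ (incone_row (G x) i) (incone_row (G x) j).
  rewrite !row0 -/(a i x) -/(a j x) -/(B x).
  have [d0 _] := poG x z hz; have [d0' _] := poG x z' hz'.
  have := mulr_ge0 d0 d0'; have := gg x; move: (z 0 0 * z' 0 0) (_ - _ * z 0 0) (G x i 0 * G x j 0) (B x).
  move=> P Q g b g0 P0 h1 h2; rewrite -(ler_pM2r g0).
  have h3 : be * (4 * Q * g) <= be * (3 * b * P) by rewrite ler_pM2l.
  have h4 : be * b * P <= al * g * P by rewrite ler_wpM2r.
  lia.
split; last by right.
  (* [fr_W] kills [fr_u] and inverts [fr_U], so it recovers the nonzero direction found in the
     slice. *)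
  apply/eqP => z; case/eqP: y0.
  have [_ _ h3 h4 _] := ff x; have := congr1 (mulmx (fr_W (f x))) z.
  by rewrite mulmxBr mulmxA h4 mul1mx -scalemxAr h3 scaler0 subr0 mulmx0.
move=> al be be0 hu; have := shrink al be be0 hu; apply: wid_weaken => //; try lia.
  have := hu _ _ (incone_center (G x)) (incone_center (G x)); rewrite subrr mulr0.
  have := center_gt0 (@poG x) (fG x); move: (center _ 0 0) => D D0; nia.
Qed.
Lemma pf_frame_sub (c : ctx) n (f : c -> frame n) p :
  pf_frame f -> @pf_frame (sub_ctx p) n (fun x => f (sval x)).
Proof.
case=> h1 h2 h3 h4; split.
- exact: pfm_sub_ctx h1.
- exact: pfm_sub_ctx h2.
- exact: pfm_sub_ctx h3.
- exact: pfm_sub_ctx h4.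
Qed.

(** Slicing requires a primitive direction. Dividing [y] by its content [g] never increases the
    width, since a nonzero integer has absolute value at least 1. *)
Lemma flat_step n (C : int) (c : ctx) M (G : c -> 'M[int]_(M, 1 + (1 + n))) y :
  0 <= C -> flat_solver n C ->
  pfm G -> (forall x, pointed (G x)) -> (forall x, full (G x)) ->
  pfm y -> (forall x, y x != 0) ->
  exists2 r, pfm r & forall x, step_ok (24 * C + 6) (G x) (y x) (r x).
Proof.
move=> C0 IH pG poG fG py y0; have [g [f [pg pff ff yE]]] := solve_frame py.
have [pu _ _ _] := pff.
have g0 x : g x != 0 by apply: contraNneq (y0 x) => z; rewrite yE z scale0r.
have sc x a b : 0 < b -> wid (G x) (y x) a b -> wid (G x) (fr_u (f x)) a b.
  by move=> b0; rewrite yE; apply: wid_scale.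
suff [r pr sr] : exists2 r, pfm r & forall x, step_ok (24 * C + 6) (G x) (fr_u (f x)) (r x).
  exists r => // x; have := sr x; rewrite /step_ok; case: ifP => // _ [h1 h2 h3]; split=> //.
    by move=> a b b0 hw; apply: h2 => //; apply: sc.
  by case: h3 => h3; [left | right=> a b b0 hw; apply: h3 => //; apply: sc].
pose bw x := widb (G x) (fr_u (f x)) (24 * C + 6) 1.
apply: (@solve_case c _ _ bw (fun x r => step_ok (24 * C + 6) (G x) (fr_u (f x)) r)).
- by apply: pfb_widb => //; apply: pf_cst.
- exists (fun x => pack 0 0 (fr_u (f (sval x)))).
    apply: pfm_pack; [exact: pf_cst | exact: pfm_cst | exact: pfm_sub_ctx pu].
  case=> x /= /widP hw; rewrite /step_ok !pkE ltxx; split=> //; last by left.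
  apply: contraNneq (y0 x) => z; by rewrite yE z scaler0.
pose d := sub_ctx (fun x => ~~ bw x).
pose a k (x : d) := lin (row k (G (sval x))) (vl (fr_u (f (sval x)))).
have pGd : @pfm d _ _ (fun x => G (sval x)) by exact: pfm_sub_ctx pG.
have pfd : @pf_frame d _ (fun x => f (sval x)) by exact: pf_frame_sub pff.
have pa k : @pf d (a k).
  by apply: pf_lin; [apply: pfm_row | apply: pfm_vl; case: pfd].
pose bb (ij : 'I_M * 'I_M) (x : d) :=
  [&& 0 < G (sval x) ij.1 0, 0 < G (sval x) ij.2 0,
     [forall k, a k x * G (sval x) ij.1 0 <= a ij.1 x * G (sval x) k 0]
   & [forall k, a ij.2 x * G (sval x) k 0 <= a k x * G (sval x) ij.2 0]].
apply: (@solve_choose d _ _ _ bb (fun x r => step_ok (24 * C + 6) (G (sval x)) (fr_u (f (sval x))) r)).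
- move=> ij; have p0 k : @pf d (fun x => G (sval x) k 0) by apply: pGd.
  apply: pfb_and; first by apply: pfb_lt => //; apply: pf_cst.
  apply: pfb_and; first by apply: pfb_lt => //; apply: pf_cst.
  by apply: pfb_and; apply: pfb_forall => k; apply: pfb_le; apply: pf_mul.
- move=> x; have [i Gi hi] := extremal_row (@poG (sval x)) (fr_u (f (sval x))) (fG (sval x)).
  have [j Gj lo] := extremal_row (@poG (sval x)) (- fr_u (f (sval x))) (fG (sval x)).
  exists (i, j); apply/and4P; split=> //; apply/forallP => k; first exact: hi.
  by have := lo k; rewrite vlN !linNr !mulNr lerN2.
move=> [i j]; apply: (@flat_step_main n C (sub_ctx (bb (i, j))) M (fun x => G (sval (sval x)))
  (fun x => f (sval (sval x))) i j) => //.
- exact: pfm_sub_ctx pGd.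
- exact: pf_frame_sub pfd.
- by case=> x /= /and4P[].
- by case=> x /= /and4P[].
- by case=> x /= /and4P[_ _ /forallP h _] k; apply: h.
- by case=> x /= /and4P[_ _ _ /forallP h] k; apply: h.
- by case=> [[x nb] hb].
Qed.

(** Three rounds gain a factor 2, because [27 * 2 <= 64]. *)
Lemma pow_four_three (t b : nat) : (3 * b <= t)%N -> (3 ^ t * 2 ^ b <= 4 ^ t)%N.
Proof.
move=> le; have [k ->] : exists k, t = (3 * b + k)%N by exists (t - 3 * b)%N; lia.
rewrite !(expnD _ (3 * b) k) !(expnM _ 3 b).
have h1 : ((3 ^ 3) ^ b * 2 ^ b <= (4 ^ 3) ^ b)%N by rewrite -expnMn; case: (b) => // b'; rewrite leq_exp2r.
have h2 : (3 ^ k <= 4 ^ k)%N by case: (k) => // k'; rewrite leq_exp2r.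
by have := leq_mul h1 h2; rewrite mulnAC.
Qed.

(** After [3 * bits H] rounds the width would be below 1, whereas a direction that fails the test
    has width above [C >= 1]. *)
Lemma iter_bound M n (G : 'M[int]_(M, 1 + n)) y (C H : int) t : pointed G -> 1 <= C ->
  wid G y ((3 ^ t)%N%:Z * H) (4 ^ t)%N%:Z -> ~~ widb G y C 1 -> (t < 3 * bits H)%N.
Proof.
move=> poG C1 hw /nwidP[x [x' [hx hx']]]; have := hw _ _ hx hx'.
have [d _] := poG _ hx; have [d' _] := poG _ hx'; have := mulr_ge0 d d'.
move: (_ - _) (x 0 0 * _) => Q P P0 h1; rewrite mul1r => h2.
rewrite ltnNge; apply/negP => /pow_four_three.
have := abs_lt_bits H; have : (0 < 4 ^ t)%N by rewrite expn_gt0.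
have : (0 < 3 ^ t)%N by rewrite expn_gt0.
move: (4 ^ t)%N (3 ^ t)%N (2 ^ bits H)%N h1 => F T B h1 T0 F0 HB FT.
have Q0 : 0 < Q by apply: le_lt_trans h2; apply: mulr_ge0 => //; lia.
have P1 : 0 < P.
  rewrite lt0r P0 andbT; apply/eqP => z; move: h1; rewrite z mulr0; nia.
have h3 : F%:Z * P <= F%:Z * Q by rewrite ler_wpM2l //; nia.
have h4 : F%:Z * P <= T%:Z * H * P by apply: le_trans h3 h1.
have h5 : F%:Z <= T%:Z * H by rewrite -(ler_pM2r P1).
have : T%:Z * H < T%:Z * B%:Z by rewrite ltr_pM2l; lia.
lia.
Qed.

(** * Iterated narrowing of a direction *)

Section FlatLoop.
Variables (n : nat) (C : int) (c : ctx) (M : nat) (G : c -> 'M[int]_(M, 1 + (1 + n))).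
Hypotheses (C0 : 0 <= C) (pG : pfm G) (poG : forall x, pointed (G x)) (fG : forall x, full (G x)).

(** A bound for the width along the first coordinate, where the search starts: nonzero generators
    have denominator at least 1, and a difference has two terms. *)
Let H x := 2 * \sum_i `|G x i (rshift 1 0)|.
Let C' := 24 * C + 6.

(** [g] is the guard and [a] the flag of a found point. The clauses [pk_pt r = 0] and
    [wid (G x) y (H x) 1] bound the registers holding the point and the direction; the last clause
    carries the decay of the width, which bounds [t]. *)
Definition flat_inv x t (s : 'rV[int]_(1 + (1 + ((1 + n) + (1 + n))))) : Prop :=
  let r := rsubmx s in let g := s 0 0 in let a := pk_flag r in let y := pk_dir r in
  [/\ [/\ (t <= 3 * bits (H x))%N, 0 <= g <= 1 & 0 <= a <= 1],
      if 0 < a then g <= 0 /\ incone (G x) (row_mx 1%:M (pk_pt r)) else pk_pt r = 0,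
      y != 0, wid (G x) y (H x) 1
    & if 0 < g then wid (G x) y ((3 ^ t)%N%:Z * H x) (4 ^ t)%N%:Z /\ ~~ widb (G x) y C' 1
      else 0 < a \/ wid (G x) y C' 1].

Lemma pf_flatH : pf H.
Proof. by apply: pf_mul (pf_cst _ _) _; apply: pf_sum => i; apply: pf_abs. Qed.

Lemma flat_loop_bound : loop_bound flat_inv.
Proof.
have [e1 h1] := wid_bits pG poG fG pf_flatH; have [e2 h2] := point_bits pG poG.
have [e he] : pbound sz (fun x : c => 1 + (3 * bits (H x) + ((sz x + 2) ^ e1 + (sz x + 2) ^ e2)))%N.
  apply: pboundD (pbound_cst _ _) _.
  apply: pboundD; first by apply: pboundM (pbound_cst _ _) (pf_bits pf_flatH).
  by apply: pboundD; [exists e1 | exists e2].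
exists e => x t; suff h : forall s : 'rV[int]_(1 + (1 + ((1 + n) + (1 + n)))), flat_inv x t s ->
    (t <= (sz x + 2) ^ e)%N /\ forall i, (bits (s 0%R i) <= (sz x + 2) ^ e)%N by exact: h.
move=> s [[ht hg ha] hz _ hy _]; split; first by have := he x; lia.
have b01 (z : int) : 0 <= z <= 1 -> (bits z <= 1)%N.
  by move=> hz01; apply: bits_le_exp => //; lia.
move=> i; apply: leq_trans (he x).
case: (@split_ordP 1 (1 + ((1 + n) + (1 + n))) i) => k ->.
  have -> : s 0 (lshift _ k) = s 0 0 by congr (s _ _); apply: val_inj; rewrite /= ord1.
  by apply: leq_trans (b01 _ hg) _; rewrite leq_addr.
have -> : s 0 (rshift 1 k) = rsubmx s 0 k by rewrite mxE.
case: (@split_ordP 1 ((1 + n) + (1 + n)) k) => l ->.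
  have -> : rsubmx s 0 (lshift _ l) = pk_flag (rsubmx s).
    by rewrite /pk_flag; congr (rsubmx s _ _); apply: val_inj; rewrite /= ord1.
  by apply: leq_trans (b01 _ ha) _; rewrite leq_addr.
have -> : rsubmx s 0 (rshift 1 l) = rsubmx (rsubmx s) 0 l by rewrite [RHS]mxE.
case: (@split_ordP (1 + n) (1 + n) l) => j ->.
  have -> : rsubmx (rsubmx s) 0 (lshift _ j) = pk_pt (rsubmx s) 0 j by rewrite [RHS]mxE.
  move: hz; case: ifP => _; last by move=> ->; rewrite mxE bits0; lia.
  by case=> _ /h2 /(_ j) h; apply: leq_trans h _; lia.
have -> : rsubmx (rsubmx s) 0 (rshift _ j) = pk_dir (rsubmx s) j 0 by rewrite [RHS]mxE [RHS]mxE.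
by apply: leq_trans (h1 _ _ hy j) _; lia.
Qed.

Lemma wid_first x : wid (G x) (delta_mx 0 0) (H x) 1.
Proof.
apply/widP/forallP => i; apply/forallP => j; rewrite mul1r.
have E k : lin (row k (G x)) (vl (delta_mx 0 0)) = G x k (rshift 1 0).
  rewrite /lin -[row k _]hsubmxK /vl mul_row_col mulmx0 add0r -colE !mxE //.
have G0 k : 0 <= G x k 0 /\ (G x k 0 = 0 -> G x k (rshift 1 0) = 0).
  have [h h'] := poG (incone_row (G x) k); rewrite mxE in h h'; split=> // /h'.
  by move=> /matrixP/(_ 0 (rshift 1 0)); rewrite !mxE.
have S k : `|G x k (rshift 1 0)| <= \sum_i `|G x i (rshift 1 0)|.
  by rewrite (bigD1 k) //= lerDl sumr_ge0.
rewrite !E /H; have [hi zi] := G0 i; have [hj zj] := G0 j; have := S i; have := S j.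
move: (\sum_i _) => T; move: (G x i _) (G x j _) (G x i 0) (G x j 0) hi zi hj zj.
move=> a b p q p0 zp q0 zq ha hb.
have [p1|p1] := eqVneq p 0.
  have [q1|q1] := eqVneq q 0; first by rewrite p1 q1; nia.
  by rewrite p1 (zp p1); nia.
have [q1|q1] := eqVneq q 0; first by rewrite q1 (zq q1); nia.
have aux (u v w : int) : `|u| <= T -> 1 <= v -> 1 <= w -> u * w <= T * (v * w).
  move=> hu hv hw; apply: (@le_trans _ _ (T * w)); first by rewrite ler_wpM2r //; lia.
  by rewrite ler_wpM2l ?ler_peMl //; lia.
have := aux a p q hb; have := aux (- b) q p; rewrite normrN => /(_ ha); lia.
Qed.

Lemma flat_loop : flat_solver n C ->
  exists2 r, pfm r & forall x, flat_ok C' (G x) (r x).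
Proof.
move=> IH; have C1 : 1 <= C' by rewrite /C'; lia.
have y0n : delta_mx 0 0 != 0 :> 'cV[int]_(1 + n).
  by apply/eqP => /matrixP/(_ 0 0); rewrite !mxE.
pose w0 x := widb (G x) (delta_mx 0 0) C' 1.
have pw0 : pfb w0 by apply: pfb_widb; [|exact: pfm_cst|exact: pf_cst|exact: pf_cst].
pose init x : 'rV[int]_(1 + (1 + ((1 + n) + (1 + n)))) :=
  row_mx (((~~ w0 x)%:R : int)%:M) (pack 0 0 (delta_mx 0 0)).
pose nb := flat_loop_bound; pose d := loop_ctx nb.
pose yd (p : d) := pk_dir (rsubmx ((sval p).2 : 'rV[int]_(1 + (1 + ((1 + n) + (1 + n)))))).
have pyd : pfm yd by apply: pfm_dir; apply: pfm_rsub; apply: pfm_loop_state.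
have pGd : @pfm d _ _ (fun p => G (sval p).1.1) by move=> i j; apply: (pf_loop_lift nb (pG i j)).
have yd0 p : yd p != 0 by case: p => [[[x t] s] /= [[]]].
have [||r pr sr] := flat_step C0 IH pGd _ _ pyd yd0; [by move=> x; apply: poG|by move=> x; apply: fG|].
pose w1 (p : d) := widb (G (sval p).1.1) (pk_dir (r p)) C' 1.
have pw1 : pfb w1 by apply: pfb_widb => //; [apply: pfm_dir|apply: pf_cst|apply: pf_cst].
pose step (p : d) : 'rV[int]_(1 + (1 + ((1 + n) + (1 + n)))) :=
  if 0 < pk_flag (r p) then row_mx 0 (pack 1 (pk_pt (r p)) (yd p))
  else row_mx (((~~ w1 p)%:R : int)%:M) (pack 0 0 (pk_dir (r p))).
have g01 (b : bool) : 0 <= (b%:R : int) <= 1 by case: b.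
have pinit : pfm init.
  apply: pfm_row_mx; first by apply: pfm_scalar; apply: pfb_neg.
  by apply: pfm_pack; [apply: pf_cst|apply: pfm_cst|apply: pfm_cst].
have pstep : pfm step.
  apply: pfm_if; first exact: pf_flag.
    by apply: pfm_row_mx; [apply: pfm_cst | apply: pfm_pack => //; [apply: pf_cst | apply: pfm_pt]].
  apply: pfm_row_mx; first by apply: pfm_scalar; apply: pfb_neg.
  by apply: pfm_pack; [apply: pf_cst|apply: pfm_cst|apply: pfm_dir].
have row0 (a : int) (r0 : 'rV[int]_(1 + ((1 + n) + (1 + n)))) : (row_mx a%:M r0 : 'rV_(1 + _)) 0 0 = a.
  by rewrite dn_lsub row_mxKl mxE.
have Iinit x : flat_inv x 0 (init x).
  rewrite /flat_inv /init row0 row_mxKr !pkE ltxx; split=> //.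
    exact: wid_first.
  case: (boolP (w0 x)) => /= [/widP h|h]; first by right.
  by split=> //; rewrite !expn0 mul1r; apply: wid_first.
have Istep x t (s : 'rV[int]_(1 + (1 + ((1 + n) + (1 + n))))) (q : 'rV[int]_(1 + ((1 + n) + (1 + n)))) :
    let y := pk_dir (rsubmx s) in flat_inv x t s -> 0 < s 0 0 -> step_ok C' (G x) y q ->
    flat_inv x t.+1 (if 0 < pk_flag q then row_mx 0%:M (pack 1 (pk_pt q) y)
      else row_mx (((~~ widb (G x) (pk_dir q) C' 1)%:R : int)%:M) (pack 0 0 (pk_dir q))).
  move=> y [[ht hg ha] hz hy hw]; case: ifP => // _ [hw3 nw] _.
  have ht1 : (t.+1 <= 3 * bits (H x))%N by apply: iter_bound hw3 nw.
  rewrite /step_ok; case: ifP => _ h; rewrite /flat_inv row0 row_mxKr !pkE.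
    by split=> //=; left.
  case: h => [n0 mono h]; rewrite ltxx; split=> //.
    by apply: mono.
  case: (boolP (widb _ _ _ _)) => /= [/widP h'|nw']; first by right.
  split=> //; case: h => [/widP h|h]; first by rewrite h in nw'.
  have := h _ _ _ hw3; rewrite !expnS !PoszM mulrA; apply.
  by rewrite ltz_nat expn_gt0.
have [||||F pF sF] := @solve_loop c _ flat_inv nb init step.
- exact: pinit.
- exact: Iinit.
- exact: pstep.
- move=> p; have [hI pos] := svalP p; have := Istep _ _ _ _ hI pos (sr p).
  by rewrite /step /yd; case: ifP => _ //; rewrite raddf0.
pose Fr x : 'rV[int]_(1 + ((1 + n) + (1 + n))) := rsubmx (F x : 'rV[int]_(1 + (1 + ((1 + n) + (1 + n))))).
exists Fr; first by apply: pfm_rsub.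
move=> x; have [[t hI] stop] := sF x; rewrite /flat_ok.
case: hI => _; rewrite -/(Fr x) => hz hy _; rewrite ltNge stop /=.
by case: ifP hz => [_ [] //|_ _ [//|h]].
Qed.
End FlatLoop.

(** In dimension 0 a full body is nonempty and its only point is integral, so a direction is never
    asked for. *)
Lemma flat n : exists2 C : int, 0 <= C & flat_solver n C.
Proof.
elim: n => [|n [C C0 IH]]; last first.
  exists (24 * C + 6); first by lia.
  by move=> c M G pG poG fG; apply: flat_loop.
exists 0 => // c M G pG poG fG; exists (fun=> pack 1 0 0); first exact: pfm_cst.
move=> x; rewrite /flat_ok !pkE /=; have D0 := center_gt0 (@poG x) (fG x).
apply: (incone_cancel D0); suff -> : center (G x) 0 0 *: row_mx 1%:M 0 = center (G x).
  exact: incone_center.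
apply/matrixP => i j; rewrite !ord1 [LHS]mxE (dn_row (0 : 'rV_0)) mulr1.
by congr (center _ _ _); apply: val_inj; case: j => [[]].
Qed.
(** * Integer programming in fixed dimension *)

Definition kernel_ok M n (G : 'M[int]_(M, n)) (r : 'rV[int]_(1 + n)) :=
  let l := (rsubmx r)^T in if 0 < r 0 0 then G *m l = 0 /\ l != 0 else full G.

Lemma flag_row n (a : int) (z : 'rV[int]_n) : (row_mx a%:M z : 'rV_(1 + n)) 0 0 = a.
Proof. by rewrite dn_lsub row_mxKl mxE. Qed.

Lemma lin_split n (z : 'rV[int]_(1 + n)) (l : 'cV[int]_(1 + n)) :
  lin z l = usubmx l 0 0 * z 0 0 + lin z (vl (dsubmx l)).
Proof.
have -> : lin z l = lin z (usubmx l 0 0 *: dnf n + vl (dsubmx l)).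
  congr lin; rewrite /dnf /vl scale_col_mx scaler0 add_col_mx addr0 add0r -{1}[l]vsubmxK.
  by congr col_mx; rewrite scalemx1 -mx11_scalar.
by rewrite linDr linZr lin_dnf.
Qed.

Lemma dnf_neq0 n : dnf n != 0.
Proof. by apply/eqP => /matrixP/(_ (lshift n 0) 0); rewrite col_mxEu !mxE. Qed.

(** If the first column vanishes, the first coordinate is the required form. Otherwise a pivot is
    eliminated; both a form vanishing on the smaller matrix and the fullness of that matrix lift
    back. *)
Lemma solve_kernel n (c : ctx) M (G : c -> 'M[int]_(M, n)) : pfm G ->
  exists2 r, pfm r & forall x, kernel_ok (G x) (r x).
Proof.
elim: n c G => [|n IH] c G pG.
  exists (fun=> 0); first exact: pfm_cst.
  by move=> x; rewrite /kernel_ok mxE ltxx => l _; apply/matrixP => -[].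
pose b x := [forall i, G x i 0 == 0].
apply: (@solve_case c _ _ b (fun x r => @kernel_ok M (1 + n) (G x) r)).
- by apply: pfb_forall => i; apply: pfb_eq0.
- exists (fun=> row_mx 1%:M (dnf n)^T); first exact: pfm_cst.
  case=> x /= /forallP h; rewrite /kernel_ok flag_row row_mxKr trmxK /=; split; last exact: dnf_neq0.
  by apply/matrixP => i j; rewrite ord1 -lin_row lin_dnf !mxE; apply/eqP.
pose d := sub_ctx (fun x => ~~ b x).
have pGd : @pfm d _ _ (fun x => G (sval x)) by exact: pfm_sub_ctx pG.
apply: (@solve_choose d _ _ _ (fun i x => G (sval x) i 0 != 0) (fun x r => @kernel_ok M (1 + n) (G (sval x)) r)).
- by move=> i; apply: pfb_neg; apply: pfb_eq0; apply: pGd.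
- by case=> x /=; rewrite negb_forall => /existsP.
move=> i; pose d' := sub_ctx (fun x : d => G (sval x) i 0 != 0).
pose H (x : d') : 'M[int]_(M, 1 + n) := G (sval (sval x)).
have pH : pfm H by exact: pfm_sub_ctx pGd.
have pE : pfm (fun x => elim_mx (H x) i).
  apply: pfm_sub; first by apply: pfm_scale; [apply: pH | apply: pfm_rsub].
  by apply: pfm_mul; [apply: pfm_lsub | apply: pfm_row; apply: pfm_rsub].
have [r pr sr] := IH d' _ pE.
have pl : pfm (fun x => (rsubmx (r x))^T) by apply: pfm_tr; apply: pfm_rsub.
exists (fun x => row_mx (r x 0 0)%:M (elim_back (H x) i (rsubmx (r x))^T)^T).
  apply: pfm_row_mx; first by apply: pfm_scalar; apply: pr.
  apply: pfm_tr; apply: pfm_col_mx; last by apply: pfm_scale => //; apply: pH.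
  by apply: pfm_opp; apply: pfm_mul => //; apply: pfm_row; apply: pfm_rsub.
move=> x; have p0 : H x i 0 != 0 := svalP x.
have := sr x; rewrite /kernel_ok flag_row row_mxKr trmxK -/(H x); case: ifP => _.
  move=> [E l0]; split; first by rewrite elim_backE.
  by rewrite /elim_back col_mx_eq0 negb_and scalemx_eq0 (negPf p0) l0 orbT.
move=> fE l E; have := elim_mxE (H x) i l; rewrite E scaler0 row0 mulmx0 subrr => /fE l0.
have := E; rewrite -[H x]hsubmxK -[l]vsubmxK mul_row_col l0 mulmx0 addr0 => /matrixP/(_ i 0).
rewrite mxE big_ord1 !mxE => h; rewrite -[RHS](@col_mx0 _ 1 n); congr col_mx.
apply/matrixP => a e; rewrite !ord1 !mxE.
have /eqP : H x i 0 * l (lshift n 0) 0 = 0 by rewrite -h; congr (H x _ _ * _); apply: val_inj.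
by rewrite mulf_eq0 (negPf p0) /= => /eqP.
Qed.

Definition ip_ok M n (G : 'M[int]_(M, 1 + n)) (r : 'rV[int]_(1 + n)) :=
  if 0 < r 0 0 then incone G (row_mx 1%:M (rsubmx r)) else forall z, ~ incone G (row_mx 1%:M z).

Definition ip_solver n := forall (c : ctx) M (G : c -> 'M[int]_(M, 1 + n)),
  pfm G -> (forall x, pointed (G x)) -> exists2 r, pfm r & forall x, ip_ok (G x) (r x).

(** The direction may be zero if the body has no integer point at all; this accounts for degenerate
    bodies that admit no useful direction. *)
Definition narrow_ok C M n (G : 'M[int]_(M, 1 + n)) r :=
  if 0 < pk_flag r then incone G (row_mx 1%:M (pk_pt r)) else
  wid G (pk_dir r) C 1 /\ (pk_dir r != 0 \/ forall z, ~ incone G (row_mx 1%:M z)).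

(** Removes the hypothesis [full]. A form vanishing on all generators is constant minus a direction
    of width 0; should that direction be zero, the constant is not, and it forces every denominator
    to vanish. *)
Lemma solve_narrow n : exists2 C : int, 0 <= C &
  forall (c : ctx) M (G : c -> 'M[int]_(M, 1 + n)),
  pfm G -> (forall x, pointed (G x)) -> exists2 r, pfm r & forall x, narrow_ok C (G x) (r x).
Proof.
have [C C0 solver] := flat n; exists C => // c M G pG poG.
have [k pk sk] := solve_kernel pG.
apply: (@solve_case c _ _ (fun x => 0 < k x 0 0) (fun x r => narrow_ok C (G x) r)).
- by apply: pfb_lt; [apply: pf_cst | apply: pk].
- pose l x : 'cV[int]_(1 + n) := (rsubmx (k x))^T.
  exists (fun x => pack 0 0 (dsubmx (l (sval x)))).
    apply: (@pfm_sub_ctx c _ _ (fun x => 0 < k x 0 0) (fun x => pack 0 0 (dsubmx (l x)))).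
    apply: pfm_pack; [exact: pf_cst | exact: pfm_cst|].
    move=> i j; apply: pf_ext (pfm_tr (pfm_rsub pk) (rshift 1 i) j) => x.
    by rewrite [RHS]mxE.
  case=> x /= pos; have := sk x; rewrite /kernel_ok pos -/(l x) => -[E l0].
  rewrite /narrow_ok !pkE ltxx.
  have lE z : incone (G x) z -> lin z (vl (dsubmx (l x))) = - (usubmx (l x) 0 0 * z 0 0).
    move=> hz; have : lin z (l x) = 0 by apply: incone_eq0 hz => i; rewrite lin_row E mxE.
    by rewrite lin_split => /eqP; rewrite addrC addr_eq0 => /eqP.
  split.
    move=> z z' hz hz'; rewrite !lE // mul1r.
    have [d _] := poG x z hz; have [d' _] := poG x z' hz'; have := mulr_ge0 d d'; nia.
  have [y0|] := eqVneq (dsubmx (l x)) 0; last by left.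
  right=> z hz; have := lE _ hz; rewrite y0 /vl col_mx0 /lin mulmx0 mxE dn_row mulr1 => /eqP.
  rewrite eq_sym oppr_eq0 => /eqP z0; case/eqP: l0.
  rewrite -[l x]vsubmxK y0 -[RHS](@col_mx0 _ 1 n); congr col_mx.
  by rewrite [LHS]mx11_scalar z0 raddf0.
have [|||r pr sr] := solver (sub_ctx (fun x => ~~ (0 < k x 0 0))) M (fun x => G (sval x)).
- exact: pfm_sub_ctx pG.
- by move=> x; apply: poG.
- by case=> x /= h; have := sk x; rewrite /kernel_ok (negPf h).
exists r => // -[x h]; have := sr (exist _ x h); rewrite /flat_ok /narrow_ok /=.
by case: ifP => // _ [h1 h2]; split=> //; left.
Qed.

Lemma slice_point n (f : frame n) v (z : 'rV[int]_(1 + n)) : is_frame f -> lin z (fr_u f) = v ->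
  row_mx 1%:M (z *m fr_U f) *m slice_emb f v = row_mx 1%:M z.
Proof.
move=> [_ _ _ _ h5] <-; rewrite mul_row_block !mul1mx mulmx0 addr0; congr row_mx.
by rewrite -{3}[z]mulmx1 -h5 mulmxDr !mulmxA linP mul_scalar_mx.
Qed.

(** The number [K] of slices is independent of the instance, so the search is unrolled in the
    program instead of being a loop. *)
Lemma ip_search n (c : ctx) M (G : c -> 'M[int]_(M, 1 + (1 + n))) f v K :
  ip_solver n -> pfm G -> (forall x, pointed (G x)) -> pf_frame f -> (forall x, is_frame (f x)) -> pf v ->
  exists2 r : c -> 'rV[int]_(1 + (1 + n)), pfm r & forall x,
    if 0 < r x 0 0 then incone (G x) (row_mx 1%:M (rsubmx (r x))) else
    forall k z, (k < K)%N -> lin z (fr_u (f x)) = v x + k%:Z -> ~ incone (G x) (row_mx 1%:M z).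
Proof.
move=> IH pG poG pff ff pv; have [pu pU pw pW] := pff.
elim: K => [|K [r pr sr]].
  by exists (fun=> 0); [apply: pfm_cst | move=> x; rewrite mxE ltxx].
have pvK : pf (fun x => v x + K%:Z) by apply: pf_add => //; apply: pf_cst.
have [||r' pr' sr'] := IH c _ (fun x => slice (f x) (v x + K%:Z) (G x)).
- exact: pfm_slice.
- by move=> x; apply: pointed_slice.
exists (fun x => if 0 < r x 0 0 then r x else
  row_mx (r' x 0 0)%:M ((v x + K%:Z) *: fr_w (f x) + rsubmx (r' x) *m fr_W (f x))).
  apply: pfm_if => //; apply: pfm_row_mx; first by apply: pfm_scalar; apply: pr'.
  by apply: pfm_add; [apply: pfm_scale | apply: pfm_mul => //; apply: pfm_rsub].
move=> x; have := sr x; case: (ltP 0 (r x 0 0)) => [pos|_ none]; first by rewrite pos.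
have := sr' x; rewrite /ip_ok flag_row row_mxKr; case: ifP => _; first exact: incone_slice_pt.
move=> noK k z; rewrite ltnS leq_eqVlt => /orP[/eqP-> E hz|kK]; last exact: none.
apply: (noK (z *m fr_U (f x))); apply/incone_slice; first exact: ff.
by rewrite slice_point.
Qed.

Lemma center_dn_gt0 M n (G : 'M[int]_(M, 1 + n)) z : pointed G ->
  incone G (row_mx 1%:M z) -> 0 < center G 0 0.
Proof.
move=> poG hz; rewrite lt0r (poG _ (incone_center G)).1 andbT; apply/eqP => D0.
have G0 k : 0 <= G k 0 by have [] := poG _ (incone_row G k); rewrite mxE.
have : lin (row_mx 1%:M z) (dnf n) = 0.
  apply: incone_eq0 hz => i; rewrite lin_dnf mxE; move/eqP: D0.
  rewrite mxE psumr_eq0 => [/allP/(_ i)|k _]; last by rewrite mxE mul1r.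
  by rewrite mem_index_enum => /(_ isT); rewrite mxE mul1r => /eqP.
by rewrite lin_dnf dn_row.
Qed.

(** The values of a narrow direction at the points of the body differ from its value at the center
    by at most [C]. Integer values are therefore among the [2 * C + 2] consecutive integers from
    [v x] on, and each slice has smaller dimension. *)
Theorem integer_programming n : ip_solver n.
Proof.
elim: n => [|n IH] c M G pG poG.
  exists (fun x => row_mx (center (G x) 0 0)%:M 0).
    apply: pfm_row_mx; last exact: pfm_cst.
    by apply: pfm_scalar; apply: (pfm_mul (pfm_cst _ _) pG).
  move=> x; rewrite /ip_ok flag_row row_mxKr; case: ifP => [D0|nD z hz]; last first.
    by rewrite (center_dn_gt0 (@poG x) hz) in nD.
  apply: (incone_cancel D0); suff -> : center (G x) 0 0 *: row_mx 1%:M 0 = center (G x).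
    exact: incone_center.
  apply/matrixP => i j; rewrite !ord1 [LHS]mxE (dn_row (0 : 'rV_0)) mulr1.
  by congr (center _ _ _); apply: val_inj; case: j => [[]].
have [C C0 narrow] := solve_narrow (1 + n); have [r pr sr] := narrow c M G pG poG.
have [g [f [pg pff ff yE]]] := solve_frame (pfm_dir pr).
have pcen : pfm (fun x => center (G x)) by apply: pfm_mul => //; apply: pfm_cst.
pose v x := (lin (center (G x)) (vl (fr_u (f x))) %/ center (G x) 0%R 0%R)%Z - C.
have pv : pf v.
  apply: pf_sub; last exact: pf_cst.
  by apply: pf_div; [apply: pf_lin => //; apply: pfm_vl; case: pff | apply: pcen].
have [r' pr' sr'] := ip_search (2 * absz C + 2)%N IH pG poG pff ff pv.
exists (fun x => if 0 < pk_flag (r x) then row_mx 1%:M (pk_pt (r x)) else r' x).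
  by apply: pfm_if => //; [apply: pf_flag | apply: pfm_row_mx; [apply: pfm_cst | apply: pfm_pt]].
move=> x; have := sr x; rewrite /narrow_ok; case: ifP => _ h.
  by rewrite /ip_ok dn_row row_mxKr.
have := sr' x; rewrite /ip_ok; case: ifP => // _ none z hz.
case: h => hw [y0|no]; last exact: no hz.
have g0 : g x != 0 by apply: contraNneq y0 => z0; rewrite yE z0 scale0r.
rewrite yE in hw; have {}hw := wid_scale (@poG x) g0 ltr01 hw.
have D0 := center_dn_gt0 (@poG x) hz.
have h1 := hw _ _ hz (incone_center (G x)); have h2 := hw _ _ (incone_center (G x)) hz.
rewrite !lin_vl !dn_row !mul1r !mulr1 in h1 h2.
have := divz_bounds (lin (center (G x)) (vl (fr_u (f x)))) D0.
have vE : v x = (lin (center (G x)) (vl (fr_u (f x))) %/ center (G x) 0%R 0%R)%Z - C by [].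
move: (_ %/ _)%Z vE => q vE hq.
move: (center _ 0 0) (lin (center _) _) D0 h1 h2 hq => D L D0 h1 h2 hq.
have l1 : v x <= lin z (fr_u (f x)).
  have : (q - C) * D < (lin z (fr_u (f x)) + 1) * D by lia.
  by rewrite ltr_pM2r // vE; lia.
have l2 : lin z (fr_u (f x)) < v x + (2 * C + 2).
  have : lin z (fr_u (f x)) * D < (q + 1 + C) * D by lia.
  by rewrite ltr_pM2r // vE; lia.
apply: (none (absz (lin z (fr_u (f x)) - v x)) z _ _ hz); move: (lin _ _) (v x) l1 l2 => *; lia.
Qed.

(** * Minimizing the sum of the coordinates under linear constraints *)

Definition simplex m (N : int) : 'M[int]_(1 + m, 1 + m) := block_mx 1%:M 0 (const_mx 1) N%:M.

Lemma simplex_comb m N (c0 : 'rV[int]_1) (c : 'rV[int]_m) :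
  row_mx c0 c *m simplex m N = row_mx (c0 0 0 + \sum_j c 0 j)%:M (N *: c).
Proof.
rewrite mul_row_block mulmx1 mulmx0 add0r mul_mx_scalar; congr row_mx.
rewrite [LHS]mx11_scalar mxE; congr (_ + _)%:M; rewrite mxE.
by apply: eq_bigr => j _; rewrite mxE mulr1.
Qed.

Lemma pointed_simplex m N : pointed (simplex m N).
Proof.
move=> x [q [c [q0 c0 E]]]; move: E; rewrite -[c]hsubmxK simplex_comb -[x]hsubmxK scale_row_mx.
move=> /eq_row_mx[E0 Ez].
have cl : 0 <= lsubmx c 0 0 by rewrite mxE c0.
have cr j : 0 <= rsubmx c 0 j by rewrite mxE c0.
have S0 : 0 <= \sum_j rsubmx c 0 j by apply: sumr_ge0.
have {E0} : q * lsubmx x 0 0 = lsubmx c 0 0 + \sum_j rsubmx c 0 j.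
  by have /matrixP/(_ 0 0) := E0; rewrite mxE => ->; rewrite mxE.
rewrite dn_lsub row_mxKl => E0; split.
  by rewrite -(pmulr_rge0 _ q0) E0 addr_ge0.
move=> z; rewrite z mulr0 in E0.
have Sz : \sum_j rsubmx c 0 j = 0 by lia.
have cz : rsubmx c = 0.
  apply/matrixP => i j; rewrite ord1 [RHS]mxE; have /eqP := Sz; rewrite psumr_eq0 // => /allP/(_ j).
  by rewrite mem_index_enum => /(_ isT) /eqP.
have -> : lsubmx x = 0 by rewrite [LHS]mx11_scalar z raddf0.
have : q *: rsubmx x == 0 by rewrite Ez cz scaler0.
by rewrite scalemx_eq0 gt_eqF //= => /eqP->; rewrite row_mx0.
Qed.

(** For [N > 0] the coefficients over the denominator [N] are the slack [N - \sum_j k 0 j] and the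
    entries of [k]. For [N = 0] all generators coincide and only [k = 0] remains, so this case has
    its own coefficients. *)
Lemma incone_simplex m N (k : 'rV[int]_m) : 0 <= N ->
  incone (simplex m N) (row_mx 1%:M k) <-> (forall j, 0 <= k 0 j) /\ \sum_j k 0 j <= N.
Proof.
move=> N0; split=> [[q [c [q0 c0]]]|[k0 kN]].
  rewrite -[c]hsubmxK simplex_comb scale_row_mx => /eq_row_mx[E0 Ez].
  have cr j : 0 <= rsubmx c 0 j by rewrite mxE c0.
  have kE j : q * k 0 j = N * rsubmx c 0 j by have /matrixP/(_ 0 j) := Ez; rewrite !mxE.
  split=> [j|]; first by rewrite -(pmulr_rge0 _ q0) kE mulr_ge0.
  rewrite -(ler_pM2l q0) mulr_sumr (eq_bigr (fun j => N * rsubmx c 0 j)) => [|j _]; last exact: kE.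
  rewrite -mulr_sumr; have : q = lsubmx c 0 0 + \sum_j rsubmx c 0 j.
    by have /matrixP/(_ 0 0) := E0; rewrite mxE [X in _ * X]mxE mulr1 => ->; rewrite mxE.
  have : 0 <= lsubmx c 0 0 by rewrite mxE c0.
  move: (lsubmx c 0 0) (\sum_j _) => p s p0 ->; nia.
have [Nz|Np] := eqVneq N 0; last first.
  have {}N0 : 0 < N by rewrite lt0r Np.
  exists N, (row_mx (N - \sum_j k 0 j)%:M k); split=> // [i|].
    case: (split_ordP i) => l ->; rewrite ?row_mxEl ?row_mxEr // mxE ord1 mulr1n subr_ge0 //.
  by rewrite simplex_comb mxE mulr1n subrK scale_row_mx scalemx1.
have kz : k = 0.
  apply/matrixP => i j; rewrite ord1 mxE; apply/eqP; have := kN; rewrite Nz => le.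
  have : \sum_j k 0 j == 0 by rewrite eq_le le sumr_ge0.
  by rewrite psumr_eq0 // => /allP/(_ j); rewrite mem_index_enum => /(_ isT).
exists 1, (row_mx 1%:M 0); split=> // [i|].
  by case: (split_ordP i) => l ->; rewrite ?row_mxEl ?row_mxEr mxE // ord1.
by rewrite simplex_comb scale1r kz scaler0 mxE big1 ?addr0 // => j _; rewrite mxE.
Qed.

Lemma solve_cuts (c : ctx) n (T : eqType) (L : T -> c -> 'cV[int]_(1 + n)) (s : seq T) M
    (G : c -> 'M[int]_(M, 1 + n)) :
  (forall j, pfm (L j)) -> pfm G -> (forall x, pointed (G x)) ->
  exists M' (G' : c -> 'M[int]_(M', 1 + n)), [/\ pfm G', forall x, pointed (G' x)
    & forall x z, incone (G' x) z <-> incone (G x) z /\ {in s, forall j, 0 <= lin z (L j x)}].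
Proof.
move=> pL pG poG; elim: s => [|j s [M' [G' [pG' poG' hG']]]].
  by exists M, G; split=> // x z; split=> [|[]].
exists (cut_size M'), (fun x => cut (G' x) (L j x)); split.
- exact: pfm_cut.
- by move=> x; apply: pointed_cut.
move=> x z; split=> [/incone_cut[/hG'[h1 h2] h3]|[h1 h2]].
  by split=> // i; rewrite inE => /orP[/eqP->//|]; apply: h2.
apply/incone_cut; split; last by apply: h2; rewrite inE eqxx.
by apply/hG'; split=> // i si; apply: h2; rewrite inE si orbT.
Qed.

(** The bound on the sum confines the points to a simplex, which provides the boundedness demanded
    by [pointed]; the constraints are then imposed by cuts. *)
Lemma solve_bounded_sum (c : ctx) m (L : 'I_m -> c -> 'cV[int]_(1 + m)) (N : c -> int) :
  (forall j, pfm (L j)) -> pf N -> (forall x, 0 <= N x) ->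
  exists2 r : c -> 'rV[int]_(1 + m), pfm r & forall x,
    let P (k : 'rV[int]_m) := [/\ forall j, 0 <= k 0 j, \sum_j k 0 j <= N x
      & forall j, 0 <= lin (row_mx 1%:M k) (L j x)] in
    if 0 < r x 0 0 then P (rsubmx (r x)) else forall k, ~ P k.
Proof.
move=> pL pN N0.
have pS : pfm (fun x => simplex m (N x)).
  apply: pfm_block_mx; try exact: pfm_cst.
  move=> i j; apply: pf_ext (pf_mul pN (pf_cst c (i == j)%:R)) => x.
  by rewrite mxE mulr_natr.
have [M [G [pG poG hG]]] := solve_cuts (enum 'I_m) pL pS (fun x => @pointed_simplex m (N x)).
have [r pr sr] := integer_programming pG poG; exists r => // x P.
have PE k : incone (G x) (row_mx 1%:M k) <-> P k.
  split=> [/hG[/incone_simplex -/(_ (N0 x))[h1 h2] h3]|[h1 h2 h3]].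
    by split=> // j; apply: h3; rewrite mem_enum.
  by apply/hG; split; [apply/incone_simplex|].
by have := sr x; rewrite /ip_ok; case: ifP => _ h; [apply/PE | move=> k /PE; apply: h].
Qed.

Section Minimum.
Variables (c : ctx) (m : nat) (L : 'I_m -> c -> 'cV[int]_(1 + m)) (U : c -> int).
Hypotheses (pL : forall j, pfm (L j)) (pU : pf U).

Let feas x (k : 'rV[int]_m) := (forall j, 0 <= k 0 j) /\ forall j, 0 <= lin (row_mx 1%:M k) (L j x).

Hypothesis Ufeas : forall x, exists2 k, feas x k & \sum_j k 0 j <= U x.

(** The least feasible sum lies between [lo] and [lo + g]. The length [g] of this interval is also
    the guard of the loop, and it is at least halved in each round. *)
Definition min_inv x t (s : 'rV[int]_2) : Prop :=
  let g := s 0 0 in let lo := s 0 1 in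
  [/\ [/\ 0 <= g, 0 <= lo & lo + g <= U x], forall k, feas x k -> lo <= \sum_j k 0 j,
     exists2 k, feas x k & \sum_j k 0 j <= lo + g & (2 ^ t)%N%:Z * g <= U x /\ (t <= bits (U x))%N].

Lemma min_bound : loop_bound min_inv.
Proof.
have [e he] := pf_bits pU; exists e => x t s [[h1 h2 h3] _ _ [_ ht]].
split; first exact: leq_trans (he x).
move=> i; apply: leq_trans (he x); apply: bits_mono.
have [->|->] : i = 0 \/ i = 1 by case: i => [[|[|]]] // hi; [left|right]; apply: val_inj.
  by lia.
lia.
Qed.

Lemma solve_min : exists2 F : c -> 'rV[int]_m, pfm F & forall x,
  feas x (F x) /\ forall k, feas x k -> \sum_j F x 0 j <= \sum_j k 0 j.
Proof.
have U0 x : 0 <= U x.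
  by have [k [k0 _] le] := Ufeas x; apply: le_trans le; apply: sumr_ge0.
pose nb := min_bound; pose d := loop_ctx nb.
pose g (p : d) := (sval p).2 0 0; pose lo (p : d) := (sval p).2 0 1.
have ps := pfm_loop_state nb.
have pg : pf g by apply: ps. have plo : pf lo by apply: ps.
pose N (p : d) := lo p + (g p %/ 2)%Z.
have pN : pf N by apply: pf_add => //; apply: pf_div => //; apply: pf_cst.
have N0 p : 0 <= N p.
  by have [[[h1 h2 h3] _ _ _] _] := svalP p; rewrite /N; apply: addr_ge0 => //; rewrite divz_ge0.
have [r pr sr] := @solve_bounded_sum d m (fun j p => L j (sval p).1.1) N
  (fun j => fun a b => pf_loop_lift nb (pL j a b)) pN N0.
pose init x := seq_row 2 [:: U x; 0].
(* A negative answer excludes the sum [N p] itself, so the interval then starts at [N p + 1] and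
   keeps its right end. *)
pose step (p : d) := if 0 < r p 0 0 then seq_row 2 [:: (g p %/ 2)%Z; lo p]
  else seq_row 2 [:: g p - (g p %/ 2)%Z - 1; N p + 1].
have pg2 : pf (fun p => (g p %/ 2)%Z) by apply: pf_div => //; apply: pf_cst.
have [||||F pF sF] := @solve_loop c 1 min_inv nb init step.
- by apply: pfm_seq_row => -[|[|//]] _ /=; [|apply: pf_cst].
- move=> x; rewrite /min_inv !seq_rowE /=; split=> //.
  + by rewrite add0r; split.
  + by move=> k [k0 _]; apply: sumr_ge0.
  + by rewrite add0r; apply: Ufeas.
  + by rewrite expn0 mul1r.
- apply: pfm_if; first exact: pr.
    by apply: pfm_seq_row => -[|[|//]] _.
  apply: pfm_seq_row => -[|[|//]] _ /=; last by apply: pf_add => //; apply: pf_cst.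
  by apply: pf_sub; [apply: pf_sub | apply: pf_cst].
- move=> p; have := sr p; have := N0 p; rewrite /step /N /g /lo.
  have [[[h1 h2 h3] hlo [k0 fk0 sk0] [hT ht]] pos] := svalP p.
  move: (sval p).1.1 (sval p).1.2 (sval p).2 (r p) h1 h2 h3 hlo fk0 sk0 hT ht pos.
  move=> x t s q h1 h2 h3 hlo fk0 sk0 hT ht pos n0.
  have ht1 : (t.+1 <= bits (U x))%N.
    rewrite -(ltn_exp2l _ _ (isT : (1 < 2)%N)); have := abs_lt_bits (U x).
    move: (2 ^ t)%N (2 ^ bits _)%N hT (U0 x) => A B hA hU hB.
    have : A%:Z <= A%:Z * s 0 0 by rewrite ler_peMr //; lia.
    lia.
  have [d1 d2] : (s 0%R 0%R %/ 2)%Z * 2 <= s 0%R 0%R /\ s 0%R 0%R < ((s 0%R 0%R %/ 2)%Z + 1) * 2.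
    by apply/andP; apply: divz_bounds.
  have pw : (2 ^ t.+1)%N%:Z = (2 ^ t)%N%:Z * 2 by rewrite expnS mulnC PoszM.
  have T0 : 0 <= (2 ^ t)%N%:Z by [].
  case: ifP => _ h; rewrite /min_inv !seq_rowE /=.
    case: h => k1 k2 k3; split=> //.
    + by split; lia.
    + by exists (rsubmx q).
    + split=> //; apply: le_trans hT; rewrite pw -mulrA ler_wpM2l //; lia.
  split.
  + by split; lia.
  + move=> k fk; have := hlo k fk; case: (leP (s 0 1 + (s 0%R 0%R %/ 2)%Z) (\sum_j k 0 j)); last first.
      by move=> lt _; case: fk => f1 f2; case: (h k); split=> //; apply: ltW.
    rewrite le_eqVlt => /orP[/eqP E _|lt _]; last by rewrite lezD1.
    by case: fk => f1 f2; case: (h k); split=> //; rewrite E.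
  + by exists k0 => //; apply: le_trans sk0 _; lia.
  + split=> //; apply: le_trans hT; rewrite pw -mulrA ler_wpM2l //; lia.
have F0 x : 0 <= F x 0 1 by have [[t [[]]]] := sF x.
(* The loop yields only the minimal value [lo]; one more query with this bound produces a vector
   attaining it. *)
have [r' pr' sr'] := solve_bounded_sum pL (pF 0 1) F0.
exists (fun x => rsubmx (r' x)); first exact: pfm_rsub.
move=> x; have := sr' x; have [[t [[h1 h2 h3] hlo [k fk sk] _]] stop] := sF x.
have gz : F x 0 0 = 0 by lia.
rewrite gz addr0 in sk; rewrite /=; case: ifP => _; last by case: fk => f1 f2 /(_ k) [].
by case=> k1 k2 k3; split=> // k' fk'; apply: le_trans k2 (hlo _ fk').
Qed.
End Minimum.
(** * The algorithm of O'Hara *)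

Section LeastAction.
Variables (m : nat) (a b t : 'rV[int]_m).
Implicit Types k : 'rV[int]_m.

(** The state after each coordinate [j] has been fired [k 0 j] times. *)
Definition fired k : 'rV[int]_m := \row_j (t 0 j - b 0 j * k 0 j + a 0 j * k 0 (ordS j)).

Definition stable k := (forall j, 0 <= k 0 j) /\ forall j, fired k 0 j < b 0 j.

Lemma ohara_fired k j : ohara_fire a b (fired k) j = fired (k + delta_mx 0 j).
Proof.
apply/matrixP => i l; rewrite ord1 !mxE !eqxx /=.
have -> : (ordS l == j) = (l == ord_pred j).
  by apply/eqP/eqP => [<-|->]; rewrite ?ordSK ?ord_predK.
case: (eqVneq l j) => [->|_]; case: (eqVneq _ (ord_pred j)) => [<-|_] /=; ring.
Qed.

(* No run fires a coordinate more often than a stable vector allows. *)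
Lemma ohara_output_stable k : (forall j, 0 <= a 0 j) -> stable k ->
  (forall k', stable k' -> \sum_j k 0 j <= \sum_j k' 0 j) -> ohara_output a b t (fired k).
Proof.
move=> a0 [k0 sk] kmin.
suff run n : forall q : 'rV[int]_m, (forall j, 0 <= q 0 j <= k 0 j) ->
    \sum_j k 0 j - \sum_j q 0 j < n%:Z -> ohara_output a b (fired q) (fired k).
  have <- : fired 0 = t by apply/matrixP => i j; rewrite ord1 !mxE !mulr0 subr0 addr0.
  apply: (run (absz (\sum_j k 0 j)).+1); first by move=> j; rewrite mxE lexx k0.
  by rewrite (big1 _ _ (fun j => (0 : 'rV[int]_m) 0 j)) => [|j _]; [lia | rewrite mxE].
elim: n => [|n IH] q qk lt.
  have : \sum_j q 0 j <= \sum_j k 0 j by apply: ler_sum => j _; case/andP: (qk j).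
  by move: (\sum_j _) (\sum_j _) lt => *; lia.
case: (boolP [exists j, b 0 j <= fired q 0 j]) => [/existsP[j hj]|].
  (* If [q] and [k] agreed at [j], then [q <= k] at the next index would make the state at [j] no
     larger than for [k], where it is below [b 0 j]. *)
  have ltj : q 0 j < k 0 j.
    rewrite lt_neqAle (andP (qk j)).2 andbT; apply/eqP => E; have := sk j; move: hj; rewrite !mxE E.
    have : a 0 j * q 0 (ordS j) <= a 0 j * k 0 (ordS j) by rewrite ler_wpM2l // (andP (qk _)).2.
    lia.
  apply: (ohara_loop hj); rewrite ohara_fired; apply: IH => [l|].
    by rewrite !mxE eqxx /=; have /andP[] := qk l; case: (eqVneq l j) => [->|_] /=; lia.
  have -> : \sum_l (q + delta_mx 0 j) 0 l = \sum_l q 0 l + 1.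
    rewrite (eq_bigr (fun l => q 0 l + (l == j)%:R)) => [|l _]; last by rewrite !mxE eqxx.
    rewrite big_split /=; congr (_ + _); rewrite (bigD1 j) //= eqxx big1 ?addr0 // => l /negPf->.
    by [].
  by move: (\sum_l _) (\sum_l _) lt => *; lia.
rewrite negb_exists => /forallP st.
(* The run has stopped at a stable [q] below [k]. Minimality of the sum of [k] leaves no room
   between them. *)
have sq : stable q.
  by split=> j; [case/andP: (qk j) | rewrite ltNge st].
have le := kmin _ sq.
have -> : q = k; last by apply: ohara_stop => j; apply: sk.
apply/matrixP => i j; rewrite ord1; apply/eqP; rewrite eq_sym -subr_eq0.
have : \sum_j (k 0 j - q 0 j) == 0.
  rewrite eq_le sumr_ge0 => [|l _]; last by rewrite subr_ge0; case/andP: (qk l).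
  by rewrite big_split /= sumrN subr_le0 le.
rewrite psumr_eq0 => [/allP/(_ j)|l _]; last by rewrite subr_ge0; case/andP: (qk l).
by rewrite mem_index_enum => /(_ isT).
Qed.
End LeastAction.

Lemma pf_prod (c : ctx) (T : Type) (s : seq T) (F : T -> c -> int) :
  (forall i, pf (F i)) -> pf (fun x => \prod_(i <- s) F i x).
Proof.
move=> pF; elim: s => [|i s IH]; first by apply: pf_ext (pf_cst c 1) => x; rewrite big_nil.
by apply: pf_ext (pf_mul (pF i) IH) => x; rewrite big_cons.
Qed.

(** * The inputs of the algorithm as a context, and its constraints *)

Section Instances.
Variable m : nat.

Definition valid (p : 'rV[int]_m * 'rV[int]_m * 'rV[int]_m * 'rV[int]_m) :=
  let: (i, a, b, t) := p in
  [/\ forall j, 0 < i 0 j, forall j, 0 < a 0 j, forall j, 0 < b 0 j,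
      forall j, i 0 j * a 0 j = i 0 (ordS j) * b 0 (ordS j) & forall j, 0 <= t 0 j < a 0 j].

Definition in_i (p : {p | valid p}) := (sval p).1.1.1.
Definition in_a (p : {p | valid p}) := (sval p).1.1.2.
Definition in_b (p : {p | valid p}) := (sval p).1.2.
Definition in_t (p : {p | valid p}) := (sval p).2.

Lemma validP p : [/\ forall j, 0 < in_i p 0 j, forall j, 0 < in_a p 0 j, forall j, 0 < in_b p 0 j,
  forall j, in_i p 0 j * in_a p 0 j = in_i p 0 (ordS j) * in_b p 0 (ordS j)
  & forall j, 0 <= in_t p 0 j < in_a p 0 j].
Proof. by case: p => [[[[i a] b] t] /= h]. Qed.

Lemma size_entries (v : 'rV[int]_m) : size (entries v) = m.
Proof. by rewrite size_map size_enum_ord. Qed.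

Lemma nth_entries (v : 'rV[int]_m) (j : 'I_m) : (entries v)`_j = v 0 j.
Proof. by rewrite (nth_map j) ?nth_ord_enum ?size_enum_ord. Qed.

Definition ohara_ctx : ctx.
Proof.
apply: (@Ctx {p | valid p}
  (fun p => trunc_log 2 (largest_entry (in_i p) (in_a p) (in_b p) (in_t p))) (4 * m)
  (fun p => input_store (in_i p) (in_a p) (in_b p) (in_t p))).
exists 1%N => p r _; rewrite expn1 /input_store /largest_entry.
set s := _ ++ _; apply: (@leq_trans (trunc_log 2 (\max_(x <- s) `|x|)).+1); last by lia.
rewrite ltnS; apply: leq_trunc_log.
have [lt|ge] := ltnP r (size s); last by rewrite nth_default.
by have := mem_nth 0 lt => /(@leq_bigmax_seq _ _ xpredT (fun x : int => `|x|%N)); apply.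
Defined.

Lemma pfm_inputs : [/\ @pfm ohara_ctx _ _ in_i, @pfm ohara_ctx _ _ in_a,
  @pfm ohara_ctx _ _ in_b & @pfm ohara_ctx _ _ in_t].
Proof.
have key (f : ohara_ctx -> 'rV[int]_m) (e : nat) : (e < 4)%N ->
    (forall (x : ohara_ctx) (j : 'I_m), enc x (e * m + j)%N = f x 0 j) -> pfm f.
  move=> e4 h i j; rewrite ord1; refine (pf_ext _ (@pf_proj ohara_ctx (e * m + j)%N _)) => [x|].
    exact: h.
  by rewrite /=; have := ltn_ord j; nia.
split; [apply: (key _ 0%N)|apply: (key _ 1%N)|apply: (key _ 2)|apply: (key _ 3)] => // x j;
  rewrite /= /input_store !nth_cat !size_entries; have jm := ltn_ord j.
- by rewrite mul0n add0n jm nth_entries.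
- by rewrite ifF; [rewrite mul1n addKn jm nth_entries | lia].
- rewrite ifF; last by lia.
  rewrite ifF; last by lia.
  by rewrite mulSn mul1n -addnA !addKn jm nth_entries.
- rewrite ifF; last by lia.
  rewrite ifF; last by lia.
  rewrite ifF; last by lia.
  by rewrite !mulSn mul0n addn0 -!addnA !addKn nth_entries.
Qed.

(** Subtracting 1 turns the strict inequality of [stable] into a weak one, as all quantities are
    integers. Differences of unit vectors remain correct when [j] and [ordS j] coincide. *)
Definition stable_form (j : 'I_m) (x : ohara_ctx) : 'cV[int]_(1 + m) :=
  col_mx (in_b x 0 j - in_t x 0 j - 1)%:M
    (in_b x 0 j *: delta_mx j 0 - in_a x 0 j *: delta_mx (ordS j) 0).

Lemma stable_formP j x k :
  (0 <= lin (row_mx 1%:M k) (stable_form j x)) = (fired (in_a x) (in_b x) (in_t x) k 0 j < in_b x 0 j).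
Proof.
have -> : lin (row_mx 1%:M k) (stable_form j x)
    = in_b x 0 j - in_t x 0 j - 1 + in_b x 0 j * k 0 j - in_a x 0 j * k 0 (ordS j).
  rewrite /lin mul_row_col mul1mx mulmxBr -!scalemxAr -!colE !mxE mulr1n; ring.
have -> : fired (in_a x) (in_b x) (in_t x) k 0 j
    = in_t x 0 j - in_b x 0 j * k 0 j + in_a x 0 j * k 0 (ordS j) by rewrite mxE.
by move: (in_b x 0 j) (in_t x 0 j) (in_a x 0 j) (k 0 j) (k 0 (ordS j)) => *; apply/idP/idP; lia.
Qed.

(* With [c j = i j * b j], the multiples of [c j] next below a common multiple
   of all of them give a stable vector. *)
Lemma stable_exists (x : ohara_ctx) : exists2 k, stable (in_a x) (in_b x) (in_t x) k &
  \sum_j k 0 j <= m%:Z * \prod_l (in_i x 0 l * in_b x 0 l).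
Proof.
have [i0 a0 b0 ab ta] := validP x; pose w l := in_i x 0 l * in_b x 0 l.
have w0 l : 0 < w l by apply: mulr_gt0.
pose P j := \prod_(l | l != j) w l.
have P0 j : 0 < P j by apply: prodr_gt0.
have PE j : \prod_l w l = w j * P j by rewrite (bigD1 j).
exists (\row_j (P j - 1)); first split=> j.
- by rewrite mxE subr_ge0; have := P0 j; lia.
- rewrite !mxE -(ltr_pM2l (i0 j)).
  have E1 : w j * (P j - 1) = \prod_l w l - w j by rewrite mulrBr mulr1 -PE.
  have E2 : w (ordS j) * (P (ordS j) - 1) = \prod_l w l - w (ordS j) by rewrite mulrBr mulr1 -PE.
  have -> : in_i x 0 j * (in_t x 0 j - in_b x 0 j * (P j - 1) + in_a x 0 j * (P (ordS j) - 1))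
     = in_i x 0 j * in_t x 0 j - w j * (P j - 1) + w (ordS j) * (P (ordS j) - 1).
    by rewrite /w -ab; ring.
  rewrite E1 E2 -/(w j).
  have : in_i x 0 j * in_t x 0 j < w (ordS j) by rewrite /w -ab ltr_pM2l // (andP (ta j)).2.
  by move: (\prod_l _) => *; lia.
have -> : m%:Z * \prod_l w l = \sum_(j < m) \prod_l w l.
  by rewrite sumr_const card_ord -mulr_natl natz.
apply: ler_sum => j _; rewrite mxE (PE j); have := P0 j; have := w0 j; nia.
Qed.

Lemma pfm_ohara : exists2 F : ohara_ctx -> 'rV[int]_m, pfm F &
  forall x, ohara_output (in_a x) (in_b x) (in_t x) (F x).
Proof.
have [pi pa pb pt] := pfm_inputs.
have pL j : pfm (stable_form j).
  apply: pfm_col_mx.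
    by apply: pfm_scalar; apply: pf_sub; [apply: pf_sub | apply: pf_cst].
  by apply: pfm_sub; apply: pfm_scale => //; apply: pfm_cst.
pose U (x : ohara_ctx) : int := m%:Z * \prod_l (in_i x 0 l * in_b x 0 l).
have pU : pf U.
  by apply: pf_mul (pf_cst _ _) _; apply: pf_prod => l; apply: pf_mul.
have stP x k : stable (in_a x) (in_b x) (in_t x) k <->
    (forall j, 0 <= k 0 j) /\ forall j, 0 <= lin (row_mx 1%:M k) (stable_form j x).
  by split=> -[h1 h2]; split=> // j; move: (h2 j); rewrite stable_formP.
have [|F pF sF] := solve_min pL pU.
  by move=> x; have [k /stP hk le] := stable_exists x; exists k.
exists (fun x => fired (in_a x) (in_b x) (in_t x) (F x)).
  move=> i j; refine (pf_ext _ (pf_add (pf_sub (pt 0 j) (pf_mul (pb 0 j) (pF 0 j)))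
    (pf_mul (pa 0 j) (pF 0 (ordS j))))) => x; by rewrite mxE.
move=> x; have [i0 a0 b0 ab ta] := validP x; have [fF minF] := sF x.
apply: ohara_output_stable; first by move=> j; apply: ltW.
  by apply/stP.
by move=> k /stP; apply: minF.
Qed.
End Instances.

Theorem theorem3p10 (m : nat) (m_gt0 : (1 <= m)%N) :
  exists (P : prog) (p : {poly nat}),
    forall i a b t : 'rV[int]_m,
      (forall j, 0 < i 0 j) -> (forall j, 0 < a 0 j) -> (forall j, 0 < b 0 j) ->
      (forall j, i 0 j * a 0 j = i 0 (ordS j) * b 0 (ordS j)) ->
      (forall j, 0 <= t 0 j < a 0 j) ->
      exists (st : store) (n : nat),
        [/\ exec P (input_store i a b t) st n,
            ohara_output a b t (output_vec m st)
          & (n <= p.[trunc_log 2 (largest_entry i a b t)])%N].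
Proof.
have [F pF sF] := pfm_ohara m.
pose out r (x : ohara_ctx m) := if insub r is Some j then F x 0 j else 0.
have pout r : pf (out r) by rewrite /out; case: insubP => [j _ _|_]; [apply: pF | apply: pf_cst].
have [//|P [e hP]] := @pf_fam (ohara_ctx m) m out (fun r _ => pout r) id (4 * m)%N.
(* The results are computed above the [4 * m] input registers, as [pf] requires, and only at the end
   overwrite the registers where the output is read. *)
have [|Q hQ] := @exec_copies m (4 * m)%N 0%N; first by lia.
pose B (x : ohara_ctx m) := (\sum_(j < m) bits (F x 0%R j))%N.
have [E hE] : pbound sz (fun x : ohara_ctx m => (sz x + 2) ^ e + (m * B x + 1))%N.
  apply: pboundD; first by exists e.
  apply: pboundD (pbound_cst _ _); apply: pboundM; first exact: pbound_cst.
  by apply: pbound_sum => j; apply: pf_bits.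
exists (Seq P Q), (('X + 2%N%:P) ^+ E) => i a b t i0 a0 b0 ab ta.
have v : valid (i, a, b, t) by split.
pose x : ohara_ctx m := exist _ (i, a, b, t) v.
have [//|st1 [n1 [ex1 _ out1 le1]]] := hP x (input_store i a b t).
have outE (j : 'I_m) : out j x = F x 0 j by rewrite /out valK.
have out1' (j : 'I_m) : st1 (4 * m + j)%N = F x 0 j by rewrite out1 ?outE.
have [|st2 [n2 [ex2 _ out2 le2]]] := hQ st1 (B x).
  by move=> r rm; rewrite (out1' (Ordinal rm)) /B (bigD1 (Ordinal rm)) //= leq_addr.
exists st2, (n1 + n2)%N; split; first exact: exec_seq ex1 ex2.
  suff -> : output_vec m st2 = F x by apply: (sF x).
  by apply/matrixP => k j; rewrite ord1 mxE -[nat_of_ord j]add0n out2 ?out1'.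
rewrite horner_exp hornerD hornerX hornerC natrXE natrDE.
by apply: leq_trans (hE x); apply: leq_add.
Qed.
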